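(* Let $G$ be the closed set of $s=\sigma+it$ satisfying $$\sigma\le0,\qquad |s-1|\ge 5408\pi,\qquad t\ge-\tfrac{99}{20}(1-\sigma),\qquad (1-\sigma)^2\ge 225\pi t.$$ For $s\in G$ (with $\sigma<0$), $$\mathcal{R}(s)=-\chi(s)\eta^{s-1}e^{-\pi i\eta^2}\frac{\sqrt2\,e^{3\pi i/8}\sin\pi\eta}{2\cos 2\pi\eta}(1+U)\quad\text{with } |U|<0.9.$$ Consequently, the only zeros of $\mathcal{R}(s)$ in $G$ are the trivial zeros at the negative even integers lying in $G$, and these zeros are simple.
   Context: $\mathcal{R}(s)=\int_{0\swarrow 1}\frac{x^{-s}e^{\pi i x^2}}{e^{\pi i x}-e^{-\pi i x}}\,dx$ (Riemann's auxiliary function), where $0\swarrow1$ is a straight line of direction $e^{-3\pi i/4}$ crossing the real axis in $(0,1)$ and $x^{-s}$ is the principal branch. $\chi(s)=\pi^{s-1/2}\Gamma(\frac{1-s}{2})/\Gamma(\frac s2)$. $\eta:=\sqrt{(s-1)/(2\pi i)}$ with $-\pi/4<\arg\eta<3\pi/4$; $\eta^{s-1}$ is the principal power. *)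

(* Defs.v *)
From Stdlib Require Import Reals Arith.
From Coquelicot Require Import Coquelicot.
Open Scope R_scope.

(* Principal argument, with values in (-PI, PI]; Arg 0 = 0. *)
Definition Arg (z : C) : R :=
  let x := fst z in let y := snd z in
  if Rlt_dec 0 x then atan (y / x)
  else if Rlt_dec x 0 then
    (if Rle_dec 0 y then atan (y / x) + PI else atan (y / x) - PI)
  else if Rlt_dec 0 y then PI / 2
  else if Rlt_dec y 0 then - (PI / 2) else 0.

Definition Clog (z : C) : C := (ln (Cmod z), Arg z).

Definition Cexp (z : C) : C :=
  (exp (fst z) * cos (snd z), exp (fst z) * sin (snd z)).

Definition Cpowc (a b : C) : C := Cexp (b * Clog a)%C.

Definition Csin (z : C) : C :=
  ((Cexp (Ci * z) - Cexp (- (Ci * z))) / (2 * Ci))%C.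
Definition Ccos (z : C) : C :=
  ((Cexp (Ci * z) + Cexp (- (Ci * z))) / 2)%C.

Fixpoint rising_prod (z : C) (n : nat) : C :=
  match n with
  | O => z
  | S m => (rising_prod z m * (z + RtoC (INR (S m))))%C
  end.

Definition CLim_seq (u : nat -> C) : C :=
  (real (Lim_seq (fun n => fst (u n))), real (Lim_seq (fun n => snd (u n)))).

(* 1/Gamma(z) (an entire function), via Gauss' product formula
   Gamma(z) = lim n! n^z / (z (z+1) ... (z+n)). *)
Definition recipGamma (z : C) : C :=
  CLim_seq (fun n => (rising_prod z n / (RtoC (INR (Factorial.fact n)) * Cpowc (RtoC (INR n)) z))%C).

Definition CGamma (z : C) : C := Cinv (recipGamma z).

(* chi(s) = pi^(s-1/2) Gamma((1-s)/2) / Gamma(s/2), the division by Gamma(s/2)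
   being multiplication by the entire function 1/Gamma(s/2). *)
Definition chi (s : C) : C :=
  (Cpowc (RtoC PI) (s - RtoC (1/2)) * CGamma ((1 - s) / 2) * recipGamma (s / 2))%C.

Definition CRInt_line (f : R -> C) : C :=
  (RInt_gen (fun u => fst (f u)) (Rbar_locally m_infty) (Rbar_locally p_infty),
   RInt_gen (fun u => snd (f u)) (Rbar_locally m_infty) (Rbar_locally p_infty)).

Definition omega : C := Cexp (0%R, - (3 * PI / 4)).

Definition R_integrand (s x : C) : C :=
  (Cpowc x (- s) * Cexp (RtoC PI * Ci * x * x) /
     (Cexp (RtoC PI * Ci * x) - Cexp (- (RtoC PI * Ci * x))))%C.

(* Riemann's auxiliary function: integral along the straight line through 1/2
   with direction e^{-3 pi i/4}, x = 1/2 + u omega, dx = omega du. *)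
Definition Raux (s : C) : C :=
  CRInt_line (fun u => (R_integrand s (RtoC (1/2) + RtoC u * omega) * omega)%C).

Definition inG (s : C) : Prop :=
  let sigma := fst s in let t := snd s in
  sigma <= 0 /\ Cmod (s - 1)%C >= 5408 * PI /\
  t >= - (99 / 20) * (1 - sigma) /\ (1 - sigma) ^ 2 >= 225 * PI * t.

(* Main.v *)
Require Import Defs.
From Stdlib Require Import ZArith Reals Lra Lia Psatz Machin.
From Coquelicot Require Import Coquelicot.
Open Scope R_scope.

(** For [Re s < 0] the branch point at 0 is harmless, so the line of integration can be pulled
    to the origin; since the integrand takes the factor [- e^(pi i s)] under [x -> - x], one gets
    [R(s) = (e^(pi i s) - 1) J(s)], with [J(s)] the integral along a ray from 0 in the upper
    half-plane.  The first factor carries the trivial zeros.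

    The ray is deformed to pass through [eta - 1/4] in the direction [e^(pi i / 4)], where
    [x^(-s) e^(pi i x^2)] has its saddle point at [eta] and [1/(e^(pi i x) - e^(-pi i x))] behaves
    like [- e^(pi i x)], which moves the saddle by [- 1/4].  Comparison with an explicit Gaussian
    gives [J(s) = A / sqrt 2 (1 + e)] with [|e| <= 0.63], where [A = - e^(pi i / 8) eta^(-s)
    e^(pi i eta^2 + pi i eta)].

    Finally [chi s] is evaluated by Stirling's formula, obtained from Gauss' product for
    [1 / Gamma], and by the reflection formula, which exhibits the factor [sin(pi s / 2)] shared
    with [e^(pi i s) - 1]. *)

(** No contour is deformed directly. The integrand f has the primitive x * int_0^1 f(u x) du on a
    domain that is star-shaped towards 0, so integrals over paths become differences of this
    primitive; the path used runs straight from 0 to eta - 1/4 - e^(pi i / 4) and then along the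
    ray. The obstacle on the ray is the far range: the cubic Taylor error of the exponent eventually
    beats the Gaussian e^(-2 pi r^2), so a second, quadratic bound with a constant below 2 pi is
    needed as well. The inequalities defining G make both coordinates of eta at least 5 and |eta| at
    least 52. Then |e^(2 pi i eta)| <= 1/180, and sin(pi eta) / (2 cos(2 pi eta)) is (i/2) e^(pi i
    eta) up to a factor close to 1. The error of J dominates; Stirling's formula adds 0.04, and the
    total stays below 0.9. The zeros are read off from (e^(pi i s) - 1) J(s), where J cannot vanish
    because its relative error is below 1; for their simplicity a Lipschitz bound of J at s is
    enough. *)

Lemma C_eq (a b : C) : fst a = fst b -> snd a = snd b -> a = b.
Proof. destruct a, b; simpl; intros -> ->; reflexivity. Qed.

Lemma exp_le (x y : R) : x <= y -> exp x <= exp y.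
Proof. intros [H| ->]; [apply Rlt_le, exp_increasing, H|apply Rle_refl]. Qed.

Lemma Cmod_fst (z : C) : Rabs (fst z) <= Cmod z.
Proof. apply Rle_trans with (2 := Rmax_Cmod z). apply Rmax_l. Qed.

Lemma Cmod_snd (z : C) : Rabs (snd z) <= Cmod z.
Proof. apply Rle_trans with (2 := Rmax_Cmod z). apply Rmax_r. Qed.

Lemma Cmod_le_sum (z : C) : Cmod z <= Rabs (fst z) + Rabs (snd z).
Proof.
  unfold Cmod. apply Rsqr_incr_0_var.
  - rewrite Rsqr_sqrt by nra. unfold Rsqr.
    rewrite <- (pow2_abs (fst z)), <- (pow2_abs (snd z)).
    generalize (Rabs_pos (fst z)) (Rabs_pos (snd z)); nra.
  - generalize (Rabs_pos (fst z)) (Rabs_pos (snd z)); lra.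
Qed.

Lemma Cmod_sqr (z : C) : Cmod z * Cmod z = fst z ^ 2 + snd z ^ 2.
Proof. unfold Cmod. apply sqrt_sqrt. nra. Qed.

Lemma Cmod_ge_intro (z : C) (r : R) : 0 <= r -> r ^ 2 <= fst z ^ 2 + snd z ^ 2 -> r <= Cmod z.
Proof.
  intros Hr H. rewrite <- (sqrt_pow2 r Hr). apply sqrt_le_1_alt. exact H.
Qed.

Lemma Cmod_minus_sym (a b : C) : Cmod (a - b) = Cmod (b - a).
Proof. rewrite <- Cmod_opp. f_equal. ring. Qed.

Lemma Cmod_triangle_rev (a b : C) : Cmod a - Cmod b <= Cmod (a - b).
Proof.
  generalize (Cmod_triangle (a - b) b). replace (a - b + b)%C with a by ring. lra.
Qed.

Lemma Cmod_nonneg_R (r : R) : 0 <= r -> Cmod (RtoC r) = r.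
Proof. intros; rewrite Cmod_R; apply Rabs_pos_eq; assumption. Qed.

Lemma RtoC_neq_0 (r : R) : r <> 0 -> RtoC r <> 0%C.
Proof. intros H E; apply (f_equal fst) in E; exact (H E). Qed.

(** * The complex exponential and logarithm *)

Lemma Cexp_0 : Cexp 0 = 1%C.
Proof. unfold Cexp; simpl; rewrite exp_0, cos_0, sin_0; apply C_eq; simpl; ring. Qed.

Lemma Cexp_plus (a b : C) : Cexp (a + b) = (Cexp a * Cexp b)%C.
Proof.
  unfold Cexp; apply C_eq; simpl; rewrite exp_plus, ?cos_plus, ?sin_plus; ring.
Qed.

Lemma Cmod_Cexp (z : C) : Cmod (Cexp z) = exp (fst z).
Proof.
  unfold Cmod, Cexp; simpl.
  replace (_ + _) with (exp (fst z) ^ 2 * (sin (snd z) ^ 2 + cos (snd z) ^ 2)) by ring.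
  generalize (sin2_cos2 (snd z)); unfold Rsqr; intros H.
  replace (sin (snd z) ^ 2 + cos (snd z) ^ 2) with 1 by (rewrite <- H; ring).
  rewrite Rmult_1_r. apply sqrt_pow2. apply Rlt_le, exp_pos.
Qed.

Lemma Cexp_neq_0 (z : C) : Cexp z <> 0%C.
Proof.
  apply Cmod_gt_0. rewrite Cmod_Cexp. apply exp_pos.
Qed.

Lemma Cexp_opp (z : C) : Cexp (- z) = (/ Cexp z)%C.
Proof.
  assert (H : (Cexp z * Cexp (- z))%C = 1%C).
  { rewrite <- Cexp_plus. replace (z + - z)%C with (RtoC 0) by ring. apply Cexp_0. }
  generalize (Cexp_neq_0 z); intros Hz.
  replace (Cexp (- z)) with (/ Cexp z * (Cexp z * Cexp (- z)))%C by (field; exact Hz).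
  rewrite H; ring.
Qed.

Lemma Cexp_minus (a b : C) : Cexp (a - b) = (Cexp a / Cexp b)%C.
Proof. unfold Cminus, Cdiv. rewrite Cexp_plus, Cexp_opp. reflexivity. Qed.

Lemma Cexp_R (r : R) : Cexp (RtoC r) = RtoC (exp r).
Proof. unfold Cexp; apply C_eq; simpl; rewrite ?cos_0, ?sin_0; ring. Qed.

(** The plane cut along the nonpositive reals, on which [Clog] is continuous and can be
    differentiated along curves. *)
Definition slit (z : C) : Prop := 0 < fst z \/ snd z <> 0.

Lemma slit_neq_0 (z : C) : slit z -> z <> 0%C.
Proof. intros [H|H] E; rewrite E in H; simpl in H; lra. Qed.

Lemma Arg_right (z : C) : 0 < fst z -> Arg z = atan (snd z / fst z).
Proof. intros H; unfold Arg; destruct (Rlt_dec 0 (fst z)); [reflexivity|lra]. Qed.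

Lemma atan_inv_neg (x : R) : x < 0 -> atan (/ x) = - (PI / 2) - atan x.
Proof.
  intros H. generalize (atan_inv (- x)); intros E.
  specialize (E ltac:(lra)).
  replace (/ - x) with (- / x) in E by (field; lra). rewrite !atan_opp in E. lra.
Qed.

(** One formula for the whole half-plane, valid across the imaginary axis. With [Arg_right] and
    [Arg_lower] it gives three open charts covering [slit], from which the continuity and the
    derivative of [Arg] are obtained. *)
Lemma Arg_upper (z : C) : 0 < snd z -> Arg z = PI / 2 - atan (fst z / snd z).
Proof.
  intros H; unfold Arg.
  destruct (Rlt_dec 0 (fst z)) as [H1|H1].
  - replace (snd z / fst z) with (/ (fst z / snd z)) by (field; lra).
    apply atan_inv. apply Rdiv_lt_0_compat; lra.
  - destruct (Rlt_dec (fst z) 0) as [H2|H2].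
    + destruct (Rle_dec 0 (snd z)); [|lra].
      replace (snd z / fst z) with (/ (fst z / snd z)) by (field; lra).
      rewrite atan_inv_neg; [lra|].
      assert (0 < (- fst z) / snd z) by (apply Rdiv_lt_0_compat; lra).
      unfold Rdiv in *; lra.
    + destruct (Rlt_dec 0 (snd z)); [|lra].
      replace (fst z) with 0 by lra. unfold Rdiv; rewrite Rmult_0_l, atan_0; lra.
Qed.

Lemma Arg_lower (z : C) : snd z < 0 -> Arg z = - (PI / 2) - atan (fst z / snd z).
Proof.
  intros H; unfold Arg.
  destruct (Rlt_dec 0 (fst z)) as [H1|H1].
  - replace (snd z / fst z) with (/ (fst z / snd z)) by (field; lra).
    apply atan_inv_neg.
    assert (0 < fst z / (- snd z)) by (apply Rdiv_lt_0_compat; lra).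
    replace (fst z / snd z) with (- (fst z / - snd z)) by (field; lra). lra.
  - destruct (Rlt_dec (fst z) 0) as [H2|H2].
    + destruct (Rle_dec 0 (snd z)); [lra|].
      replace (snd z / fst z) with (/ (fst z / snd z)) by (field; lra).
      rewrite atan_inv; [lra|].
      replace (fst z / snd z) with ((- fst z) / (- snd z)) by (field; lra).
      apply Rdiv_lt_0_compat; lra.
    + destruct (Rlt_dec 0 (snd z)); [lra|].
      destruct (Rlt_dec (snd z) 0); [|lra].
      replace (fst z) with 0 by lra. unfold Rdiv; rewrite Rmult_0_l, atan_0; lra.
Qed.

Lemma Arg_bound (z : C) : - PI <= Arg z <= PI.
Proof.
  unfold Arg; generalize PI_RGT_0; intros HP.
  generalize (atan_bound (snd z / fst z)); intros HA.
  destruct (Rlt_dec 0 (fst z)); [lra|].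
  destruct (Rlt_dec (fst z) 0).
  - assert (E : snd z / fst z = - (snd z / - fst z)) by (field; lra).
    destruct (Rle_dec 0 (snd z)).
    + split; [lra|].
      assert (0 <= snd z / - fst z) by (apply Rdiv_le_0_compat; lra).
      assert (atan (snd z / fst z) <= 0).
      { destruct (Req_dec (snd z / fst z) 0) as [->|]; [rewrite atan_0; lra|].
        rewrite <- atan_0; apply Rlt_le, atan_increasing; lra. }
      lra.
    + assert (0 <= snd z / fst z).
      { replace (snd z / fst z) with ((- snd z) / (- fst z)) by (field; lra).
        apply Rdiv_le_0_compat; lra. }
      assert (0 <= atan (snd z / fst z)).
      { destruct (Req_dec (snd z / fst z) 0) as [->|]; [rewrite atan_0; lra|].
        rewrite <- atan_0; apply Rlt_le, atan_increasing; lra. }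
      lra.
  - destruct (Rlt_dec 0 (snd z)); [lra|]. destruct (Rlt_dec (snd z) 0); lra.
Qed.

Lemma Arg_first_quadrant (z : C) : 0 < fst z -> 0 < snd z -> 0 < Arg z < PI / 2.
Proof.
  intros H1 H2. rewrite Arg_right by assumption.
  generalize (atan_bound (snd z / fst z)); intros HA. split; [|lra].
  rewrite <- atan_0; apply atan_increasing, Rdiv_lt_0_compat; lra.
Qed.

Lemma Arg_upper_bound (z : C) : 0 < snd z -> 0 < Arg z < PI.
Proof.
  intros H. rewrite Arg_upper by assumption.
  generalize (atan_bound (fst z / snd z)); lra.
Qed.

Lemma Clog_Cexp (u : C) : - PI < snd u < PI -> Clog (Cexp u) = u.
Proof.
  intros Hu. unfold Clog. rewrite Cmod_Cexp, ln_exp. apply C_eq; [reflexivity|simpl].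
  generalize (exp_pos (fst u)); intros He. generalize PI_RGT_0; intros HP.
  assert (Hdiv : forall a b, b <> 0 -> exp (fst u) * a / (exp (fst u) * b) = a / b)
    by (intros; field; lra).
  (* The three ranges of the angle match the three charts of [Arg]. *)
  destruct (Rlt_dec (- (PI / 2)) (snd u)) as [H1|H1].
  - destruct (Rlt_dec (snd u) (PI / 2)) as [H2|H2].
    + assert (Hc : 0 < cos (snd u)) by (apply cos_gt_0; lra).
      rewrite Arg_right; simpl; [|apply Rmult_lt_0_compat; lra].
      rewrite Hdiv by lra. fold (tan (snd u)). apply atan_tan; lra.
    + assert (Hs : 0 < sin (snd u)) by (apply sin_gt_0; lra).
      rewrite Arg_upper; simpl; [|apply Rmult_lt_0_compat; lra].
      rewrite Hdiv by lra.
      replace (cos (snd u) / sin (snd u)) with (tan (PI / 2 - snd u)).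
      * rewrite atan_tan; lra.
      * unfold tan. rewrite sin_shift, cos_shift. reflexivity.
  - assert (Hs : sin (snd u) < 0).
    { rewrite <- (Ropp_involutive (snd u)), sin_neg.
      assert (0 < sin (- snd u)) by (apply sin_gt_0; lra). lra. }
    rewrite Arg_lower; simpl.
    2: { assert (0 < exp (fst u) * - sin (snd u)) by (apply Rmult_lt_0_compat; lra). lra. }
    rewrite Hdiv by lra.
    replace (cos (snd u) / sin (snd u)) with (tan (- (PI / 2) - snd u)).
    * rewrite atan_tan; lra.
    * unfold tan. replace (- (PI / 2) - snd u) with (- (PI/2 + snd u)) by ring.
      rewrite sin_neg, cos_neg, <- cos_sin.
      replace (cos (PI / 2 + snd u)) with (- sin (snd u)) by (rewrite sin_cos; ring).
      field; lra.
Qed.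

Lemma Cexp_Clog (z : C) : slit z -> Cexp (Clog z) = z.
Proof.
  intros Hz. assert (Hm : 0 < Cmod z) by (apply Cmod_gt_0, slit_neq_0, Hz).
  unfold Clog, Cexp; simpl. rewrite exp_ln by assumption.
  assert (Hk : forall x y : R, 0 < x -> sqrt (1 + (y / x)²) = sqrt (x ^ 2 + y ^ 2) / x).
  { intros x y Hx. apply (Rmult_eq_reg_r x); [|lra].
    replace (sqrt (x ^ 2 + y ^ 2) / x * x) with (sqrt (x ^ 2 + y ^ 2)) by (field; lra).
    rewrite <- (sqrt_pow2 x) at 2 by lra. rewrite <- sqrt_mult_alt.
    - f_equal. unfold Rsqr. field; lra.
    - unfold Rsqr; generalize (Rle_0_sqr (y/x)); unfold Rsqr; lra. }
  (* Polar coordinates in the right half-plane; the upper and lower charts reuse them with the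
     coordinates exchanged. *)
  assert (Hkey : forall x y : R, 0 < x -> sqrt (x ^ 2 + y ^ 2) * cos (atan (y / x)) = x
                      /\ sqrt (x ^ 2 + y ^ 2) * sin (atan (y / x)) = y).
  { intros x y Hx. rewrite cos_atan, sin_atan, Hk by assumption.
    assert (0 < sqrt (x ^ 2 + y ^ 2)) by (apply sqrt_lt_R0; nra).
    split; field; lra. }
  destruct Hz as [H|H].
  - rewrite Arg_right by assumption. destruct (Hkey (fst z) (snd z) H) as [A B].
    apply C_eq; simpl; assumption.
  - destruct (Rlt_dec 0 (snd z)) as [H1|H1].
    + rewrite Arg_upper by assumption. rewrite cos_shift, sin_shift.
      destruct (Hkey (snd z) (fst z) H1) as [A B].
      unfold Cmod. rewrite (Rplus_comm (fst z ^ 2)).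
      apply C_eq; simpl fst; simpl snd; [exact B|exact A].
    + assert (H2 : 0 < - snd z) by lra.
      rewrite Arg_lower by lra.
      destruct (Hkey (- snd z) (fst z) H2) as [A B].
      replace (fst z / snd z) with (- (fst z / - snd z)) by (field; lra).
      rewrite atan_opp.
      replace (- (PI / 2) - - atan (fst z / - snd z)) with (- (PI / 2 - atan (fst z / - snd z))) by ring.
      rewrite cos_neg, sin_neg, cos_shift, sin_shift.
      unfold Cmod. rewrite (Rplus_comm (fst z ^ 2)). replace (snd z ^ 2) with ((- snd z) ^ 2) by ring.
      apply C_eq; simpl fst; simpl snd; [exact B|].
      apply Ropp_eq_compat in A. rewrite Ropp_involutive in A.
      unfold pow in A. etransitivity; [|exact A]; ring.
Qed.

Lemma Clog_unique (u z : C) : Cexp u = z -> - PI < snd u < PI -> Clog z = u.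
Proof. intros <-; apply Clog_Cexp. Qed.

Lemma Clog_pos (r : R) : 0 < r -> Clog (RtoC r) = RtoC (ln r).
Proof.
  intros H. apply Clog_unique; simpl.
  - rewrite Cexp_R, exp_ln; auto.
  - generalize PI_RGT_0; lra.
Qed.

Lemma Arg_slit (z : C) : slit z -> - PI < Arg z < PI.
Proof.
  generalize PI_RGT_0; intros HP. intros [H|H].
  - rewrite Arg_right by assumption. generalize (atan_bound (snd z / fst z)); lra.
  - destruct (Rlt_dec 0 (snd z)).
    + rewrite Arg_upper by assumption. generalize (atan_bound (fst z / snd z)); lra.
    + rewrite Arg_lower by lra. generalize (atan_bound (fst z / snd z)); lra.
Qed.

Lemma Clog_scal (r : R) (z : C) :
  0 < r -> slit z -> Clog (RtoC r * z) = (RtoC (ln r) + Clog z)%C.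
Proof.
  intros Hr Hz. apply Clog_unique.
  - rewrite Cexp_plus, Cexp_R, exp_ln, Cexp_Clog; auto.
  - simpl. generalize (Arg_slit z Hz); lra.
Qed.

Lemma Cexp_piI : Cexp (RtoC PI * Ci) = (- (1))%C.
Proof.
  unfold Cexp; apply C_eq; simpl.
  - replace (PI * 0 - 0 * 1) with 0 by ring. replace (PI * 1 + 0 * 0) with PI by ring.
    rewrite exp_0, cos_PI; ring.
  - replace (PI * 0 - 0 * 1) with 0 by ring. replace (PI * 1 + 0 * 0) with PI by ring.
    rewrite exp_0, sin_PI; ring.
Qed.

Lemma Clog_opp_upper (z : C) : 0 < snd z -> Clog (- z) = (Clog z - RtoC PI * Ci)%C.
Proof.
  intros Hz. apply Clog_unique.
  - rewrite Cexp_minus, Cexp_piI, Cexp_Clog by (right; lra).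
    apply C_eq; simpl; field.
  - simpl. generalize (Arg_upper_bound z Hz); lra.
Qed.

(** * Limits and continuity of complex-valued functions *)

(** Convergence by components along an arbitrary filter, so that one set of rules serves sequences,
    points of the line and of the plane, and infinity. *)
Definition clim {T} (F : (T -> Prop) -> Prop) (A : T -> C) (L : C) : Prop :=
  filterlim (fun t => fst (A t)) F (locally (fst L)) /\
  filterlim (fun t => snd (A t)) F (locally (snd L)).

Section Clim.

Context {T : Type} {F : (T -> Prop) -> Prop} {FF : Filter F}.

Lemma rlim_plus (f g : T -> R) (a b : R) :
  filterlim f F (locally a) -> filterlim g F (locally b) ->
  filterlim (fun t => f t + g t) F (locally (a + b)).
Proof. intros Hf Hg; eapply filterlim_comp_2; [exact Hf|exact Hg|apply (filterlim_plus a b)]. Qed.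

Lemma rlim_mult (f g : T -> R) (a b : R) :
  filterlim f F (locally a) -> filterlim g F (locally b) ->
  filterlim (fun t => f t * g t) F (locally (a * b)).
Proof. intros Hf Hg; eapply filterlim_comp_2; [exact Hf|exact Hg|apply (filterlim_mult a b)]. Qed.

Lemma rlim_comp (h : R -> R) (f : T -> R) (a : R) :
  filterlim f F (locally a) -> continuous h a ->
  filterlim (fun t => h (f t)) F (locally (h a)).
Proof. intros Hf Hh; eapply filterlim_comp; [exact Hf|exact Hh]. Qed.

Lemma rlim_opp (f : T -> R) (a : R) :
  filterlim f F (locally a) -> filterlim (fun t => - f t) F (locally (- a)).
Proof. intros Hf; apply (rlim_comp Ropp f a Hf), (filterlim_opp a). Qed.

Lemma rlim_inv (f : T -> R) (a : R) :
  filterlim f F (locally a) -> a <> 0 -> filterlim (fun t => / f t) F (locally (/ a)).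
Proof.
  intros Hf Ha. apply (rlim_comp Rinv f a Hf). apply continuous_Rinv, Ha.
Qed.

Lemma rlim_const (a : R) : filterlim (fun _ : T => a) F (locally a).
Proof. apply filterlim_const. Qed.

Lemma rlim_sqr (f : T -> R) (a : R) :
  filterlim f F (locally a) -> filterlim (fun t => f t ^ 2) F (locally (a ^ 2)).
Proof.
  intros H. apply rlim_mult; [exact H|]. apply rlim_mult; [exact H|apply rlim_const].
Qed.

Lemma clim_const (c : C) : clim F (fun _ => c) c.
Proof. split; apply rlim_const. Qed.

Lemma clim_R (f : T -> R) (a : R) :
  filterlim f F (locally a) -> clim F (fun t => RtoC (f t)) (RtoC a).
Proof. intros H; split; simpl; [exact H|apply rlim_const]. Qed.

Lemma clim_plus (A B : T -> C) (a b : C) :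
  clim F A a -> clim F B b -> clim F (fun t => (A t + B t)%C) (a + b)%C.
Proof. intros [A1 A2] [B1 B2]; split; simpl; apply rlim_plus; assumption. Qed.

Lemma clim_opp (A : T -> C) (a : C) :
  clim F A a -> clim F (fun t => (- A t)%C) (- a)%C.
Proof. intros [A1 A2]; split; simpl; apply rlim_opp; assumption. Qed.

Lemma clim_minus (A B : T -> C) (a b : C) :
  clim F A a -> clim F B b -> clim F (fun t => (A t - B t)%C) (a - b)%C.
Proof. intros HA HB; apply clim_plus; [exact HA|apply clim_opp, HB]. Qed.

Lemma clim_mult (A B : T -> C) (a b : C) :
  clim F A a -> clim F B b -> clim F (fun t => (A t * B t)%C) (a * b)%C.
Proof.
  intros [A1 A2] [B1 B2]; split; simpl.
  - apply rlim_plus; [|apply rlim_opp]; apply rlim_mult; assumption.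
  - apply rlim_plus; apply rlim_mult; assumption.
Qed.

Lemma clim_inv (A : T -> C) (a : C) :
  clim F A a -> a <> 0%C -> clim F (fun t => (/ A t)%C) (/ a)%C.
Proof.
  intros [A1 A2] Ha.
  assert (Hn : fst a ^ 2 + snd a ^ 2 <> 0).
  { rewrite <- Cmod_sqr. apply Cmod_gt_0 in Ha. nra. }
  assert (Hd : filterlim (fun t => / (fst (A t) ^ 2 + snd (A t) ^ 2)) F
                 (locally (/ (fst a ^ 2 + snd a ^ 2)))).
  { apply rlim_inv; [|exact Hn].
    apply rlim_plus; apply rlim_sqr; assumption. }
  split; simpl; apply rlim_mult; auto using rlim_opp.
Qed.

Lemma clim_div (A B : T -> C) (a b : C) :
  clim F A a -> clim F B b -> b <> 0%C -> clim F (fun t => (A t / B t)%C) (a / b)%C.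
Proof. intros HA HB Hb; apply clim_mult; [exact HA|apply clim_inv; assumption]. Qed.

Lemma clim_exp (A : T -> C) (a : C) : clim F A a -> clim F (fun t => Cexp (A t)) (Cexp a).
Proof.
  intros [A1 A2]; split; simpl; apply rlim_mult;
    (apply rlim_comp; [assumption|]).
  - apply continuous_exp.
  - apply continuous_cos.
  - apply continuous_exp.
  - apply continuous_sin.
Qed.

Lemma rlim_sqrt (f : T -> R) (a : R) :
  filterlim f F (locally a) -> filterlim (fun t => sqrt (f t)) F (locally (sqrt a)).
Proof. intros H; apply (rlim_comp sqrt f a H), continuous_sqrt. Qed.

Lemma rlim_Cmod (A : T -> C) (a : C) :
  clim F A a -> filterlim (fun t => Cmod (A t)) F (locally (Cmod a)).
Proof.
  intros [A1 A2]. unfold Cmod. apply rlim_sqrt.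
  apply rlim_plus; apply rlim_sqr; assumption.
Qed.

Lemma rlim_ext_loc (f g : T -> R) (a : R) :
  F (fun t => f t = g t) -> filterlim f F (locally a) -> filterlim g F (locally a).
Proof. intros H; apply filterlim_ext_loc; exact H. Qed.

Lemma clim_ext_loc (A B : T -> C) (a : C) : F (fun t => A t = B t) -> clim F A a -> clim F B a.
Proof.
  intros H [A1 A2]; split; eapply rlim_ext_loc; eauto;
    (apply filter_imp with (2 := H); intros t ->; reflexivity).
Qed.

Lemma rlim_gt (f : T -> R) (a b : R) :
  filterlim f F (locally a) -> b < a -> F (fun t => b < f t).
Proof. intros H Hb. apply (H (fun y => b < y)). apply (open_gt b a Hb). Qed.

Lemma rlim_lt (f : T -> R) (a b : R) :
  filterlim f F (locally a) -> a < b -> F (fun t => f t < b).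
Proof. intros H Hb. apply (H (fun y => y < b)). apply (open_lt b a Hb). Qed.

Lemma rlim_Arg (A : T -> C) (a : C) :
  clim F A a -> slit a -> filterlim (fun t => Arg (A t)) F (locally (Arg a)).
Proof.
  intros [A1 A2] Ha.
  assert (Hat : forall f g (x y : R), filterlim f F (locally x) -> filterlim g F (locally y) ->
     y <> 0 -> filterlim (fun t => atan (f t / g t)) F (locally (atan (x / y)))).
  { intros f g x y Hf Hg Hy. apply rlim_comp; [|apply continuous_atan].
    apply rlim_mult; [exact Hf|apply rlim_inv; assumption]. }
  destruct Ha as [H|H].
  - rewrite Arg_right by assumption.
    apply rlim_ext_loc with (fun t => atan (snd (A t) / fst (A t))).
    + apply filter_imp with (2 := rlim_gt _ _ 0 A1 H).
      intros t Ht; rewrite Arg_right; auto.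
    + apply Hat; auto; lra.
  - destruct (Rlt_dec 0 (snd a)) as [H1|H1].
    + rewrite Arg_upper by assumption.
      apply rlim_ext_loc with (fun t => PI / 2 + - atan (fst (A t) / snd (A t))).
      * apply filter_imp with (2 := rlim_gt _ _ 0 A2 H1).
        intros t Ht; rewrite Arg_upper; auto.
      * apply rlim_plus; [apply rlim_const|]. apply rlim_opp, Hat; auto; lra.
    + assert (H2 : snd a < 0) by lra. rewrite Arg_lower by assumption.
      apply rlim_ext_loc with (fun t => - (PI / 2) + - atan (fst (A t) / snd (A t))).
      * apply filter_imp with (2 := rlim_lt _ _ 0 A2 H2).
        intros t Ht; rewrite Arg_lower; auto.
      * apply rlim_plus; [apply rlim_const|]. apply rlim_opp, Hat; auto; lra.
Qed.

Lemma clim_log (A : T -> C) (a : C) :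
  clim F A a -> slit a -> clim F (fun t => Clog (A t)) (Clog a).
Proof.
  intros HA Ha. split; simpl; [|apply rlim_Arg; assumption].
  apply rlim_comp; [apply rlim_Cmod, HA|].
  apply continuous_ln. apply Cmod_gt_0, slit_neq_0, Ha.
Qed.

Lemma clim_bound (A : T -> C) (L : C) (b : T -> R) :
  F (fun t => Cmod (A t - L) <= b t) -> filterlim b F (locally 0) -> clim F A L.
Proof.
  intros H Hb.
  assert (Hs : forall (pr : C -> R), (forall u v, pr (u - v)%C = pr u - pr v) ->
     (forall z, Rabs (pr z) <= Cmod z) ->
     filterlim (fun t => pr (A t)) F (locally (pr L))).
  { intros pr Hpr Hle. apply filterlim_locally. intros eps.
    assert (Hbe := rlim_lt _ _ eps Hb (cond_pos eps)).
    apply filter_imp with (2 := filter_and _ _ H Hbe).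
    intros t [H1 H2].
    change (Rabs (pr (A t) - pr L) < eps). rewrite <- Hpr.
    generalize (Hle (A t - L)%C); lra. }
  split; apply Hs; auto using Cmod_fst, Cmod_snd.
Qed.

Lemma ex_clim {PF : ProperFilter F} (A : T -> C) :
  (forall eps : posreal, exists P : T -> Prop, F P /\
     forall u v, P u -> P v -> Cmod (A v - A u) < eps) ->
  exists L, clim F A L.
Proof.
  intros HA.
  assert (Hex : forall pr : C -> R, (forall u v, pr (u - v)%C = pr u - pr v) ->
     (forall z, Rabs (pr z) <= Cmod z) ->
     exists l : R, filterlim (fun t => pr (A t)) F (locally l)).
  { intros pr Hp1 Hp2.
    apply (filterlim_locally_cauchy (U := R_CompleteSpace)).
    intros eps. destruct (HA eps) as [P [HP Hc]]. exists P. split; [exact HP|].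
    intros u v Hu Hv. change (Rabs (pr (A v) - pr (A u)) < eps).
    rewrite <- Hp1. apply Rle_lt_trans with (1 := Hp2 _). apply Hc; assumption. }
  destruct (Hex fst) as [l1 H1]; [reflexivity|apply Cmod_fst|].
  destruct (Hex snd) as [l2 H2]; [reflexivity|apply Cmod_snd|].
  exists (l1, l2). split; assumption.
Qed.

Lemma clim_Cmod_le {PF : ProperFilter' F} (A : T -> C) (a : C) (b : T -> R) (M : R) :
  clim F A a -> filterlim b F (locally M) -> F (fun t => Cmod (A t) <= b t) -> Cmod a <= M.
Proof.
  intros HA HM Hle. apply Rnot_lt_le; intros Hlt.
  set (m := (Cmod a + M) / 2).
  assert (H1 := rlim_gt _ _ m (rlim_Cmod _ _ HA) ltac:(unfold m; lra)).
  assert (H2 := rlim_lt _ _ m HM ltac:(unfold m; lra)).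
  apply (@filter_not_empty _ F PF).
  apply filter_imp with (2 := filter_and _ _ (filter_and _ _ H1 H2) Hle).
  intros t; lra.
Qed.

End Clim.

(** * Derivatives of complex curves *)

(** The analysis runs along real curves in the plane, with derivatives taken by components; complex
    differentiability itself appears only for [Raux] at a trivial zero. *)
Definition cder (A : R -> C) (r : R) (l : C) : Prop :=
  is_derive (fun u => fst (A u)) r (fst l) /\ is_derive (fun u => snd (A u)) r (snd l).

Lemma is_derive_eq (f : R -> R) (r a b : R) : is_derive f r a -> a = b -> is_derive f r b.
Proof. intros H <-; exact H. Qed.

(** For unspecified functions [auto_derive] leaves terms [Derive f x]; these are rewritten with the
    derivatives found in the context. The section below states the components of the complex rules
    for such functions. *)
Ltac derive_abstract :=
  auto_derive; [repeat split; try (eexists; eassumption); auto|];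
  repeat match goal with
         | H : is_derive ?f ?x ?l |- context [Derive ?g ?x] =>
             change (Derive g x) with (Derive f x); rewrite (is_derive_unique f x l H)
         end.

Section RealComponents.

Context (f g : R -> R) (r a b : R) (Hf : is_derive f r a) (Hg : is_derive g r b).

Lemma is_derive_mult_minus (h k : R -> R) (c d : R) :
  is_derive h r c -> is_derive k r d ->
  is_derive (fun u => f u * h u - g u * k u) r (a * h r - b * k r + (f r * c - g r * d)).
Proof. intros Hh Hk; derive_abstract; ring. Qed.

Lemma is_derive_mult_plus (h k : R -> R) (c d : R) :
  is_derive h r c -> is_derive k r d ->
  is_derive (fun u => f u * h u + g u * k u) r (a * h r + b * k r + (f r * c + g r * d)).
Proof. intros Hh Hk; derive_abstract; ring. Qed.

Lemma is_derive_exp_cos :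
  is_derive (fun u => exp (f u) * cos (g u)) r
    (a * (exp (f r) * cos (g r)) - b * (exp (f r) * sin (g r))).
Proof. derive_abstract; ring. Qed.

Lemma is_derive_exp_sin :
  is_derive (fun u => exp (f u) * sin (g u)) r
    (a * (exp (f r) * sin (g r)) + b * (exp (f r) * cos (g r))).
Proof. derive_abstract; ring. Qed.

Lemma is_derive_div_norm2 :
  0 < f r ^ 2 + g r ^ 2 ->
  is_derive (fun u => f u / (f u ^ 2 + g u ^ 2)) r
    ((a * (f r ^ 2 + g r ^ 2) - f r * (2 * f r * a + 2 * g r * b)) / (f r ^ 2 + g r ^ 2) ^ 2).
Proof. intros Hn; derive_abstract; [simpl in Hn; lra|]. field; simpl in *; lra. Qed.

Lemma is_derive_ln_norm :
  0 < f r ^ 2 + g r ^ 2 ->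
  is_derive (fun u => ln (sqrt (f u ^ 2 + g u ^ 2))) r
    ((f r * a + g r * b) / (f r ^ 2 + g r ^ 2)).
Proof.
  intros Hn. assert (Hs := sqrt_sqrt _ (Rlt_le _ _ Hn)). assert (Hp := sqrt_lt_R0 _ Hn).
  simpl in *. derive_abstract. set (q := sqrt _) in *.
  rewrite <- Hs. field; lra.
Qed.

Lemma is_derive_atan_div (c : R) :
  g r <> 0 ->
  is_derive (fun u => c - atan (f u / g u)) r
    ((f r * b - g r * a) / (f r ^ 2 + g r ^ 2)).
Proof.
  intros Hn; derive_abstract. unfold Rsqr.
  generalize (pow2_ge_0 (f r)) (pow2_gt_0 (g r) Hn); intros H1 H2.
  field. simpl in *. repeat split; lra.
Qed.

Lemma is_derive_lin_comb (h : R -> R) (c x y z : R) :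
  is_derive h r c ->
  is_derive (fun u => h u - (x * f u + y * g u) / z) r (c - (x * a + y * b) / z).
Proof. intros Hh; derive_abstract. unfold Rdiv; ring. Qed.

End RealComponents.

Section Cder.

Context (r : R).

Lemma cder_eq (A : R -> C) (l l' : C) : cder A r l -> l = l' -> cder A r l'.
Proof. intros H <-; exact H. Qed.

Lemma cder_ext (A B : R -> C) (l : C) : (forall u, A u = B u) -> cder A r l -> cder B r l.
Proof.
  intros H [H1 H2]; split; (eapply is_derive_ext; [|eassumption]); intros u; simpl; rewrite H; auto.
Qed.

Lemma cder_const (c : C) : cder (fun _ => c) r 0.
Proof. split; simpl; apply @is_derive_const. Qed.

Lemma cder_R (f : R -> R) (l : R) : is_derive f r l -> cder (fun u => RtoC (f u)) r (RtoC l).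
Proof. intros H; split; simpl; [exact H|apply @is_derive_const]. Qed.

Lemma cder_id : cder (fun u => RtoC u) r 1.
Proof. apply (cder_R (fun u => u)). apply @is_derive_id. Qed.

Lemma cder_plus (A B : R -> C) (a b : C) :
  cder A r a -> cder B r b -> cder (fun u => (A u + B u)%C) r (a + b)%C.
Proof. intros [A1 A2] [B1 B2]; split; simpl; apply @is_derive_plus; assumption. Qed.

Lemma cder_opp (A : R -> C) (a : C) : cder A r a -> cder (fun u => (- A u)%C) r (- a)%C.
Proof. intros [A1 A2]; split; simpl; apply @is_derive_opp; assumption. Qed.

Lemma cder_minus (A B : R -> C) (a b : C) :
  cder A r a -> cder B r b -> cder (fun u => (A u - B u)%C) r (a - b)%C.
Proof. intros HA HB; apply cder_plus; [exact HA|apply cder_opp, HB]. Qed.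

Lemma cder_mult (A B : R -> C) (a b : C) :
  cder A r a -> cder B r b -> cder (fun u => (A u * B u)%C) r (a * B r + A r * b)%C.
Proof.
  intros [A1 A2] [B1 B2]; split; simpl.
  - eapply is_derive_eq; [exact (is_derive_mult_minus _ _ _ _ _ A1 A2 _ _ _ _ B1 B2)|cbv beta]. ring.
  - eapply is_derive_eq; [exact (is_derive_mult_plus _ _ _ _ _ A1 A2 _ _ _ _ B2 B1)|cbv beta]. ring.
Qed.

Lemma cder_scal (A : R -> C) (a c : C) :
  cder A r a -> cder (fun u => (c * A u)%C) r (c * a)%C.
Proof.
  intros H. eapply cder_eq; [apply cder_mult; [apply cder_const|exact H]|]. cbv beta. ring.
Qed.

Lemma cder_line (x d : C) : cder (fun u => (x + RtoC u * d)%C) r d.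
Proof.
  eapply cder_eq.
  - apply cder_plus; [apply cder_const|]. apply cder_mult; [apply cder_id|apply cder_const].
  - cbv beta. ring.
Qed.

Lemma cder_exp (A : R -> C) (a : C) :
  cder A r a -> cder (fun u => Cexp (A u)) r (a * Cexp (A r))%C.
Proof.
  intros [A1 A2]; split; simpl.
  - exact (is_derive_exp_cos _ _ _ _ _ A1 A2).
  - eapply is_derive_eq; [exact (is_derive_exp_sin _ _ _ _ _ A1 A2)|cbv beta]. ring.
Qed.

Lemma norm2_pos (z : C) : z <> 0%C -> 0 < fst z ^ 2 + snd z ^ 2.
Proof. intros H; rewrite <- Cmod_sqr. apply Cmod_gt_0 in H. nra. Qed.

Lemma cder_inv (A : R -> C) (a : C) :
  cder A r a -> A r <> 0%C -> cder (fun u => (/ A u)%C) r (- a / (A r * A r))%C.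
Proof.
  intros [A1 A2] H. generalize (norm2_pos _ H); intros Hn.
  assert (Hd : forall x y, 0 < x ^ 2 + y ^ 2 -> (x * x - y * y) ^ 2 + (x * y + y * x) ^ 2 <> 0).
  { intros x y Hxy. replace ((x * x - y * y) ^ 2 + (x * y + y * x) ^ 2) with ((x ^ 2 + y ^ 2) ^ 2) by ring.
    apply pow_nonzero; lra. }
  specialize (Hd _ _ Hn).
  split.
  - eapply is_derive_eq; [exact (is_derive_div_norm2 _ _ _ _ _ A1 A2 Hn)|cbv beta].
    simpl in *. field; split; intros E; [apply Hd|apply (Rlt_not_eq _ _ Hn); symmetry]; rewrite <- E; simpl; ring.
  - assert (A2' := is_derive_opp _ _ _ A2).
    assert (Hn' : 0 < (fun u => opp (snd (A u))) r ^ 2 + (fun u => fst (A u)) r ^ 2)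
      by (unfold opp; simpl in *; lra).
    eapply is_derive_ext; [|eapply is_derive_eq; [exact (is_derive_div_norm2 _ _ _ _ _ A2' A1 Hn')|cbv beta]].
    + intros u; unfold opp; simpl. f_equal. ring.
    + unfold opp; simpl in *. field; split; intros E; [apply Hd|apply (Rlt_not_eq _ _ Hn); symmetry]; rewrite <- E; simpl; ring.
Qed.

Lemma cder_continuous (A : R -> C) (a : C) : cder A r a -> clim (locally r) A (A r).
Proof.
  intros [A1 A2]; split.
  - apply (ex_derive_continuous (fun u => fst (A u))). eexists; exact A1.
  - apply (ex_derive_continuous (fun u => snd (A u))). eexists; exact A2.
Qed.

Lemma cder_log (A : R -> C) (a : C) :
  cder A r a -> slit (A r) -> cder (fun u => Clog (A u)) r (a / A r)%C.
Proof.
  intros HA H. generalize (norm2_pos _ (slit_neq_0 _ H)); intros Hn.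
  generalize (cder_continuous A a HA); intros [C1 C2]. destruct HA as [A1 A2].
  split.
  - eapply is_derive_eq; [exact (is_derive_ln_norm _ _ _ _ _ A1 A2 Hn)|cbv beta].
    simpl in *; field; lra.
  - destruct H as [H|H].
    + apply is_derive_ext_loc with (fun u => opp (0 - atan (snd (A u) / fst (A u)))).
      { apply filter_imp with (2 := rlim_gt _ _ 0 C1 H).
        intros t Ht. unfold Clog, opp; simpl. rewrite Arg_right by exact Ht. ring. }
      eapply is_derive_eq; [exact (is_derive_opp _ _ _ (is_derive_atan_div _ _ _ _ _ A2 A1 0 (Rgt_not_eq _ _ H)))|cbv beta].
      unfold opp; simpl in *; field; lra.
    + destruct (Rlt_dec 0 (snd (A r))) as [H1|H1].
      * apply is_derive_ext_loc with (fun u => PI / 2 - atan (fst (A u) / snd (A u))).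
        { apply filter_imp with (2 := rlim_gt _ _ 0 C2 H1).
          intros t Ht. unfold Clog; simpl. rewrite Arg_upper by exact Ht. reflexivity. }
        eapply is_derive_eq; [exact (is_derive_atan_div _ _ _ _ _ A1 A2 (PI / 2) H)|cbv beta].
        simpl in *; field; lra.
      * apply is_derive_ext_loc with (fun u => - (PI / 2) - atan (fst (A u) / snd (A u))).
        { apply filter_imp with (2 := rlim_lt _ _ 0 C2 (ltac:(lra) : snd (A r) < 0)).
          intros t Ht. unfold Clog; simpl. rewrite Arg_lower by exact Ht. reflexivity. }
        eapply is_derive_eq; [exact (is_derive_atan_div _ _ _ _ _ A1 A2 (- (PI / 2)) H)|cbv beta].
        simpl in *; field; lra.
Qed.

End Cder.

(* Rotating the increment to the positive real axis reduces this to the monotonicity of a real function. *)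
Lemma cder_mean_value (A A' : R -> C) (B B' : R -> R) (a b : R) :
  a <= b ->
  (forall u, a <= u <= b -> cder A u (A' u)) ->
  (forall u, a <= u <= b -> is_derive B u (B' u)) ->
  (forall u, a <= u <= b -> Cmod (A' u) <= B' u) ->
  Cmod (A b - A a) <= B b - B a.
Proof.
  intros Hab HA HB Hle.
  set (D := (A b - A a)%C).
  destruct (Req_dec (Cmod D) 0) as [H0|H0].
  { rewrite H0. destruct Hab as [Hab| ->]; [|lra].
    destruct (MVT_gen B a b B') as [c [Hc E]].
    - intros x Hx; apply HB; rewrite Rmin_left, Rmax_right in Hx; lra.
    - intros x Hx; rewrite Rmin_left, Rmax_right in Hx by lra.
      apply continuity_pt_filterlim, (ex_derive_continuous B). eexists; apply HB; lra.
    - rewrite Rmin_left, Rmax_right in Hc by lra.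
      rewrite E. apply Rmult_le_pos; [|lra].
      apply Rle_trans with (2 := Hle c Hc). apply Cmod_ge_0. }
  assert (Hpos : 0 < Cmod D) by (generalize (Cmod_ge_0 D); lra).
  destruct Hab as [Hab| ->].
  2: { exfalso; apply H0. unfold D. replace (A b - A b)%C with (RtoC 0) by ring. apply Cmod_0. }
  set (phi := fun u => B u - (fst D * fst (A u) + snd D * snd (A u)) / Cmod D).
  set (phi' := fun u => B' u - (fst D * fst (A' u) + snd D * snd (A' u)) / Cmod D).
  assert (Hd : forall u, a <= u <= b -> is_derive phi u (phi' u)).
  { intros u Hu. destruct (HA u Hu) as [A1 A2]. specialize (HB u Hu).
    exact (is_derive_lin_comb _ _ _ _ _ A1 A2 _ _ (fst D) (snd D) (Cmod D) HB). }
  assert (Hp : forall u, a <= u <= b -> 0 <= phi' u).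
  { intros u Hu. unfold phi'.
    assert (Hcs : fst D * fst (A' u) + snd D * snd (A' u) <= Cmod D * Cmod (A' u)).
    { apply Rle_trans with (1 := Rle_abs _). rewrite <- Cmod_mult.
      replace (Cmod (D * A' u)) with (Cmod (Cconj D * A' u)%C) by (rewrite !Cmod_mult, Cmod_conj; auto).
      replace (fst D * fst (A' u) + snd D * snd (A' u)) with (fst (Cconj D * A' u)%C) by (simpl; ring).
      apply Cmod_fst. }
    assert ((fst D * fst (A' u) + snd D * snd (A' u)) / Cmod D <= Cmod (A' u)).
    { apply (Rmult_le_reg_r (Cmod D)); [assumption|].
      unfold Rdiv; rewrite Rmult_assoc, Rinv_l, Rmult_1_r by lra. lra. }
    generalize (Hle u Hu); lra. }
  destruct (MVT_gen phi a b phi') as [c [Hc E]].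
  - intros x Hx; apply Hd; rewrite Rmin_left, Rmax_right in Hx; lra.
  - intros x Hx; rewrite Rmin_left, Rmax_right in Hx by lra.
    apply continuity_pt_filterlim, (ex_derive_continuous phi). eexists; apply Hd; lra.
  - rewrite Rmin_left, Rmax_right in Hc by lra.
    assert (0 <= phi b - phi a) by (rewrite E; apply Rmult_le_pos; [apply Hp; lra|lra]).
    assert (E2 : (fst D * fst (A b) + snd D * snd (A b)) / Cmod D -
       (fst D * fst (A a) + snd D * snd (A a)) / Cmod D = Cmod D).
    { transitivity ((fst D ^ 2 + snd D ^ 2) / Cmod D).
      - assert (Ef : fst (A b) = fst D + fst (A a)) by (unfold D; simpl; ring).
        assert (Es : snd (A b) = snd D + snd (A a)) by (unfold D; simpl; ring).
        rewrite Ef, Es. field; lra.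
      - rewrite <- Cmod_sqr; field; lra. }
    unfold phi in H. lra.
Qed.

(** Replaces the bound by int_0^1 n u^k du without any integral. Applied to functions of u d with 0
    <= u <= 1, it yields the Taylor remainders needed below. *)
Lemma cder_unit_bound (A A' : R -> C) (n : R) (k : nat) :
  (forall u, 0 <= u <= 1 -> cder A u (A' u)) ->
  (forall u, 0 <= u <= 1 -> Cmod (A' u) <= n * u ^ k) ->
  Cmod (A 1 - A 0) <= n / INR (S k).
Proof.
  intros HA Hle.
  assert (Hk : 0 < INR (S k)) by (apply lt_0_INR; lia).
  set (B := fun u => n * u ^ S k / INR (S k)).
  replace (n / INR (S k)) with (B 1 - B 0)
    by (unfold B; rewrite pow1, pow_i by lia; field; lra).
  apply cder_mean_value with (A' := A') (B' := fun u => n * u ^ k); auto; [lra|].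
  intros u _. unfold B.
  assert (H : is_derive (fun u => u ^ S k) u (INR (S k) * 1 * u ^ k))
    by (apply (is_derive_pow (fun u => u) (S k) u 1), @is_derive_id).
  apply is_derive_ext with (fun u => n / INR (S k) * u ^ S k); [intros t; change (n / INR (S k) * t ^ S k = n * t ^ S k / INR (S k)); field; lra|].
  eapply is_derive_eq; [exact (is_derive_scal _ _ (n / INR (S k)) _ H)|]. field; lra.
Qed.

(** * Differentiation under the integral sign *)

(** The parameter derivative [phi' r] is assumed exact in v, with primitive [psi], so the derivative
    of the integral is a boundary term. Both path independence ([cder_R_prim]) and the Gaussian
    identity ([is_derive_gauss_aux]) take this form. *)
Lemma is_derive_param_RInt (phi phi' : R -> R -> R) (psi : R -> R) (r : R) :
  locally r (fun u => forall v, 0 <= v <= 1 -> is_derive (fun z => phi z v) u (phi' u v)) ->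
  (forall v, 0 <= v <= 1 ->
     locally (r, v) (fun z : R * R => is_derive (fun u => phi u (snd z)) (fst z) (phi' (fst z) (snd z)))) ->
  (forall v, 0 <= v <= 1 ->
     filterlim (fun z : R * R => phi' (fst z) (snd z)) (locally (r, v)) (locally (phi' r v))) ->
  locally r (fun u => forall v, 0 <= v <= 1 -> continuous (phi u) v) ->
  (forall v, 0 <= v <= 1 -> is_derive psi v (phi' r v)) ->
  is_derive (fun u => RInt (phi u) 0 1) r (psi 1 - psi 0).
Proof.
  intros H1 H2 H3 H4 H5.
  assert (E : RInt (fun v => Derive (fun u => phi u v) r) 0 1 = psi 1 - psi 0).
  { transitivity (RInt (phi' r) 0 1).
    - apply RInt_ext. intros v Hv. rewrite Rmin_left, Rmax_right in Hv by lra.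
      apply is_derive_unique. apply (locally_singleton _ _ H1). lra.
    - apply is_RInt_unique. apply (is_RInt_derive psi (phi' r)).
      + intros v Hv. rewrite Rmin_left, Rmax_right in Hv by lra. apply H5; lra.
      + intros v Hv. rewrite Rmin_left, Rmax_right in Hv by lra.
        specialize (H3 v ltac:(lra)).
        assert (Hc : filterlim (fun w : R => (r, w)) (locally v) (locally (r, v))).
        { intros P [eps HP]. exists eps. intros y Hy. apply HP. split; [apply ball_center|exact Hy]. }
        exact (filterlim_comp _ _ _ (fun w : R => (r, w)) (fun z : R * R => phi' (fst z) (snd z)) _ _ _ Hc H3). }
  rewrite <- E. apply is_derive_RInt_param.
  - apply filter_imp with (2 := H1). intros u Hu v Hv.
    rewrite Rmin_left, Rmax_right in Hv by lra. eexists; apply Hu; lra.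
  - intros v Hv. rewrite Rmin_left, Rmax_right in Hv by lra.
    apply continuity_2d_pt_filterlim.
    replace (Derive (fun z => phi z v) r) with (phi' r v).
    2: { symmetry; apply is_derive_unique. apply (locally_singleton _ _ H1). lra. }
    apply filterlim_ext_loc with (2 := H3 v Hv).
    apply filter_imp with (2 := H2 v Hv).
    intros z Hz. symmetry. apply is_derive_unique, Hz.
  - apply filter_imp with (2 := H4). intros u Hu.
    apply (ex_RInt_continuous (V := R_CompleteNormedModule) (phi u)).
    intros v Hv. rewrite Rmin_left, Rmax_right in Hv by lra. apply Hu; lra.
Qed.

Definition CRInt (h : R -> C) (a b : R) : C :=
  (RInt (fun v => fst (h v)) a b, RInt (fun v => snd (h v)) a b).

Lemma cder_param_CRInt (Phi Phi' : R -> R -> C) (Psi : R -> C) (r : R) :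
  locally r (fun u => forall v, 0 <= v <= 1 -> cder (fun z => Phi z v) u (Phi' u v)) ->
  (forall v, 0 <= v <= 1 ->
     locally (r, v) (fun z : R * R => cder (fun u => Phi u (snd z)) (fst z) (Phi' (fst z) (snd z)))) ->
  (forall v, 0 <= v <= 1 ->
     clim (locally (r, v)) (fun z : R * R => Phi' (fst z) (snd z)) (Phi' r v)) ->
  locally r (fun u => forall v, 0 <= v <= 1 -> clim (locally v) (Phi u) (Phi u v)) ->
  (forall v, 0 <= v <= 1 -> cder Psi v (Phi' r v)) ->
  cder (fun u => CRInt (Phi u) 0 1) r (Psi 1 - Psi 0).
Proof.
  intros H1 H2 H3 H4 H5. split.
  - apply (is_derive_param_RInt (fun u v => fst (Phi u v)) (fun u v => fst (Phi' u v)) (fun v => fst (Psi v))).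
    + apply filter_imp with (2 := H1); intros u Hu v Hv; apply (Hu v Hv).
    + intros v Hv; apply filter_imp with (2 := H2 v Hv); intros u Hu; apply Hu.
    + intros v Hv; apply (H3 v Hv).
    + apply filter_imp with (2 := H4); intros u Hu v Hv; apply (Hu v Hv).
    + intros v Hv; apply (H5 v Hv).
  - apply (is_derive_param_RInt (fun u v => snd (Phi u v)) (fun u v => snd (Phi' u v)) (fun v => snd (Psi v))).
    + apply filter_imp with (2 := H1); intros u Hu v Hv; apply (Hu v Hv).
    + intros v Hv; apply filter_imp with (2 := H2 v Hv); intros u Hu; apply Hu.
    + intros v Hv; apply (H3 v Hv).
    + apply filter_imp with (2 := H4); intros u Hu v Hv; apply (Hu v Hv).
    + intros v Hv; apply (H5 v Hv).
Qed.

(** * The integrand on the slit domain *)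

(** This is 2 i sin(pi x), and [cos_denom] is 2 cos(pi x). *)
Definition sin_denom (x : C) : C :=
  (Cexp (PI * Ci * x) - Cexp (- (PI * Ci * x)))%C.

Definition cos_denom (x : C) : C :=
  (Cexp (PI * Ci * x) + Cexp (- (PI * Ci * x)))%C.

Lemma R_integrand_unfold (s x : C) :
  R_integrand s x = (Cexp (- s * Clog x + PI * Ci * x * x) / sin_denom x)%C.
Proof. unfold R_integrand, Cpowc, sin_denom. rewrite Cexp_plus. reflexivity. Qed.

(** The identity |2 sin(a + i b)|^2 = (2 sinh b)^2 + 4 sin^2 a, which separates the two coordinates
    in the lower bounds that follow. *)
Lemma Cmod_sin_denom_sqr (x : C) :
  Cmod (sin_denom x) * Cmod (sin_denom x) =
  (exp (PI * snd x) - exp (- (PI * snd x))) ^ 2 + 4 * sin (PI * fst x) ^ 2.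
Proof.
  rewrite Cmod_sqr. unfold sin_denom, Cexp; simpl.
  set (p := exp (PI * snd x)). set (q := exp (- (PI * snd x))).
  replace (exp ((PI * 0 - 0 * 1) * fst x - (PI * 1 + 0 * 0) * snd x)) with q
    by (unfold q; f_equal; ring).
  replace (exp (- ((PI * 0 - 0 * 1) * fst x - (PI * 1 + 0 * 0) * snd x))) with p
    by (unfold p; f_equal; ring).
  replace ((PI * 0 - 0 * 1) * snd x + (PI * 1 + 0 * 0) * fst x) with (PI * fst x) by ring.
  rewrite cos_neg, sin_neg.
  assert (Hpq : p * q = 1) by (unfold p, q; rewrite <- exp_plus, Rplus_opp_r; apply exp_0).
  generalize (sin2_cos2 (PI * fst x)); unfold Rsqr; intros Hsc.
  set (c := cos _) in *; set (d := sin _) in *.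
  replace (_ + _) with ((p - q) ^ 2 * (d * d + c * c) + 4 * (p * q) * d ^ 2) by ring.
  rewrite Hsc, Hpq; ring.
Qed.

Lemma sin_denom_ge_sinh (x : C) :
  0 <= snd x -> exp (PI * snd x) - exp (- (PI * snd x)) <= Cmod (sin_denom x).
Proof.
  intros H. apply Rsqr_incr_0_var; [|apply Cmod_ge_0].
  unfold Rsqr. rewrite Cmod_sin_denom_sqr. generalize (pow2_ge_0 (sin (PI * fst x))). nra.
Qed.

Lemma exp_minus_exp_opp_ge (y : R) : 0 <= y -> 2 * y <= exp y - exp (- y).
Proof.
  intros Hy.
  destruct (MVT_gen (fun u => exp u - exp (- u)) 0 y (fun u => exp u + exp (- u))) as [c [Hc E]].
  - intros u _. auto_derive; [trivial|ring].
  - intros u _. apply continuity_pt_filterlim, (ex_derive_continuous (fun u => exp u - exp (- u))).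
    auto_derive; trivial.
  - rewrite Ropp_0, exp_0 in E.
    assert (Hcc : exp c * exp (- c) = 1) by (rewrite <- exp_plus, Rplus_opp_r; apply exp_0).
    generalize (exp_pos c) (exp_pos (- c)); intros.
    assert (2 <= exp c + exp (- c)).
    { generalize (pow2_ge_0 (exp c - exp (- c))); intros. apply Rnot_lt_le; intros; nra. }
    rewrite Rmin_left, Rmax_right in Hc by lra. nra.
Qed.

Lemma sin_ge_half (a : R) : 0 <= a <= PI / 4 -> a / 2 <= sin a.
Proof.
  intros Ha.
  destruct (MVT_gen sin 0 a cos) as [c [Hc E]].
  - intros u _. auto_derive; [trivial|ring].
  - intros u _. apply continuity_sin.
  - rewrite sin_0 in E. rewrite Rmin_left, Rmax_right in Hc by lra.
    assert (1 / 2 <= cos c).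
    { rewrite <- cos_PI3. generalize PI_RGT_0; intros. apply cos_decr_1; lra. }
    nra.
Qed.

(** Each coordinate of x is dominated by its own term of [Cmod_sin_denom_sqr]. The radius 1/4 keeps
    pi |fst x| within [0, pi/4], the range of [sin_ge_half]. *)
Lemma sin_denom_ge_Cmod (x : C) : Cmod x <= 1 / 4 -> Cmod x <= Cmod (sin_denom x).
Proof.
  intros Hx.
  generalize (Cmod_fst x) (Cmod_snd x); intros H1 H2.
  generalize PI_RGT_0 PI2_3_2; intros HP HP2.
  apply Rsqr_incr_0_var; [|apply Cmod_ge_0].
  unfold Rsqr. rewrite Cmod_sin_denom_sqr, Cmod_sqr.
  assert (A : fst x ^ 2 <= 4 * sin (PI * fst x) ^ 2).
  { assert (Hs : Rabs (fst x) <= 2 * Rabs (sin (PI * fst x))).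
    { unfold Rabs at 1; destruct (Rcase_abs (fst x)) as [Hn|Hn].
      - rewrite Rabs_left1 in H1 by lra.
        assert (Hg := sin_ge_half (PI * - fst x) ltac:(nra)).
        replace (PI * - fst x) with (- (PI * fst x)) in Hg by ring. rewrite sin_neg in Hg.
        rewrite Rabs_left1 by nra. nra.
      - rewrite Rabs_pos_eq in H1 by lra.
        assert (Hg := sin_ge_half (PI * fst x) ltac:(nra)).
        rewrite Rabs_pos_eq by nra. nra. }
    rewrite <- (pow2_abs (fst x)), <- (pow2_abs (sin _)).
    generalize (Rabs_pos (fst x)) (Rabs_pos (sin (PI * fst x))); nra. }
  assert (B : snd x ^ 2 <= (exp (PI * snd x) - exp (- (PI * snd x))) ^ 2).
  { destruct (Rle_dec 0 (snd x)) as [Hn|Hn].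
    - assert (Hg := exp_minus_exp_opp_ge (PI * snd x) ltac:(nra)).
      apply pow_incr. split; [exact Hn|nra].
    - assert (Hg := exp_minus_exp_opp_ge (- (PI * snd x)) ltac:(nra)).
      rewrite Ropp_involutive in Hg.
      replace (snd x ^ 2) with ((- snd x) ^ 2) by ring.
      replace ((exp (PI * snd x) - exp (- (PI * snd x))) ^ 2)
        with ((exp (- (PI * snd x)) - exp (PI * snd x)) ^ 2) by ring.
      apply pow_incr. split; [lra|nra]. }
  lra.
Qed.

(** Both open half-planes joined through (0,1): this set avoids the branch cut and the poles at the
    integers, contains Riemann's line through 1/2, and is star-shaped towards 0, which provides a
    primitive. *)
Definition slit_domain (x : C) : Prop := snd x <> 0 \/ 0 < fst x < 1.

Lemma slit_domain_slit (x : C) : slit_domain x -> slit x.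
Proof. intros [H|H]; [right; exact H|left; lra]. Qed.

Lemma slit_domain_upper (x : C) : 0 < snd x -> slit_domain x.
Proof. intros H; left; lra. Qed.

Lemma slit_domain_sin_denom (x : C) : slit_domain x -> sin_denom x <> 0%C.
Proof.
  intros Hx E. generalize (Cmod_sin_denom_sqr x). rewrite E, Cmod_0, Rmult_0_l. intros H.
  generalize PI_RGT_0; intros HP.
  set (u := exp (PI * snd x) - exp (- (PI * snd x))) in *.
  set (v := sin (PI * fst x)) in *.
  assert (Hu : u = 0) by nra. assert (Hv : v = 0) by nra.
  destruct Hx as [Hx|Hx].
  - apply Hx. assert (exp (PI * snd x) = exp (- (PI * snd x))) by (unfold u in Hu; lra).
    apply exp_inv in H0. nra.
  - assert (0 < v) by (apply sin_gt_0; nra). lra.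
Qed.

Lemma slit_domain_scale (x : C) (c : R) : slit_domain x -> 0 < c <= 1 -> slit_domain (RtoC c * x)%C.
Proof.
  intros [H|H] Hc; unfold slit_domain; simpl.
  - left. replace (c * snd x + 0 * fst x) with (c * snd x) by ring.
    apply Rmult_integral_contrapositive; lra.
  - destruct (Req_dec (snd x) 0) as [E|E].
    + right. rewrite E. nra.
    + left. replace (c * snd x + 0 * fst x) with (c * snd x) by ring.
      apply Rmult_integral_contrapositive; lra.
Qed.

Lemma slit_domain_clim {T} {F : (T -> Prop) -> Prop} {FF : Filter F} (A : T -> C) (a : C) :
  clim F A a -> slit_domain a -> F (fun t => slit_domain (A t)).
Proof.
  intros [A1 A2] [H|H].
  - destruct (Rlt_dec 0 (snd a)) as [H1|H1].
    + apply filter_imp with (2 := rlim_gt _ _ 0 A2 H1). intros t Ht; left; lra.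
    + apply filter_imp with (2 := rlim_lt _ _ 0 A2 (ltac:(lra) : snd a < 0)). intros t Ht; left; lra.
  - apply filter_imp with (2 := filter_and _ _ (rlim_gt _ _ 0 A1 (proj1 H)) (rlim_lt _ _ 1 A1 (proj2 H))).
    intros t Ht; right; lra.
Qed.

Lemma clim_sin_denom {T} {F : (T -> Prop) -> Prop} {FF : Filter F} (A : T -> C) (a : C) :
  clim F A a -> clim F (fun t => sin_denom (A t)) (sin_denom a).
Proof.
  intros H; unfold sin_denom.
  apply clim_minus; apply clim_exp; [|apply clim_opp]; apply clim_mult; auto using clim_const.
Qed.

Lemma clim_cos_denom {T} {F : (T -> Prop) -> Prop} {FF : Filter F} (A : T -> C) (a : C) :
  clim F A a -> clim F (fun t => cos_denom (A t)) (cos_denom a).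
Proof.
  intros H; unfold cos_denom.
  apply clim_plus; apply clim_exp; [|apply clim_opp]; apply clim_mult; auto using clim_const.
Qed.

Lemma clim_R_integrand {T} {F : (T -> Prop) -> Prop} {FF : Filter F} (s : C) (A : T -> C) (a : C) :
  clim F A a -> slit_domain a -> clim F (fun t => R_integrand s (A t)) (R_integrand s a).
Proof.
  intros H Ha. rewrite R_integrand_unfold.
  apply clim_ext_loc with (fun t => (Cexp (- s * Clog (A t) + PI * Ci * A t * A t) / sin_denom (A t))%C).
  { apply filter_forall. intros t; rewrite R_integrand_unfold; reflexivity. }
  apply clim_div; [|apply clim_sin_denom, H|apply slit_domain_sin_denom, Ha].
  apply clim_exp, clim_plus.
  - apply clim_mult; [apply clim_const|]. apply clim_log; [exact H|apply slit_domain_slit, Ha].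
  - apply clim_mult; [apply clim_mult; [apply clim_const|exact H]|exact H].
Qed.

(* The logarithmic derivative of the integrand, multiplied by [x]. *)
Definition R_logder (s x : C) : C :=
  (- s + 2 * PI * Ci * x * x - PI * Ci * x * (cos_denom x / sin_denom x))%C.

Lemma cder_R_integrand (s : C) (A : R -> C) (r : R) (a : C) :
  cder A r a -> slit_domain (A r) ->
  cder (fun u => R_integrand s (A u)) r (a * (R_integrand s (A r) * (R_logder s (A r) / A r)))%C.
Proof.
  intros HA HD.
  assert (Hs := slit_domain_slit _ HD). assert (H0 := slit_neq_0 _ Hs).
  assert (Hd := slit_domain_sin_denom _ HD).
  apply cder_ext with (fun u => (Cexp (- s * Clog (A u) + PI * Ci * A u * A u) * / sin_denom (A u))%C).
  { intros u; rewrite R_integrand_unfold; reflexivity. }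
  assert (Hden : cder (fun u => sin_denom (A u)) r (PI * Ci * a * cos_denom (A r))%C).
  { unfold sin_denom. eapply cder_eq.
    - apply cder_minus.
      + apply cder_exp. apply cder_scal. exact HA.
      + apply cder_exp. apply cder_opp. apply cder_scal. exact HA.
    - unfold cos_denom. ring. }
  eapply cder_eq.
  - apply cder_mult.
    + apply cder_exp. apply cder_plus.
      * apply cder_scal. apply cder_log; eassumption.
      * apply cder_mult; [apply cder_scal|]; exact HA.
    + apply cder_inv; [exact Hden|exact Hd].
  - cbv beta. rewrite R_integrand_unfold. unfold R_logder. field. split; assumption.
Qed.

(* The derivative of [x f(x)], where [f] is the integrand. *)
Definition R_radial (s x : C) : C := (R_integrand s x * (1 + R_logder s x))%C.

(** * Size of the integrand and of its radial derivative near the origin *)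

Lemma Cmod_R_integrand (s x : C) :
  sin_denom x <> 0%C ->
  Cmod (R_integrand s x) =
  exp (- fst s * ln (Cmod x) + snd s * Arg x - 2 * PI * fst x * snd x) / Cmod (sin_denom x).
Proof.
  intros H. rewrite R_integrand_unfold, Cmod_div by exact H. rewrite Cmod_Cexp.
  f_equal. f_equal. unfold Clog. simpl. ring.
Qed.

(** The convention [/ 0 = 0] decides the value at the common endpoint of all the segments, and
    allows the bounds near 0 to be stated without excluding 0. *)
Lemma R_integrand_0 (s : C) : R_integrand s 0 = 0%C.
Proof.
  assert (H : sin_denom 0 = 0%C).
  { unfold sin_denom. rewrite Cmult_0_r. replace (- (0))%C with (RtoC 0) by ring. ring. }
  rewrite R_integrand_unfold, H. unfold Cdiv.
  replace (/ 0)%C with (RtoC 0); [apply Cmult_0_r|].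
  apply C_eq; simpl; unfold Rdiv; ring.
Qed.

Lemma Arg_term_bound (t : R) (x : C) : t * Arg x <= Rabs t * PI.
Proof.
  apply Rle_trans with (1 := Rle_abs _). rewrite Rabs_mult.
  apply Rmult_le_compat_l; [apply Rabs_pos|]. apply Rabs_le, Arg_bound.
Qed.

(** Since [fst s <= -1], the power contributes |x|^(- fst s) <= |x|, which absorbs the simple zero
    of the sine at 0. *)
Lemma R_integrand_near_0 (s x : C) :
  fst s <= - 1 -> Cmod x <= 1 / 4 -> Cmod (R_integrand s x) <= exp (Rabs (snd s) * PI + 2 * PI).
Proof.
  intros Hs Hx. generalize PI_RGT_0; intros HP.
  destruct (Req_dec (Cmod x) 0) as [E|E].
  { apply Cmod_eq_0 in E; subst x. rewrite R_integrand_0, Cmod_0. apply Rlt_le, exp_pos. }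
  assert (H0 : 0 < Cmod x) by (generalize (Cmod_ge_0 x); lra).
  assert (Hd := sin_denom_ge_Cmod x Hx).
  assert (Hd0 : sin_denom x <> 0%C) by (apply Cmod_gt_0; lra).
  rewrite Cmod_R_integrand by assumption.
  apply (Rmult_le_reg_r (Cmod (sin_denom x))); [lra|].
  unfold Rdiv. rewrite Rmult_assoc, Rinv_l, Rmult_1_r by lra.
  apply Rle_trans with (exp (Rabs (snd s) * PI + 2 * PI) * Cmod x).
  2: { apply Rmult_le_compat_l; [apply Rlt_le, exp_pos|exact Hd]. }
  rewrite <- (exp_ln (Cmod x)) at 2 by assumption. rewrite <- exp_plus.
  apply exp_le.
  assert (ln (Cmod x) <= 0) by (rewrite <- ln_1; apply ln_le; lra).
  generalize (Arg_term_bound (snd s) x) (Cmod_fst x) (Cmod_snd x); intros H1 H2 H3.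
  assert (- (fst x * snd x) <= 1).
  { apply Rle_trans with (1 := Rle_abs _). rewrite Rabs_Ropp, Rabs_mult.
    generalize (Rabs_pos (fst x)) (Rabs_pos (snd x)); nra. }
  nra.
Qed.

Lemma Cmod_cos_denom_le (x : C) : Cmod x <= 1 / 4 -> Cmod (cos_denom x) <= 2 * exp PI.
Proof.
  intros Hx. generalize PI_RGT_0; intros HP.
  apply Rle_trans with (1 := Cmod_triangle _ _). rewrite !Cmod_Cexp. simpl.
  assert (Hb : - (1 / 4) <= snd x <= 1 / 4) by (generalize (Cmod_snd x); intros; apply Rabs_le_between; lra).
  assert (exp ((PI * 0 - 0 * 1) * fst x - (PI * 1 + 0 * 0) * snd x) <= exp PI) by (apply exp_le; nra).
  assert (exp (- ((PI * 0 - 0 * 1) * fst x - (PI * 1 + 0 * 0) * snd x)) <= exp PI) by (apply exp_le; nra).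
  lra.
Qed.

Lemma R_radial_near_0 (s : C) :
  fst s <= - 1 -> exists M, forall x, Cmod x <= 1 / 4 -> Cmod (R_radial s x) <= M.
Proof.
  intros Hs. generalize PI_RGT_0; intros HP.
  set (K := exp (Rabs (snd s) * PI + 2 * PI)).
  exists (K * (1 + (Cmod s + 2 * PI + PI * (2 * exp PI)))). intros x Hx.
  unfold R_radial. rewrite Cmod_mult.
  destruct (Req_dec (Cmod x) 0) as [E|E].
  { apply Cmod_eq_0 in E; subst x. rewrite R_integrand_0, Cmod_0, Rmult_0_l.
    apply Rmult_le_pos; [apply Rlt_le, exp_pos|].
    generalize (Cmod_ge_0 s) (exp_pos PI); intros; nra. }
  assert (H0 : 0 < Cmod x) by (generalize (Cmod_ge_0 x); lra).
  assert (Hd := sin_denom_ge_Cmod x Hx).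
  assert (Hd0 : sin_denom x <> 0%C) by (apply Cmod_gt_0; lra).
  apply Rmult_le_compat; try apply Cmod_ge_0.
  - apply R_integrand_near_0; assumption.
  - apply Rle_trans with (1 := Cmod_triangle _ _). rewrite Cmod_1. apply Rplus_le_compat_l.
    unfold R_logder, Cminus.
    apply Rle_trans with (1 := Cmod_triangle _ _). rewrite Cmod_opp.
    apply Rplus_le_compat.
    + apply Rle_trans with (1 := Cmod_triangle _ _). rewrite Cmod_opp. apply Rplus_le_compat_l.
      rewrite !Cmod_mult, Cmod_Ci, !Cmod_nonneg_R by lra.
      replace (2 * PI * 1 * Cmod x * Cmod x) with (2 * PI * (Cmod x * Cmod x)) by ring.
      assert (Cmod x * Cmod x <= 1) by nra. nra.
    + rewrite !Cmod_mult, Cmod_Ci, Cmod_div, Cmod_nonneg_R by (assumption || lra).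
      assert (Hc := Cmod_cos_denom_le x Hx).
      replace (PI * 1 * Cmod x * (Cmod (cos_denom x) / Cmod (sin_denom x)))
        with (PI * (Cmod (cos_denom x) * (Cmod x / Cmod (sin_denom x)))) by (field; lra).
      apply Rmult_le_compat_l; [lra|].
      assert (Hq : 0 <= Cmod x / Cmod (sin_denom x) <= 1).
      { split; [apply Rdiv_le_0_compat; lra|].
        apply (Rmult_le_reg_r (Cmod (sin_denom x))); [lra|].
        unfold Rdiv; rewrite Rmult_assoc, Rinv_l by lra. lra. }
      generalize (Cmod_ge_0 (cos_denom x)); nra.
Qed.

(* The substitution [v -> v^2] keeps the parameter nonnegative, so that the
   differentiation under the integral sign never meets the branch cut. *)
Definition R_scaled (s x : C) (v : R) : C :=
  (RtoC (2 * v) * (x * R_integrand s (RtoC (v * v) * x)))%C.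

(** The integral of the integrand along the segment from 0 to x, parametrized by v^2. *)
Definition R_prim (s x : C) : C := CRInt (R_scaled s x) 0 1.

Lemma clim_R_radial {T} {F : (T -> Prop) -> Prop} {FF : Filter F} (s : C) (A : T -> C) (a : C) :
  clim F A a -> slit_domain a -> clim F (fun t => R_radial s (A t)) (R_radial s a).
Proof.
  intros H Ha. unfold R_radial, R_logder.
  apply clim_mult; [apply clim_R_integrand; assumption|].
  apply clim_plus; [apply clim_const|].
  apply clim_minus.
  - apply clim_plus; [apply clim_const|].
    apply clim_mult; [apply clim_mult; [apply clim_const|exact H]|exact H].
  - apply clim_mult; [apply clim_mult; [apply clim_const|exact H]|].
    apply clim_div; [apply clim_cos_denom, H|apply clim_sin_denom, H|].
    apply slit_domain_sin_denom, Ha.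
Qed.

Lemma cder_R_scaled (s x d : C) (u v : R) :
  (v <> 0 -> slit_domain (RtoC (v * v) * (x + RtoC u * d))) ->
  cder (fun z => R_scaled s (x + RtoC z * d) v) u
    (RtoC (2 * v) * (d * R_radial s (RtoC (v * v) * (x + RtoC u * d))))%C.
Proof.
  intros HD. destruct (Req_dec v 0) as [->|Hv].
  - apply cder_ext with (fun _ => RtoC 0).
    { intros z; unfold R_scaled. rewrite Rmult_0_r. ring. }
    eapply cder_eq; [apply cder_const|]. rewrite (Rmult_0_r 2). ring.
  - specialize (HD Hv). unfold R_scaled.
    assert (H0 := slit_neq_0 _ (slit_domain_slit _ HD)).
    eapply cder_eq.
    + apply cder_scal. apply cder_mult; [apply cder_line|].
      apply cder_R_integrand; [apply cder_scal, cder_line|exact HD].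
    + unfold R_radial. cbv beta. set (X := (x + RtoC u * d)%C) in *.
      assert (HX : X <> 0%C) by (intros E; apply H0; rewrite E; ring).
      assert (Hc : RtoC (v * v) <> 0%C).
      { intros E; apply (f_equal fst) in E; simpl in E; nra. }
      set (f := R_integrand s _). set (g := R_logder s _). field. split; assumption.
Qed.

(** The right-hand side is the derivative of [R_scaled] in the direction d ([cder_R_scaled]). It is
    therefore exact in v, and integrating over [0,1] leaves only d times the integrand at X. *)
Lemma cder_square_R_integrand (s X d : C) (v : R) :
  fst s <= - 1 -> (v <> 0 -> slit_domain (RtoC (v * v) * X)) ->
  cder (fun z => (RtoC (z * z) * (d * R_integrand s (RtoC (z * z) * X)))%C) v
    (RtoC (2 * v) * (d * R_radial s (RtoC (v * v) * X)))%C.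
Proof.
  intros Hs HD. assert (Hsq : cder (fun z => RtoC (z * z)) v (RtoC (2 * v))).
  { apply cder_R. auto_derive; [trivial|ring]. }
  destruct (Req_dec v 0) as [->|Hv].
  (* At v = 0 the logarithm is not differentiable; there the function is O(v^2) by
     [R_integrand_near_0], so its derivative is 0. *)
  - set (K := exp (Rabs (snd s) * PI + 2 * PI)).
    assert (HK : 0 < K) by apply exp_pos.
    assert (Hsm : locally 0 (fun z => Cmod (RtoC (z * z) * X) <= 1 / 4)).
    { assert (Hl : filterlim (fun z : R => Cmod (RtoC (z * z) * X)) (locally 0) (locally (Cmod (RtoC (0 * 0) * X)))).
      { apply rlim_Cmod. apply clim_mult; [|apply clim_const]. apply (cder_continuous _ _ _ Hsq). }
      assert (H4 : Cmod (RtoC (0 * 0) * X) < 1 / 4).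
      { rewrite Rmult_0_l, Cmult_0_l, Cmod_0. lra. }
      apply filter_imp with (2 := rlim_lt _ _ _ Hl H4). intros; lra. }
    assert (Hb : forall pr : C -> R, (forall z, Rabs (pr z) <= Cmod z) ->
      pr 0%C = 0 ->
      is_derive (fun z : R => pr (RtoC (z * z) * (d * R_integrand s (RtoC (z * z) * X)))%C) 0 0).
    { intros pr Hpr Hp0. apply is_derive_Reals.
      intros eps Heps. destruct Hsm as [del Hdel].
      assert (Hd2 : 0 < eps / (Cmod d * K + 1)).
      { apply Rdiv_lt_0_compat; [exact Heps|]. generalize (Cmod_ge_0 d); nra. }
      assert (Hmin : 0 < Rmin del (eps / (Cmod d * K + 1))).
      { apply Rmin_case; [apply cond_pos|exact Hd2]. }
      exists (mkposreal _ Hmin). simpl. intros h Hh Hlt.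
      rewrite Rplus_0_l, Rmult_0_l, Cmult_0_l, Hp0, !Rminus_0_r.
      assert (L1 : Rabs h < del) by (apply Rlt_le_trans with (1 := Hlt), Rmin_l).
      assert (L2 : Rabs h < eps / (Cmod d * K + 1)) by (apply Rlt_le_trans with (1 := Hlt), Rmin_r).
      assert (Hf : Cmod (R_integrand s (RtoC (h * h) * X)) <= K).
      { apply R_integrand_near_0; [exact Hs|]. apply Hdel.
        change (Rabs (h - 0) < del). rewrite Rminus_0_r. exact L1. }
      unfold Rdiv. rewrite Rabs_mult, Rabs_inv by assumption.
      assert (Hah : 0 < Rabs h) by (apply Rabs_pos_lt; exact Hh).
      apply (Rmult_lt_reg_r (Rabs h)); [exact Hah|].
      rewrite Rmult_assoc, Rinv_l, Rmult_1_r by lra.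
      apply Rle_lt_trans with (1 := Hpr _).
      rewrite !Cmod_mult, Cmod_R, Rabs_mult.
      assert (L3 : Rabs h * (Cmod d * K + 1) < eps).
      { apply (Rmult_lt_reg_r (/ (Cmod d * K + 1))).
        - apply Rinv_0_lt_compat. generalize (Cmod_ge_0 d); nra.
        - rewrite Rmult_assoc, Rinv_r, Rmult_1_r; [exact L2|]. generalize (Cmod_ge_0 d); nra. }
      generalize (Cmod_ge_0 d) (Cmod_ge_0 (R_integrand s (RtoC (h * h) * X))); intros D0 F0.
      apply Rle_lt_trans with (Rabs h * (Rabs h * (Cmod d * K + 1))); [|nra].
      assert (Cmod d * Cmod (R_integrand s (RtoC (h * h) * X)) <= Cmod d * K + 1) by nra.
      rewrite Rmult_assoc. apply Rmult_le_compat_l; [lra|]. apply Rmult_le_compat_l; lra. }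
    replace (RtoC (2 * 0) * (d * R_radial s (RtoC (0 * 0) * X)))%C with (RtoC 0)
      by (rewrite (Rmult_0_r 2); ring).
    split; [apply (Hb fst)|apply (Hb snd)]; auto using Cmod_fst, Cmod_snd.
  - specialize (HD Hv). assert (H0 := slit_neq_0 _ (slit_domain_slit _ HD)).
    eapply cder_eq.
    + apply cder_mult; [exact Hsq|]. apply cder_scal.
      apply cder_R_integrand; [|exact HD].
      apply cder_mult; [exact Hsq|apply cder_const].
    + unfold R_radial. cbv beta.
      assert (HX : X <> 0%C) by (intros E; apply H0; rewrite E; ring).
      assert (Hc : RtoC (v * v) <> 0%C).
      { intros E; apply (f_equal fst) in E; simpl in E; nra. }
      set (f := R_integrand s _). set (g := R_logder s _). field. split; assumption.
Qed.

Lemma filterlim_fst_R (a b : R) : filterlim (fun z : R * R => fst z) (locally (a, b)) (locally a).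
Proof. intros P [eps HP]. exists eps. intros y Hy. apply HP, Hy. Qed.

Lemma filterlim_snd_R (a b : R) : filterlim (fun z : R * R => snd z) (locally (a, b)) (locally b).
Proof. intros P [eps HP]. exists eps. intros y Hy. apply HP, Hy. Qed.

Lemma clim_R_scaled (s Y : C) (v : R) :
  fst s <= - 1 -> slit_domain Y -> 0 <= v <= 1 -> clim (locally v) (R_scaled s Y) (R_scaled s Y v).
Proof.
  intros Hs Hu Hv. set (K := exp (Rabs (snd s) * PI + 2 * PI)).
  assert (HY : clim (locally v) (fun z : R => (RtoC (z * z) * Y)%C) (RtoC (v * v) * Y)%C).
  { apply clim_mult; [|apply clim_const]. apply clim_R.
    apply rlim_mult; apply filterlim_id. }
  unfold R_scaled. destruct (Req_dec v 0) as [->|Hv0].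
  * apply clim_bound with (fun z : R => Rabs z * (2 * (Cmod Y * K))).
    -- assert (Hsm : locally 0 (fun z : R => Cmod (RtoC (z * z) * Y) < 1 / 4)).
       { apply (rlim_lt _ _ (1 / 4) (rlim_Cmod _ _ HY)).
         rewrite Rmult_0_l, Cmult_0_l, Cmod_0; lra. }
       apply filter_imp with (2 := Hsm). intros z Hz.
       rewrite (Rmult_0_r 2). unfold Cminus. rewrite Cmult_0_l.
       replace (- (0))%C with (RtoC 0) by ring. rewrite Cplus_0_r.
       assert (Hk := R_integrand_near_0 s _ Hs (Rlt_le _ _ Hz)). fold K in Hk.
       rewrite !(Cmod_mult (RtoC (2 * z))), Cmod_mult, Cmod_R, Rabs_mult, (Rabs_pos_eq 2) by lra.
       generalize (Cmod_ge_0 Y) (Rabs_pos z); intros D0 Z0.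
       replace (2 * Rabs z * (Cmod Y * Cmod (R_integrand s (RtoC (z * z) * Y))))
         with (Rabs z * (2 * (Cmod Y * Cmod (R_integrand s (RtoC (z * z) * Y))))) by ring.
       apply Rmult_le_compat_l; [exact Z0|]. apply Rmult_le_compat_l; [lra|].
       apply Rmult_le_compat_l; [exact D0|]. exact Hk.
    -- replace 0 with (Rabs 0 * (2 * (Cmod Y * K))) at 2 by (rewrite Rabs_R0; ring).
       apply rlim_mult; [|apply rlim_const]. apply (continuous_Rabs 0).
  * apply clim_mult; [|apply clim_mult; [apply clim_const|]].
    -- apply clim_R, rlim_mult; [apply rlim_const|apply filterlim_id].
    -- apply clim_R_integrand; [apply HY|]. apply slit_domain_scale; [exact Hu|nra].
Qed.

(** The substitute for Cauchy's theorem: the integral over the segment from 0 is differentiated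
    under the integral sign, and the result collapses to the endpoint value of the integrand. *)
Lemma cder_R_prim (s x d : C) (r : R) :
  fst s <= - 1 -> slit_domain (x + RtoC r * d) ->
  cder (fun u => R_prim s (x + RtoC u * d)) r (d * R_integrand s (x + RtoC r * d))%C.
Proof.
  intros Hs HD. set (X := (x + RtoC r * d)%C) in *.
  destruct (R_radial_near_0 s Hs) as [M HM].
  assert (HX : forall v, clim (locally (r, v)) (fun z : R * R => (x + RtoC (fst z) * d)%C) X).
  { intros v. apply clim_plus; [apply clim_const|]. apply clim_mult; [|apply clim_const].
    apply clim_R, filterlim_fst_R. }
  assert (HvX : forall v, clim (locally (r, v)) (fun z : R * R => (RtoC (snd z * snd z) * (x + RtoC (fst z) * d))%C)
                (RtoC (v * v) * X)%C).
  { intros v. apply clim_mult; [|apply HX]. apply clim_R.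
    apply rlim_mult; apply filterlim_snd_R. }
  assert (Hloc : locally r (fun u => slit_domain (x + RtoC u * d))).
  { apply (slit_domain_clim (fun u => (x + RtoC u * d)%C) X); [|exact HD].
    exact (cder_continuous r _ _ (cder_line r x d)). }
  assert (Hsc : forall Y v, slit_domain Y -> 0 <= v <= 1 -> v <> 0 -> slit_domain (RtoC (v * v) * Y)).
  { intros Y v HY Hv Hv0. apply slit_domain_scale; [exact HY|nra]. }
  eapply cder_eq.
  - apply (cder_param_CRInt (fun u v => R_scaled s (x + RtoC u * d) v)
      (fun u v => (RtoC (2 * v) * (d * R_radial s (RtoC (v * v) * (x + RtoC u * d))))%C)
      (fun z => (RtoC (z * z) * (d * R_integrand s (RtoC (z * z) * X)))%C)).
    + apply filter_imp with (2 := Hloc). intros u Hu v Hv.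
      apply cder_R_scaled. intros Hv0. apply Hsc; assumption.
    + intros v Hv.
      assert (Hev : locally (r, v) (fun z : R * R => snd z <> 0 ->
                slit_domain (RtoC (snd z * snd z) * (x + RtoC (fst z) * d)))).
      (* For v = 0 the scaled point is 0, outside the domain; nearby points with nonzero second
         coordinate only need a scaling factor v^2 in (0,1], whatever the sign of v. *)
      { destruct (Req_dec v 0) as [->|Hv0].
        - assert (L1 : locally (r, 0) (fun z : R * R => slit_domain (x + RtoC (fst z) * d)))
            by exact (slit_domain_clim _ _ (HX 0) HD).
          assert (L2 : locally (r, 0) (fun z : R * R => snd z < 1))
            by (apply (rlim_lt _ 0 1 (filterlim_snd_R r 0)); lra).
          assert (L3 : locally (r, 0) (fun z : R * R => - 1 < snd z))
            by (apply (rlim_gt _ 0 (- 1) (filterlim_snd_R r 0)); lra).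
          apply filter_imp with (2 := filter_and _ _ L1 (filter_and _ _ L2 L3)).
          intros z [Z1 [Z2 Z3]] Z0. apply slit_domain_scale; [exact Z1|]. nra.
        - apply filter_imp with (2 := slit_domain_clim _ _ (HvX v) (Hsc X v HD Hv Hv0)).
          intros z Hz _; exact Hz. }
      apply filter_imp with (2 := Hev). intros z Hz. apply cder_R_scaled, Hz.
    + intros v Hv. destruct (Req_dec v 0) as [->|Hv0].
      (* The radial derivative need not have a limit at 0, but it is bounded there and multiplied by
         2 v. *)
      * apply clim_bound with (fun z : R * R => Rabs (snd z) * (2 * (Cmod d * M))).
        -- assert (Hsm : locally (r, 0) (fun z : R * R => Cmod (RtoC (snd z * snd z) * (x + RtoC (fst z) * d)) < 1 / 4)).
           { apply (rlim_lt _ _ (1 / 4) (rlim_Cmod _ _ (HvX 0))).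
             rewrite Rmult_0_l, Cmult_0_l, Cmod_0; lra. }
           apply filter_imp with (2 := Hsm). intros z Hz.
           rewrite (Rmult_0_r 2). unfold Cminus. rewrite Cmult_0_l.
           replace (- (0))%C with (RtoC 0) by ring. rewrite Cplus_0_r.
           rewrite !Cmod_mult, Cmod_R, Rabs_mult, (Rabs_pos_eq 2) by lra.
           specialize (HM _ (Rlt_le _ _ Hz)).
           generalize (Cmod_ge_0 d) (Rabs_pos (snd z)); intros D0 Z0.
           set (q := Cmod (R_radial _ _)) in *.
           replace (2 * Rabs (snd z) * (Cmod d * q)) with (Rabs (snd z) * (2 * (Cmod d * q))) by ring.
           apply Rmult_le_compat_l; [exact Z0|]. apply Rmult_le_compat_l; [lra|].
           apply Rmult_le_compat_l; [exact D0|exact HM].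
        -- replace 0 with (Rabs 0 * (2 * (Cmod d * M))) at 2 by (rewrite Rabs_R0; ring).
           apply rlim_mult; [|apply rlim_const].
           apply (rlim_comp Rabs _ 0 (filterlim_snd_R r 0)), continuous_Rabs.
      * apply clim_mult; [|apply clim_mult; [apply clim_const|]].
        -- apply clim_R, rlim_mult; [apply rlim_const|apply filterlim_snd_R].
        -- apply clim_R_radial; [apply HvX|]. apply Hsc; assumption.
    + apply filter_imp with (2 := Hloc). intros u Hu v Hv. apply clim_R_scaled; assumption.
    + intros v Hv. fold X. apply cder_square_R_integrand; [exact Hs|].
      intros Hv0. apply Hsc; assumption.
  - cbv beta. rewrite Rmult_1_l, Rmult_0_l, !Cmult_1_l. ring.
Qed.

(** * The primitive at infinity and Riemann's integral *)

Lemma CRInt_scal (c : C) (h : R -> C) (a b : R) :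
  ex_RInt (fun v => fst (h v)) a b -> ex_RInt (fun v => snd (h v)) a b ->
  CRInt (fun v => c * h v)%C a b = (c * CRInt h a b)%C.
Proof.
  intros H1 H2.
  assert (Hscal : forall k g, ex_RInt g a b -> is_RInt (fun v => k * g v) a b (k * RInt g a b)).
  { intros k g Hg. apply (is_RInt_scal (V := R_NormedModule) g a b k).
    apply (RInt_correct (V := R_CompleteNormedModule)), Hg. }
  unfold CRInt. apply C_eq; simpl; apply is_RInt_unique.
  - apply (is_RInt_minus (V := R_NormedModule) (fun v => fst c * fst (h v)) (fun v => snd c * snd (h v)));
      apply Hscal; assumption.
  - apply (is_RInt_plus (V := R_NormedModule) (fun v => fst c * snd (h v)) (fun v => snd c * fst (h v)));
      apply Hscal; assumption.
Qed.

(** The factor 2 comes from bounding the two components separately; the numerical constants below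
    have room for it. *)
Lemma CRInt_bound (h : R -> C) (g : R -> R) (a b I : R) :
  a <= b -> ex_RInt (fun v => fst (h v)) a b -> ex_RInt (fun v => snd (h v)) a b ->
  is_RInt g a b I -> (forall v, a < v < b -> Cmod (h v) <= g v) ->
  Cmod (CRInt h a b) <= 2 * I.
Proof.
  intros Hab E1 E2 HI Hb.
  assert (HIn := is_RInt_opp (V := R_NormedModule) _ _ _ _ HI).
  assert (Hc : forall k, ex_RInt k a b -> (forall v, Rabs (k v) <= Cmod (h v)) -> Rabs (RInt k a b) <= I).
  { intros k Hk Hkh. apply Rabs_le. rewrite <- (is_RInt_unique _ _ _ _ HI) at 2.
    replace (- I) with (RInt (fun v => opp (g v)) a b) by (apply (is_RInt_unique _ _ _ _ HIn)).
    split.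
    - apply RInt_le; [lra|eexists; exact HIn|exact Hk|].
      intros v Hv. specialize (Hb v Hv). specialize (Hkh v). apply Rabs_le_between in Hkh.
      unfold opp; simpl. lra.
    - apply RInt_le; [lra|exact Hk|eexists; exact HI|].
      intros v Hv. specialize (Hb v Hv). specialize (Hkh v). apply Rabs_le_between in Hkh. lra. }
  apply Rle_trans with (1 := Cmod_le_sum _).
  assert (A1 := Hc _ E1 (fun v => Cmod_fst (h v))).
  assert (A2 := Hc _ E2 (fun v => Cmod_snd (h v))).
  unfold CRInt. simpl fst; simpl snd. lra.
Qed.

(** From the upper half-plane, passing to - x subtracts pi i from the logarithm, whence e^(pi i s);
    the sign is that of the odd denominator. *)
Lemma R_integrand_opp (s x : C) :
  0 < snd x -> R_integrand s (- x) = (- (Cexp (PI * Ci * s) * R_integrand s x))%C.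
Proof.
  intros Hx. rewrite !R_integrand_unfold, Clog_opp_upper by assumption.
  assert (Hd := slit_domain_sin_denom x (slit_domain_upper x Hx)).
  assert (E : sin_denom (- x) = (- sin_denom x)%C).
  { unfold sin_denom. replace (PI * Ci * - x)%C with (- (PI * Ci * x))%C by ring.
    replace (- - (PI * Ci * x))%C with (PI * Ci * x)%C by ring. ring. }
  rewrite E.
  replace (- s * (Clog x - PI * Ci) + PI * Ci * - x * - x)%C
    with (PI * Ci * s + (- s * Clog x + PI * Ci * x * x))%C by ring.
  rewrite Cexp_plus. field. exact Hd.
Qed.

Lemma ex_RInt_R_scaled (s x : C) :
  fst s <= - 1 -> slit_domain x ->
  ex_RInt (fun v => fst (R_scaled s x v)) 0 1 /\ ex_RInt (fun v => snd (R_scaled s x v)) 0 1.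
Proof.
  intros Hs Hx.
  split; apply (ex_RInt_continuous (V := R_CompleteNormedModule));
    intros v Hv; rewrite Rmin_left, Rmax_right in Hv by lra;
    apply (clim_R_scaled s x v Hs Hx Hv).
Qed.

(** The sign in [R_integrand_opp] is cancelled by the factor x in [R_scaled]. *)
Lemma R_prim_opp (s x : C) :
  fst s <= - 1 -> 0 < snd x -> R_prim s (- x) = (Cexp (PI * Ci * s) * R_prim s x)%C.
Proof.
  intros Hs Hx. unfold R_prim.
  destruct (ex_RInt_R_scaled s x Hs (slit_domain_upper x Hx)) as [E1 E2].
  rewrite <- CRInt_scal by assumption.
  assert (E : forall v, R_scaled s (- x) v = (Cexp (PI * Ci * s) * R_scaled s x v)%C).
  { intros v. unfold R_scaled. destruct (Req_dec v 0) as [->|Hv].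
    - rewrite Rmult_0_r. ring.
    - replace (RtoC (v * v) * - x)%C with (- (RtoC (v * v) * x))%C by ring.
      rewrite R_integrand_opp; [ring|]. simpl.
      assert (0 < v * v) by nra. nra. }
  unfold CRInt. f_equal; apply RInt_ext; intros v _; rewrite E; reflexivity.
Qed.

Definition edir : C := Cexp (RtoC (PI / 4) * Ci).

Lemma edir_fst : fst edir = 1 / sqrt 2.
Proof.
  unfold edir, Cexp; simpl. replace (PI / 4 * 0 - 0 * 1) with 0 by ring.
  replace (PI / 4 * 1 + 0 * 0) with (PI / 4) by ring. rewrite exp_0, cos_PI4; ring.
Qed.

Lemma edir_snd : snd edir = 1 / sqrt 2.
Proof.
  unfold edir, Cexp; simpl. replace (PI / 4 * 0 - 0 * 1) with 0 by ring.
  replace (PI / 4 * 1 + 0 * 0) with (PI / 4) by ring. rewrite exp_0, sin_PI4; ring.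
Qed.

Lemma edir_eq : edir = (1 / sqrt 2, 1 / sqrt 2).
Proof. apply C_eq; [apply edir_fst|apply edir_snd]. Qed.

Lemma inv_sqrt2_bounds : 7 / 10 < 1 / sqrt 2 < 71 / 100.
Proof.
  assert (H := sqrt_sqrt 2 ltac:(lra)). assert (H0 := sqrt_lt_R0 2 ltac:(lra)).
  set (q := sqrt 2) in *.
  split; apply (Rmult_lt_reg_r q); try lra; unfold Rdiv; rewrite ?Rmult_assoc, ?Rinv_l by lra; nra.
Qed.

Lemma inv_sqrt2_sqr : 1 / sqrt 2 * (1 / sqrt 2) = 1 / 2.
Proof.
  assert (H := sqrt_sqrt 2 ltac:(lra)). assert (H0 := sqrt_lt_R0 2 ltac:(lra)).
  replace (1 / 2) with (1 / (sqrt 2 * sqrt 2)) by (rewrite H; reflexivity). field; lra.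
Qed.

Lemma edir_sqr : (edir * edir)%C = Ci.
Proof.
  rewrite edir_eq. apply C_eq; simpl; generalize inv_sqrt2_sqr; lra.
Qed.

Lemma Cmod_edir : Cmod edir = 1.
Proof. unfold edir. rewrite Cmod_Cexp. simpl. rewrite <- exp_0. f_equal; ring. Qed.

Lemma omega_edir : omega = (- edir)%C.
Proof.
  unfold omega, edir, Cexp. apply C_eq; simpl.
  - replace (- (3 * PI / 4)) with (PI / 4 - PI) by field.
    replace (PI / 4 * 0 - 0 * 1) with 0 by ring. replace (PI / 4 * 1 + 0 * 0) with (PI / 4) by ring.
    rewrite cos_minus, cos_PI, sin_PI. ring.
  - replace (- (3 * PI / 4)) with (PI / 4 - PI) by field.
    replace (PI / 4 * 0 - 0 * 1) with 0 by ring. replace (PI / 4 * 1 + 0 * 0) with (PI / 4) by ring.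
    rewrite sin_minus, cos_PI, sin_PI. ring.
Qed.

Lemma ln_le_self (y : R) : 0 < y -> ln y <= y.
Proof.
  intros Hy. rewrite <- (ln_exp y) at 2. apply ln_le; [exact Hy|].
  generalize (exp_ineq1_le y); lra.
Qed.

Lemma snd_line (c : C) (r : R) : snd (c + RtoC r * edir)%C = snd c + r * (1 / sqrt 2).
Proof. rewrite edir_eq; simpl. ring. Qed.

Lemma fst_line (c : C) (r : R) : fst (c + RtoC r * edir)%C = fst c + r * (1 / sqrt 2).
Proof. rewrite edir_eq; simpl. ring. Qed.

(** On lines of direction [edir] the factor e^(pi i x^2) has modulus e^(-2 pi fst x snd x), which is
    Gaussian in r. Uniformity in the offset c is what the comparison of parallel lines needs. *)
Lemma R_integrand_decay (s : C) (c0 : R) :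
  fst s <= - 1 -> 0 <= c0 ->
  exists M r0, 0 < r0 /\ 0 < M /\ forall c r, Cmod c <= c0 -> r0 <= r ->
    0 < snd (c + RtoC r * edir)%C /\ Cmod (R_integrand s (c + RtoC r * edir)) <= M * exp (- r).
Proof.
  intros Hs Hc0. generalize PI_RGT_0 PI2_3_2; intros HP HP2.
  set (B := - 2 * fst s).
  (* The condition r >= 5 c0 keeps both coordinates of the point above r / 2, since 0.7 r - c0 >= r
     / 2; the extra 2 keeps the denominator above 1. The term (B + 1)^2 / 6 is the maximum of (B +
     1) r - 3 r^2 / 2. *)
  exists (exp (Rabs (snd s) * PI + (B + 1) ^ 2 / 6)), (5 * c0 + 2).
  split; [lra|]. split; [apply exp_pos|]. intros c r Hc Hr.
  generalize inv_sqrt2_bounds; intros Hq.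
  set (x := (c + RtoC r * edir)%C).
  generalize (Cmod_fst c) (Cmod_snd c); intros C1 C2.
  assert (C1' : - c0 <= fst c) by (apply Rabs_le_between in C1; lra).
  assert (C2' : - c0 <= snd c) by (apply Rabs_le_between in C2; lra).
  assert (X1 : r / 2 <= fst x) by (unfold x; rewrite fst_line; nra).
  assert (X2 : r / 2 <= snd x) by (unfold x; rewrite snd_line; nra).
  split; [lra|].
  assert (Xm : Cmod x <= 2 * r).
  { unfold x. apply Rle_trans with (1 := Cmod_triangle _ _).
    rewrite Cmod_mult, Cmod_edir, Cmod_nonneg_R by lra. lra. }
  assert (Hd0 : sin_denom x <> 0%C) by (apply slit_domain_sin_denom, slit_domain_upper; lra).
  assert (Hd : 1 <= Cmod (sin_denom x)).
  { apply Rle_trans with (2 := sin_denom_ge_sinh x ltac:(lra)).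
    apply Rle_trans with (2 := exp_minus_exp_opp_ge (PI * snd x) ltac:(nra)). nra. }
  rewrite Cmod_R_integrand by assumption.
  apply Rle_trans with (exp (- fst s * ln (Cmod x) + snd s * Arg x - 2 * PI * fst x * snd x)).
  { unfold Rdiv. rewrite <- (Rmult_1_r (exp _)) at 2.
    apply Rmult_le_compat_l; [apply Rlt_le, exp_pos|]. rewrite <- Rinv_1.
    apply Rinv_le_contravar; lra. }
  rewrite <- exp_plus. apply exp_le.
  assert (Hx0 : 0 < Cmod x) by (generalize (Cmod_fst x) (Rle_abs (fst x)); lra).
  assert (L := ln_le_self _ Hx0).
  generalize (Arg_term_bound (snd s) x); intros HA.
  assert (A1 : - fst s * ln (Cmod x) <= B * r) by (unfold B; nra).
  assert (A2 : 3 / 2 * r ^ 2 <= 2 * PI * fst x * snd x).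
  { assert (r / 2 * (r / 2) <= fst x * snd x) by (apply Rmult_le_compat; lra). nra. }
  assert (A3 : B * r - 3 / 2 * r ^ 2 <= (B + 1) ^ 2 / 6 - r).
  { generalize (pow2_ge_0 (3 * r - (B + 1))). lra. }
  lra.
Qed.

Lemma R_prim_increment_bound (s x d : C) (M : R) :
  fst s <= - 1 -> (forall u, 0 <= u <= 1 -> slit_domain (x + RtoC u * d)) ->
  (forall u, 0 <= u <= 1 -> Cmod (R_integrand s (x + RtoC u * d)) <= M) ->
  Cmod (R_prim s (x + d) - R_prim s x) <= Cmod d * M.
Proof.
  intros Hs HD HM.
  replace (Cmod d * M) with (Cmod d * M / INR 1) by (simpl; field).
  replace (x + d)%C with (x + RtoC 1 * d)%C by ring.
  replace x with (x + RtoC 0 * d)%C at 2 by ring.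
  apply (cder_unit_bound (fun u => R_prim s (x + RtoC u * d)) (fun u => d * R_integrand s (x + RtoC u * d))%C).
  - intros u Hu. apply cder_R_prim; auto.
  - intros u Hu. rewrite pow_O, Rmult_1_r, Cmod_mult.
    apply Rmult_le_compat_l; [apply Cmod_ge_0|auto].
Qed.

Lemma ex_clim_cauchy (A : R -> C) (b : R -> R) (r0 : R) :
  (forall u v, r0 <= u <= v -> Cmod (A v - A u) <= b u) ->
  filterlim b (Rbar_locally p_infty) (locally 0) ->
  exists L, clim (Rbar_locally p_infty) A L.
Proof.
  intros HA Hb. apply ex_clim. intros eps.
  assert (Hev := rlim_lt _ _ (eps / 2) Hb ltac:(generalize (cond_pos eps); lra)).
  destruct Hev as [M HM].
  exists (fun u => Rmax r0 (M + 1) < u). split; [exists (Rmax r0 (M + 1)); auto|].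
  intros u v Hu Hv. set (w := Rmax r0 (M + 1)) in *.
  assert (W1 : r0 <= w) by apply Rmax_l. assert (W2 : M + 1 <= w) by apply Rmax_r.
  assert (Hw := HM w ltac:(lra)).
  replace (A v - A u)%C with ((A v - A w) - (A u - A w))%C by ring.
  apply Rle_lt_trans with (1 := Cmod_triangle _ _). rewrite Cmod_opp.
  generalize (HA w v ltac:(lra)) (HA w u ltac:(lra)). lra.
Qed.

Lemma exp_opp_lim : filterlim (fun r : R => exp (- r)) (Rbar_locally p_infty) (locally 0).
Proof.
  apply (filterlim_comp _ _ _ Ropp exp _ (Rbar_locally m_infty)).
  - apply (filterlim_Rbar_opp p_infty).
  - apply is_lim_exp_m.
Qed.

Lemma scal_exp_opp_lim (M : R) : filterlim (fun r : R => M * exp (- r)) (Rbar_locally p_infty) (locally 0).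
Proof.
  rewrite <- (Rmult_0_r M). apply rlim_mult; [apply rlim_const|apply exp_opp_lim].
Qed.

Definition CLim (A : R -> C) : C :=
  (real (Lim (fun r => fst (A r)) p_infty), real (Lim (fun r => snd (A r)) p_infty)).

Lemma CLim_unique (A : R -> C) (L : C) : clim (Rbar_locally p_infty) A L -> CLim A = L.
Proof.
  intros [L1 L2]. unfold CLim.
  rewrite (is_lim_unique (fun r => fst (A r)) p_infty (Finite (fst L)) L1).
  rewrite (is_lim_unique (fun r => snd (A r)) p_infty (Finite (snd L)) L2).
  destruct L; reflexivity.
Qed.

(* The integral [J(s)] along the ray from 0 in the direction [edir]. *)
Definition R_ray (s : C) : C := CLim (fun r => R_prim s (RtoC r * edir)).

(** The limit does not depend on c: the segment joining r [edir] to c + r [edir] contributes at most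
    |c| M e^(-r). This moves the ray to the one through eta - 1/4, and connects it with Riemann's
    line. *)
Lemma R_prim_lim (s c : C) :
  fst s <= - 1 -> clim (Rbar_locally p_infty) (fun r => R_prim s (c + RtoC r * edir)) (R_ray s).
Proof.
  intros Hs.
  assert (H0 : clim (Rbar_locally p_infty) (fun r => R_prim s (RtoC r * edir)) (R_ray s)).
  { destruct (R_integrand_decay s 0 Hs (Rle_refl 0)) as [M [r0 [Hr0 [HM Hdec]]]].
    destruct (ex_clim_cauchy (fun r => R_prim s (RtoC r * edir)) (fun r => M * exp (- r)) r0) as [L HL].
    - intros u v Huv.
      apply Rle_trans with (- M * exp (- v) - - M * exp (- u)).
      2: { generalize (exp_pos (- v)); nra. }
      apply cder_mean_value with (A := fun r => R_prim s (RtoC r * edir)) (B := fun r => - M * exp (- r))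
        (A' := fun r => (edir * R_integrand s (0 + RtoC r * edir))%C) (B' := fun r => M * exp (- r)); [lra| | |].
      + intros w Hw.
        apply cder_ext with (fun r => R_prim s (0 + RtoC r * edir)); [intros; rewrite Cplus_0_l; reflexivity|].
        apply cder_R_prim; [exact Hs|]. apply slit_domain_upper.
        apply (Hdec 0%C w); [rewrite Cmod_0; lra|lra].
      + intros w Hw. auto_derive; [trivial|ring].
      + intros w Hw. rewrite Cmod_mult, Cmod_edir, Rmult_1_l.
        apply Hdec; [rewrite Cmod_0; lra|lra].
    - apply scal_exp_opp_lim.
    - unfold R_ray. rewrite (CLim_unique _ L HL). exact HL. }
  destruct (R_integrand_decay s (Cmod c) Hs (Cmod_ge_0 c)) as [M [r0 [Hr0 [HM Hdec]]]].
  assert (Hd : clim (Rbar_locally p_infty)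
             (fun r => R_prim s (c + RtoC r * edir) - R_prim s (RtoC r * edir))%C 0).
  { apply clim_bound with (fun r => (Cmod c * M) * exp (- r)); [|apply scal_exp_opp_lim].
    exists r0. intros r Hr.
    replace (R_prim s (c + RtoC r * edir) - R_prim s (RtoC r * edir) - 0)%C
      with (R_prim s (RtoC r * edir + c) - R_prim s (RtoC r * edir))%C
      by (rewrite (Cplus_comm c); ring).
    rewrite Rmult_assoc.
    assert (Hpt : forall u, 0 <= u <= 1 -> 0 < snd (RtoC r * edir + RtoC u * c)%C /\
               Cmod (R_integrand s (RtoC r * edir + RtoC u * c)) <= M * exp (- r)).
    { intros u Hu. rewrite Cplus_comm. apply Hdec; [|lra].
      rewrite Cmod_mult, Cmod_nonneg_R by lra. generalize (Cmod_ge_0 c); nra. }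
    apply R_prim_increment_bound; [exact Hs| |].
    - intros u Hu. apply slit_domain_upper, Hpt, Hu.
    - intros u Hu. apply Hpt, Hu. }
  apply clim_ext_loc with (fun r => ((R_prim s (c + RtoC r * edir) - R_prim s (RtoC r * edir)) + R_prim s (RtoC r * edir))%C).
  { apply filter_forall. intros r; ring. }
  replace (R_ray s) with (0 + R_ray s)%C by ring. apply clim_plus; assumption.
Qed.

Lemma is_RInt_gen_primitive (f F : R -> R) (la lb : R) :
  (forall u, is_derive F u (f u)) -> (forall u, continuous f u) ->
  filterlim F (Rbar_locally m_infty) (locally la) ->
  filterlim F (Rbar_locally p_infty) (locally lb) ->
  RInt_gen f (Rbar_locally m_infty) (Rbar_locally p_infty) = lb - la.
Proof.
  intros HF Hf Ha Hb. apply is_RInt_gen_unique.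
  intros P HP. unfold filtermapi.
  assert (Hlim : filterlim (fun ab : R * R => F (snd ab) + - F (fst ab))
      (filter_prod (Rbar_locally m_infty) (Rbar_locally p_infty)) (locally (lb + - la))).
  { apply rlim_plus; [|apply rlim_opp].
    - apply (filterlim_comp _ _ _ snd F _ (Rbar_locally p_infty)); [apply filterlim_snd|exact Hb].
    - apply (filterlim_comp _ _ _ fst F _ (Rbar_locally m_infty)); [apply filterlim_fst|exact Ha]. }
  refine (filter_imp (fun ab : R * R => P (F (snd ab) + - F (fst ab))) _ _ (Hlim P HP)).
  intros ab Hab. exists (F (snd ab) + - F (fst ab)). split; [|exact Hab].
  apply (is_RInt_derive (V := R_CompleteNormedModule) F f); intros; auto.
Qed.

Theorem Raux_eq_ray (s : C) :
  fst s <= - 1 -> Raux s = ((Cexp (PI * Ci * s) - 1) * R_ray s)%C.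
Proof.
  intros Hs. generalize inv_sqrt2_bounds; intros Hq.
  set (F := fun u : R => R_prim s (RtoC (1 / 2) + RtoC u * omega)).
  set (f := fun u : R => (R_integrand s (RtoC (1 / 2) + RtoC u * omega) * omega)%C).
  assert (HD : forall u, slit_domain (RtoC (1 / 2) + RtoC u * omega)).
  { intros u. rewrite omega_edir. destruct (Req_dec u 0) as [->|Hu].
    - right. simpl. lra.
    - left. rewrite edir_eq; simpl. nra. }
  assert (HF : forall u, cder F u (f u)).
  { intros u. eapply cder_eq; [exact (cder_R_prim s (RtoC (1 / 2)) omega u Hs (HD u))|]. unfold f. ring. }
  assert (Hf : forall u, clim (locally u) f (f u)).
  { intros u. apply clim_mult; [|apply clim_const]. apply clim_R_integrand; [|apply HD].
    exact (cder_continuous u _ _ (cder_line u _ _)). }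
  (* Since [omega] is - [edir], the line descends to the lower left as u grows; reflection in 0
     carries this half to the line through -1/2 of direction [edir]. *)
  assert (Hb : clim (Rbar_locally p_infty) F (Cexp (PI * Ci * s) * R_ray s)%C).
  { apply clim_ext_loc with (fun r => (Cexp (PI * Ci * s) * R_prim s (- RtoC (1 / 2) + RtoC r * edir))%C).
    - exists 0. intros r Hr. unfold F. rewrite omega_edir.
      replace (RtoC (1 / 2) + RtoC r * - edir)%C with (- (- RtoC (1 / 2) + RtoC r * edir))%C by ring.
      symmetry. apply R_prim_opp; [exact Hs|]. rewrite snd_line. simpl. nra.
    - apply clim_mult; [apply clim_const|]. apply R_prim_lim, Hs. }
  (* As u tends to minus infinity the line rises to the upper right, parallel to the ray. *)
  assert (Ha : clim (Rbar_locally m_infty) F (R_ray s)).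
  { destruct (R_prim_lim s (RtoC (1 / 2)) Hs) as [A1 A2].
    assert (E : forall u, F u = R_prim s (RtoC (1 / 2) + RtoC (- u) * edir)).
    { intros u. unfold F. rewrite omega_edir, RtoC_opp. f_equal. ring. }
    split.
    - apply filterlim_ext with (fun u => fst (R_prim s (RtoC (1 / 2) + RtoC (- u) * edir)%C)).
      { intros u; rewrite E; reflexivity. }
      apply (filterlim_comp _ _ _ Ropp _ _ (Rbar_locally p_infty) _ (filterlim_Rbar_opp m_infty) A1).
    - apply filterlim_ext with (fun u => snd (R_prim s (RtoC (1 / 2) + RtoC (- u) * edir)%C)).
      { intros u; rewrite E; reflexivity. }
      apply (filterlim_comp _ _ _ Ropp _ _ (Rbar_locally p_infty) _ (filterlim_Rbar_opp m_infty) A2). }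
  replace ((Cexp (PI * Ci * s) - 1) * R_ray s)%C
    with (Cexp (PI * Ci * s) * R_ray s - R_ray s)%C by ring.
  unfold Raux, CRInt_line. fold f. rewrite (surjective_pairing (_ - R_ray s)%C). f_equal.
  - exact (is_RInt_gen_primitive (fun u => fst (f u)) (fun u => fst (F u)) _ _
      (fun u => proj1 (HF u)) (fun u => proj1 (Hf u)) (proj1 Ha) (proj1 Hb)).
  - exact (is_RInt_gen_primitive (fun u => snd (f u)) (fun u => snd (F u)) _ _
      (fun u => proj2 (HF u)) (fun u => proj2 (Hf u)) (proj2 Ha) (proj2 Hb)).
Qed.

Lemma PI_gt_3 : 3 < PI.
Proof. generalize PI2_3_2; lra. Qed.

(** The first partial sum of pi/4 = 2 arctan(1/3) + arctan(1/7) gives pi <= 68/21. *)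
Lemma PI_lt_324 : PI < 324 / 100.
Proof.
  generalize (proj2 (PI_2_3_7_ineq 0)). unfold tg_alt, PI_2_3_7_tg, Ratan_seq. simpl. lra.
Qed.

(** * The Gaussian integral *)

(** The exponent is the one left on the ray through the saddle point ([saddle_exponent]); the total
    mass is 1 / sqrt 2. *)
Definition gauss (r : R) : R := exp (- (2 * PI) * r ^ 2).

Definition gauss_prim (r : R) : R := RInt gauss 0 r.

Lemma continuous_gauss (r : R) : continuous gauss r.
Proof. apply (ex_derive_continuous gauss). unfold gauss. auto_derive; trivial. Qed.

Lemma is_derive_gauss_prim (r : R) : is_derive gauss_prim r (gauss r).
Proof.
  unfold gauss_prim. apply (is_derive_RInt gauss (RInt gauss 0) 0 r).
  - apply filter_forall. intros b. apply (RInt_correct (V := R_CompleteNormedModule)).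
    apply (ex_RInt_continuous (V := R_CompleteNormedModule)). intros; apply continuous_gauss.
  - apply continuous_gauss.
Qed.

Lemma gauss_prim_0 : gauss_prim 0 = 0.
Proof. apply (RInt_point (V := R_CompleteNormedModule)). Qed.

(* The function [gauss_prim r ^ 2 + gauss_aux r] is constant. *)
Definition gauss_aux (r : R) : R :=
  RInt (fun v => exp (- (2 * PI) * r ^ 2 * (1 + v ^ 2)) / (2 * PI * (1 + v ^ 2))) 0 1.

Lemma is_derive_gauss_aux (r : R) : is_derive gauss_aux r (- 2 * gauss r * gauss_prim r).
Proof.
  generalize PI_RGT_0; intros HP.
  assert (Hc : forall u v, continuous (fun w => exp (- (2 * PI) * u ^ 2 * (1 + w ^ 2)) / (2 * PI * (1 + w ^ 2))) v).
  { intros u v. apply (ex_derive_continuous (fun w => exp (- (2 * PI) * u ^ 2 * (1 + w ^ 2)) / (2 * PI * (1 + w ^ 2)))).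
    auto_derive. nra. }
  assert (Hd : forall u v, is_derive (fun z => exp (- (2 * PI) * z ^ 2 * (1 + v ^ 2)) / (2 * PI * (1 + v ^ 2))) u
      (- 2 * u * exp (- (2 * PI) * u ^ 2 * (1 + v ^ 2)))).
  { intros u v. assert (0 < 1 + v ^ 2) by nra. auto_derive; [nra|].
    replace (v * (v * 1)) with (v ^ 2) by ring. replace (u * (u * 1)) with (u ^ 2) by ring.
    field. lra. }
  eapply is_derive_eq.
  (* The exponential splits as [gauss r * gauss (r * v)], so the derivative in r is exact in v, with
     primitive built from [gauss_prim (r * v)]. *)
  - apply (is_derive_param_RInt (fun u v => exp (- (2 * PI) * u ^ 2 * (1 + v ^ 2)) / (2 * PI * (1 + v ^ 2)))
      (fun u v => - 2 * u * exp (- (2 * PI) * u ^ 2 * (1 + v ^ 2)))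
      (fun v => - 2 * gauss r * gauss_prim (r * v))).
    + apply filter_forall. intros u v _. apply Hd.
    + intros v _. apply filter_forall. intros z. apply Hd.
    + intros v _. apply rlim_mult.
      * apply rlim_mult; [apply rlim_const|apply filterlim_fst_R].
      * apply rlim_comp; [|apply continuous_exp].
        apply rlim_mult; [apply rlim_mult; [apply rlim_const|]|apply rlim_plus; [apply rlim_const|]];
          apply rlim_sqr; [apply filterlim_fst_R|apply filterlim_snd_R].
    + apply filter_forall. intros u v _. apply Hc.
    + intros v _.
      assert (H1 := is_derive_comp gauss_prim (fun v => r * v) v _ _ (is_derive_gauss_prim (r * v))
         (is_derive_scal (fun v => v) v r 1 (is_derive_id v))).
      eapply is_derive_eq; [exact (is_derive_scal _ _ (- 2 * gauss r) _ H1)|].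
      change (- 2 * gauss r * (r * 1 * gauss (r * v)) =
        - 2 * r * exp (- (2 * PI) * r ^ 2 * (1 + v ^ 2))).
      replace (exp (- (2 * PI) * r ^ 2 * (1 + v ^ 2))) with (gauss r * gauss (r * v)); [ring|].
      unfold gauss. rewrite <- exp_plus. f_equal. ring.
  - cbv beta. rewrite !Rmult_1_r, !Rmult_0_r, gauss_prim_0. ring.
Qed.

Lemma gauss_aux_0 : gauss_aux 0 = 1 / 8.
Proof.
  generalize PI_RGT_0; intros HP. unfold gauss_aux. apply is_RInt_unique.
  replace (1 / 8) with (atan 1 / (2 * PI) - atan 0 / (2 * PI)) by (rewrite atan_0, atan_1; field; lra).
  apply (is_RInt_derive (V := R_CompleteNormedModule) (fun v => atan v / (2 * PI))).
  - intros v _. auto_derive; [lra|].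
    replace (- (2 * PI) * 0 ^ 2 * (1 + v ^ 2)) with 0 by ring. rewrite exp_0. unfold Rsqr.
    field. split; nra.
  - intros v _.
    apply (ex_derive_continuous (fun w => exp (- (2 * PI) * 0 ^ 2 * (1 + w ^ 2)) / (2 * PI * (1 + w ^ 2)))).
    auto_derive. nra.
Qed.

Lemma gauss_prim_sqr (r : R) : gauss_prim r ^ 2 + gauss_aux r = 1 / 8.
Proof.
  set (H := fun r => gauss_prim r * gauss_prim r + gauss_aux r).
  assert (HD : forall u, is_derive H u 0).
  { intros u. unfold H.
    assert (D1 := is_derive_gauss_prim u). assert (D2 := is_derive_gauss_aux u).
    derive_abstract. ring. }
  assert (E : H r = H 0).
  { destruct (MVT_gen H 0 r (fun _ => 0)) as [c [_ Ec]].
    - intros; apply HD.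
    - intros x _. apply continuity_pt_filterlim, (ex_derive_continuous H). eexists; apply HD.
    - lra. }
  unfold H in E. rewrite gauss_prim_0, gauss_aux_0 in E. simpl. lra.
Qed.

Lemma gauss_aux_bound (r : R) : 0 <= gauss_aux r <= gauss r.
Proof.
  generalize PI_gt_3; intros HP. unfold gauss_aux.
  assert (Hex : ex_RInt (fun v => exp (- (2 * PI) * r ^ 2 * (1 + v ^ 2)) / (2 * PI * (1 + v ^ 2))) 0 1).
  { apply (ex_RInt_continuous (V := R_CompleteNormedModule)). intros v _.
    apply (ex_derive_continuous (fun w => exp (- (2 * PI) * r ^ 2 * (1 + w ^ 2)) / (2 * PI * (1 + w ^ 2)))).
    auto_derive. nra. }
  assert (Hp : forall v, 0 <= exp (- (2 * PI) * r ^ 2 * (1 + v ^ 2)) / (2 * PI * (1 + v ^ 2)) <= gauss r).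
  { intros v. assert (Hd : 1 <= 2 * PI * (1 + v ^ 2)) by nra.
    assert (He := exp_pos (- (2 * PI) * r ^ 2 * (1 + v ^ 2))).
    split; [apply Rdiv_le_0_compat; lra|].
    apply Rle_trans with (exp (- (2 * PI) * r ^ 2 * (1 + v ^ 2))).
    - apply (Rmult_le_reg_r (2 * PI * (1 + v ^ 2))); [lra|].
      unfold Rdiv; rewrite Rmult_assoc, Rinv_l, Rmult_1_r by lra. nra.
    - apply exp_le. assert (0 <= r ^ 2 * v ^ 2) by (apply Rmult_le_pos; apply pow2_ge_0). nra. }
  split.
  - apply RInt_ge_0; [lra|exact Hex|]. intros; apply Hp.
  - replace (gauss r) with (RInt (fun _ => gauss r) 0 1).
    + apply RInt_le; [lra|exact Hex|apply (ex_RInt_const (V := R_NormedModule))|]. intros; apply Hp.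
    + rewrite (RInt_const (V := R_CompleteNormedModule)). unfold scal; simpl; unfold mult; simpl. ring.
Qed.

Lemma gauss_prim_ge_0 (r : R) : 0 <= r -> 0 <= gauss_prim r.
Proof.
  intros Hr. apply RInt_ge_0; [exact Hr| |intros; apply Rlt_le, exp_pos].
  apply (ex_RInt_continuous (V := R_CompleteNormedModule)). intros; apply continuous_gauss.
Qed.

Lemma gauss_prim_opp (r : R) : gauss_prim (- r) = - gauss_prim r.
Proof.
  set (H := fun r => gauss_prim (- r) + gauss_prim r).
  assert (HD : forall u, is_derive H u 0).
  { intros u. unfold H.
    assert (D1 := is_derive_gauss_prim u). assert (D2 := is_derive_gauss_prim (- u)).
    auto_derive.
    - repeat split; eexists; eassumption.
    - change (fun x => gauss_prim x) with gauss_prim. rewrite (is_derive_unique _ _ _ D1), (is_derive_unique _ _ _ D2).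
      unfold gauss. replace ((- u) ^ 2) with (u ^ 2) by ring. ring. }
  destruct (MVT_gen H 0 r (fun _ => 0)) as [c [_ Ec]].
  - intros; apply HD.
  - intros x _. apply continuity_pt_filterlim, (ex_derive_continuous H). eexists; apply HD.
  - unfold H in Ec. rewrite Ropp_0, gauss_prim_0 in Ec. lra.
Qed.

Lemma gauss_lim : filterlim gauss (Rbar_locally p_infty) (locally 0).
Proof.
  apply filterlim_locally. intros eps.
  destruct (exp_opp_lim (fun y => y < eps)) as [M HM].
  { apply (open_lt eps 0), cond_pos. }
  exists (Rmax M 1). intros r Hr.
  assert (M < r) by (apply Rle_lt_trans with (2 := Hr), Rmax_l).
  assert (1 < r) by (apply Rle_lt_trans with (2 := Hr), Rmax_r).
  change (Rabs (gauss r - 0) < eps). rewrite Rminus_0_r, Rabs_pos_eq by apply Rlt_le, exp_pos.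
  apply Rle_lt_trans with (2 := HM r H). apply exp_le. generalize PI_gt_3; intros; nra.
Qed.

Lemma gauss_prim_lim : filterlim gauss_prim (Rbar_locally p_infty) (locally (1 / sqrt 2 / 2)).
Proof.
  assert (Haux : filterlim gauss_aux (Rbar_locally p_infty) (locally 0)).
  { apply (filterlim_le_le (fun _ => 0) gauss_aux gauss (Finite 0)).
    - apply filter_forall. apply gauss_aux_bound.
    - apply (rlim_const 0).
    - apply gauss_lim. }
  assert (Hs : filterlim (fun r => sqrt (1 / 8 + - gauss_aux r)) (Rbar_locally p_infty) (locally (sqrt (1 / 8 + - 0)))).
  { apply rlim_sqrt, rlim_plus; [apply rlim_const|apply rlim_opp, Haux]. }
  replace (1 / sqrt 2 / 2) with (sqrt (1 / 8 + - 0)).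
  - apply rlim_ext_loc with (2 := Hs). exists 0. intros r Hr.
    replace (1 / 8 + - gauss_aux r) with (gauss_prim r ^ 2) by (generalize (gauss_prim_sqr r); lra).
    apply sqrt_pow2, gauss_prim_ge_0; lra.
  - replace (1 / 8 + - 0) with ((1 / sqrt 2 / 2) ^ 2).
    + apply sqrt_pow2. generalize inv_sqrt2_bounds; lra.
    + generalize inv_sqrt2_sqr. lra.
Qed.

Lemma gauss_1_le : gauss 1 <= 5 / 1000.
Proof.
  unfold gauss. apply Rle_trans with (exp (- (6))); [apply exp_le; generalize PI_gt_3; lra|].
    rewrite exp_Ropp.
    (* Starting from e^(1/8) >= 9/8, repeated multiplication gives e^(1/2) >= 8/5, then e^3 >=
       16. *)
    assert (H6 : 200 <= exp 6).
    { assert (H12 : 8 / 5 <= exp (1 / 2)).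
      { assert (H8 : 1 + 1 / 8 <= exp (1 / 8)) by apply exp_ineq1_le.
        replace (1 / 2) with (1 / 8 + 1 / 8 + (1 / 8 + 1 / 8)) by lra. rewrite !exp_plus.
        set (q := exp (1 / 8)) in *. assert (81 / 64 <= q * q) by nra. nra. }
      replace 6 with (3 + 3) by lra. rewrite exp_plus.
      replace 3 with (1 / 2 + 1 / 2 + (1 / 2 + 1 / 2) + (1 / 2 + 1 / 2)) by lra. rewrite !exp_plus.
      set (q := exp (1 / 2)) in *.
      assert (Hm : 64 / 25 <= q * q) by nra.
      set (m := q * q) in *.
      assert (65 / 10 <= m * m) by nra.
      assert (16 <= m * m * m) by nra. nra. }
    apply (Rmult_le_reg_r (exp 6)); [lra|]. rewrite Rinv_l by lra. lra.
Qed.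

Lemma gauss_prim_1_lower : 1 / sqrt 2 / 2 - 1 / 100 <= gauss_prim 1.
Proof.
  generalize (gauss_prim_sqr 1) (gauss_aux_bound 1) (gauss_prim_ge_0 1 ltac:(lra)) inv_sqrt2_sqr inv_sqrt2_bounds.
  intros E B P Q Q2.
  assert (G := gauss_1_le).
  set (q := 1 / sqrt 2) in *. nra.
Qed.

(** * The saddle point *)

Lemma Cmod_Cexp_minus_1 (d : C) : Cmod (Cexp d - 1) <= Cmod d * exp (Cmod d).
Proof.
  assert (H : Cmod (Cexp (RtoC 1 * d) - Cexp (RtoC 0 * d)) <= Cmod d * exp (Cmod d) / INR 1).
  { apply (cder_unit_bound (fun u => Cexp (RtoC u * d)) (fun u => d * Cexp (RtoC u * d))%C _ 0).
    - intros u _. apply cder_exp. eapply cder_eq; [apply cder_mult; [apply cder_id|apply cder_const]|].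
      cbv beta. ring.
    - intros u Hu. rewrite pow_O, Rmult_1_r, Cmod_mult, Cmod_Cexp.
      apply Rmult_le_compat_l; [apply Cmod_ge_0|]. apply exp_le.
      replace (fst (RtoC u * d)%C) with (u * fst d) by (simpl; ring).
      generalize (Cmod_fst d) (Rle_abs (fst d)) (Cmod_ge_0 d). nra. }
  rewrite Cmult_0_l, Cmult_1_l, Cexp_0 in H. simpl in H. lra.
Qed.

Lemma exp_opp_le_inv (y : R) : 0 <= y -> exp (- y) <= / (1 + y).
Proof.
  intros Hy. rewrite exp_Ropp. apply Rinv_le_contravar; [lra|]. apply exp_ineq1_le.
Qed.

Lemma exp_le_inv_1_minus (y : R) : 0 <= y < 1 -> exp y <= / (1 - y).
Proof.
  intros Hy. rewrite <- (Ropp_involutive y) at 1. rewrite exp_Ropp.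
  apply Rinv_le_contravar; [lra|]. generalize (exp_ineq1_le (- y)); lra.
Qed.

(** The bound m <= e^(m - 1) turns the left-hand side into the exponential of a quadratic polynomial
    in x whose leading coefficient pi (1/0.88 - 2) is negative, so a factor e^(-x) can be split off.
    The weight e^(-x) is chosen because it integrates in closed form. *)
Lemma saddle_majorant_main (x m : R) :
  0 <= x -> m = x + 1 / 4 ->
  exp (- (2 * PI) * x ^ 2) * (m ^ 3 * exp (PI * m ^ 2 / (88 / 100))) <= 34 / 10 * exp (- x).
Proof.
  intros Hx Hm. generalize PI_gt_3 PI_lt_324; intros HP1 HP2.
  assert (M3 : m ^ 3 <= exp (3 * (m - 1))).
  { replace (3 * (m - 1)) with ((m - 1) + ((m - 1) + (m - 1))) by ring. rewrite !exp_plus.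
    generalize (exp_ineq1_le (m - 1)). set (q := exp (m - 1)). intros Hq.
    replace (m ^ 3) with (m * (m * m)) by ring.
    apply Rmult_le_compat; [lra|nra|lra|]. apply Rmult_le_compat; lra. }
  assert (E : exp (111 / 100) <= 34 / 10).
  { replace (111 / 100) with (1 + 11 / 100) by lra. rewrite exp_plus.
    generalize exp_le_3 (exp_le_inv_1_minus (11 / 100) ltac:(lra)) (exp_pos 1) (exp_pos (11 / 100)).
    intros A B C D. nra. }
  apply Rle_trans with (exp (111 / 100) * exp (- x)).
  2: { apply Rmult_le_compat_r; [apply Rlt_le, exp_pos|exact E]. }
  apply Rle_trans with (exp (- (2 * PI) * x ^ 2) * (exp (3 * (m - 1)) * exp (PI * m ^ 2 / (88 / 100)))).
  { apply Rmult_le_compat_l; [apply Rlt_le, exp_pos|].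
    apply Rmult_le_compat_r; [apply Rlt_le, exp_pos|exact M3]. }
  rewrite <- !exp_plus. apply exp_le. subst m.
  set (g := (x + 1 / 4) ^ 2 / (88 / 100) - 2 * x ^ 2).
  replace (- (2 * PI) * x ^ 2 + (3 * (x + 1 / 4 - 1) + PI * (x + 1 / 4) ^ 2 / (88 / 100)))
    with (PI * g + 3 * x - 9 / 4) by (unfold g; field).
  (* The sign of g decides whether the upper or the lower bound of pi applies. *)
  assert (Hg : PI * g <= 3 * g \/ PI * g <= 324 / 100 * g) by (destruct (Rle_dec 0 g); [right|left]; nra).
  (* Near 1.04 and 1.10 lie the maxima of the quadratics obtained with 3.24 and with 3 in place of
     pi; both maxima are below 1.11. *)
  generalize (pow2_ge_0 (x - 104 / 100)) (pow2_ge_0 (x - 110 / 100)); intros S1 S2.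
  destruct Hg as [Hg|Hg]; apply Rle_trans with (1 := Rplus_le_compat_r _ _ _ (Rplus_le_compat_r _ _ _ Hg));
    unfold g; nra.
Qed.

Lemma saddle_majorant_rest (x : R) :
  0 <= x -> exp (- (2 * PI) * x ^ 2) * (6 / 1000 + 23 / 1000 * (x + 1 / 4)) <= 36 / 1000 * exp (- x).
Proof.
  intros Hx. generalize PI_gt_3; intros HP1.
  assert (A : exp (- (2 * PI) * x ^ 2) <= 105 / 100 * exp (- x)).
  { apply Rle_trans with (exp (1 / 24) * exp (- x)).
    - rewrite <- exp_plus. apply exp_le. generalize (pow2_ge_0 (12 * x - 1)). nra.
    - apply Rmult_le_compat_r; [apply Rlt_le, exp_pos|].
      apply Rle_trans with (1 := exp_le_inv_1_minus (1 / 24) ltac:(lra)). lra. }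
  assert (B : exp (- (2 * PI) * x ^ 2) * x <= exp (- x)).
  { apply Rle_trans with (exp (- (2 * PI) * x ^ 2) * exp (x - 1)).
    - apply Rmult_le_compat_l; [apply Rlt_le, exp_pos|]. generalize (exp_ineq1_le (x - 1)); lra.
    - rewrite <- exp_plus. apply exp_le. generalize (pow2_ge_0 (6 * x - 1)). nra. }
  generalize (exp_pos (- x)). nra.
Qed.

Section Saddle.

Context (s eta : C).
Context (Heta : (2 * PI * Ci * eta * eta)%C = (s - 1)%C).
Context (He1 : 5 <= fst eta) (He2 : 5 <= snd eta) (Hem : 52 <= Cmod eta).

(* The full integrand is stationary at [eta - 1/4], up to lower order terms. *)
Definition saddle_shift (r : R) : C := (RtoC (- (1 / 4)) + RtoC r * edir)%C.

Lemma Cmod_saddle_shift (r : R) : Cmod (saddle_shift r) <= Rabs r + 1 / 4.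
Proof.
  unfold saddle_shift. apply Rle_trans with (1 := Cmod_triangle _ _).
  rewrite Cmod_mult, Cmod_edir, !Cmod_R, Rabs_Ropp, (Rabs_pos_eq (1 / 4)) by lra. lra.
Qed.

(** The directions of eta and [edir] differ by at most pi/4, so for r >= 0 the modulus of a sum is
    at least cos(pi/8) > 0.9 times the sum of the moduli; 0.88 leaves room for the offset -1/4. For
    -1 <= r < 0 the shift is short compared with 52. The bound must grow with the shift, because the
    quadratic estimate of the remainder relies on that growth. *)
Lemma saddle_far (r u : R) :
  - 1 <= r -> 0 <= u <= 1 ->
  88 / 100 * (Cmod eta + u * Cmod (saddle_shift r)) <= Cmod (eta + RtoC u * saddle_shift r).
Proof.
  intros Hr Hu. generalize (Cmod_saddle_shift r); intros Hw.
  generalize (Cmod_ge_0 (saddle_shift r)); intros Hw0.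
  destruct (Rle_dec 0 r) as [Hr0|Hr0].
  - rewrite Rabs_pos_eq in Hw by lra.
    generalize inv_sqrt2_bounds; intros Hq.
    set (v := u * r).
    assert (Hv : 0 <= v) by (unfold v; nra).
    assert (H9 : 9 / 10 * (Cmod eta + v) <= Cmod (eta + RtoC v * edir)).
    { apply Cmod_ge_intro; [lra|]. rewrite fst_line, snd_line.
      assert (Hs : Cmod eta <= fst eta + snd eta).
      { apply Rle_trans with (1 := Cmod_le_sum eta). rewrite !Rabs_pos_eq; lra. }
      assert (Hsq := Cmod_sqr eta). assert (Hqq := inv_sqrt2_sqr).
      set (q := 1 / sqrt 2) in *. set (n := Cmod eta) in *.
      replace ((fst eta + v * q) ^ 2 + (snd eta + v * q) ^ 2)
        with (n * n + 2 * (v * (q * (fst eta + snd eta))) + v * v * (2 * (q * q))) by (rewrite Hsq; ring).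
      rewrite Hqq.
      assert (7 / 10 * n <= q * (fst eta + snd eta)) by nra.
      assert (v * (7 / 10 * n) <= v * (q * (fst eta + snd eta))) by nra.
      generalize (pow2_ge_0 (n - v)). nra. }
    replace (eta + RtoC u * saddle_shift r)%C with ((eta + RtoC v * edir) - RtoC (u / 4))%C.
    2: { unfold saddle_shift, v. rewrite RtoC_mult, RtoC_opp. unfold Rdiv. rewrite !RtoC_mult. ring. }
    apply Rle_trans with (2 := Cmod_triangle_rev _ _).
    rewrite Cmod_nonneg_R by lra.
    assert (u * Cmod (saddle_shift r) <= v + u / 4) by (unfold v; nra).
    lra.
  - rewrite Rabs_left in Hw by lra.
    apply Rle_trans with (Cmod eta - u * Cmod (saddle_shift r)).
    + assert (u * Cmod (saddle_shift r) <= 5 / 4) by nra. lra.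
    + replace (eta + RtoC u * saddle_shift r)%C with (eta - RtoC u * - saddle_shift r)%C by ring.
      apply Rle_trans with (2 := Cmod_triangle_rev _ _).
      rewrite Cmod_mult, Cmod_opp, Cmod_nonneg_R by lra. lra.
Qed.

Lemma saddle_quadrant (r u : R) :
  - 1 <= r -> 0 <= u <= 1 ->
  4 <= fst (eta + RtoC u * saddle_shift r)%C /\ 42 / 10 <= snd (eta + RtoC u * saddle_shift r)%C.
Proof.
  intros Hr Hu. generalize inv_sqrt2_bounds; intros Hq.
  unfold saddle_shift. rewrite edir_eq. simpl. set (q := 1 / sqrt 2) in *. split.
  - replace (fst eta + (u * (- (1 / 4) + (r * q - 0 * q)) - 0 * (0 + (r * q + 0 * q))))
      with (fst eta - u / 4 + (u * r) * q) by field.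
    assert (- 1 <= u * r) by nra. nra.
  - replace (snd eta + (u * (0 + (r * q + 0 * q)) + 0 * (- (1 / 4) + (r * q - 0 * q))))
      with (snd eta + (u * r) * q) by ring.
    assert (- 1 <= u * r) by nra. nra.
Qed.

Definition saddle_pt (r : R) : C := (eta + saddle_shift r)%C.

Lemma saddle_pt_line (r : R) : saddle_pt r = ((eta - RtoC (1 / 4)) + RtoC r * edir)%C.
Proof. unfold saddle_pt, saddle_shift. rewrite RtoC_opp. ring. Qed.

Lemma saddle_pt_quadrant (r : R) : - 1 <= r -> 4 <= fst (saddle_pt r) /\ 42 / 10 <= snd (saddle_pt r).
Proof.
  intros Hr. generalize (saddle_quadrant r 1 Hr ltac:(lra)). rewrite Cmult_1_l. auto.
Qed.

Definition saddle_ratio (r : R) : C := (saddle_shift r / eta)%C.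

Definition log_remainder (r : R) : C :=
  (Clog (saddle_pt r) - Clog eta - saddle_ratio r + saddle_ratio r * saddle_ratio r / 2)%C.

Lemma eta_neq_0 : eta <> 0%C.
Proof. intros E; rewrite E in He1; simpl in He1; lra. Qed.

(** The u-derivative of log(1 + u z) - u z + (u z)^2 / 2 is u^2 z^3 / (1 + u z), and |1 + u z| >=
    0.88 (1 + u |z|). Keeping the term 1 gives the cubic bound, keeping u |z| the quadratic one. The
    first is small for moderate r; the second controls the range where r is comparable with |eta| or
    larger. *)
Lemma log_remainder_bounds (r : R) :
  - 1 <= r ->
  Cmod (log_remainder r) <= Cmod (saddle_ratio r) ^ 3 / (88 / 100) / 3 /\
  Cmod (log_remainder r) <= Cmod (saddle_ratio r) ^ 2 / (88 / 100) / 2.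
Proof.
  intros Hr. assert (H0 := eta_neq_0). set (z := saddle_ratio r).
  set (K := fun u : R => (Clog (eta + RtoC u * saddle_shift r) - RtoC u * z + RtoC (u * u / 2) * (z * z))%C).
  set (K' := fun u : R => (RtoC (u * u) * (z * z * z) / ((eta + RtoC u * saddle_shift r) / eta))%C).
  assert (HE : log_remainder r = (K 1 - K 0)%C).
  { unfold log_remainder, K, saddle_pt. fold z.
    rewrite Cmult_1_l, Cmult_0_l, Cplus_0_r.
    replace (1 * 1 / 2) with (/ 2) by field. replace (0 * 0 / 2) with 0 by field.
    rewrite RtoC_inv by lra. field. }
  assert (Hx : forall u, 0 <= u <= 1 -> (eta + RtoC u * saddle_shift r)%C <> 0%C).
  { intros u Hu E. generalize (proj1 (saddle_quadrant r u Hr Hu)). rewrite E; simpl; lra. }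
  assert (HD : forall u, 0 <= u <= 1 -> cder K u (K' u)).
  { intros u Hu. unfold K. eapply cder_eq.
    - apply cder_plus; [apply cder_minus|].
      + apply cder_log; [apply cder_line|]. left. generalize (proj1 (saddle_quadrant r u Hr Hu)); lra.
      + apply cder_mult; [apply cder_id|apply cder_const].
      + apply cder_mult; [|apply cder_const]. apply (cder_R _ (fun u => u * u / 2) u).
        auto_derive; [trivial|field].
    - cbv beta. unfold K'. fold z.
      assert (E : saddle_shift r = (z * eta)%C) by (unfold z, saddle_ratio; field; exact H0).
      specialize (Hx u Hu). rewrite E in *. rewrite RtoC_mult. field.
      split; assumption. }
  assert (HB : forall u, 0 <= u <= 1 -> 88 / 100 * (1 + u * Cmod z) <= Cmod ((eta + RtoC u * saddle_shift r) / eta)).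
  { intros u Hu. rewrite Cmod_div by exact H0. unfold z, saddle_ratio. rewrite Cmod_div by exact H0.
    apply (Rmult_le_reg_r (Cmod eta)); [lra|].
    replace (Cmod (eta + RtoC u * saddle_shift r) / Cmod eta * Cmod eta)
      with (Cmod (eta + RtoC u * saddle_shift r)) by (field; lra).
    replace (88 / 100 * (1 + u * (Cmod (saddle_shift r) / Cmod eta)) * Cmod eta)
      with (88 / 100 * (Cmod eta + u * Cmod (saddle_shift r))) by (field; lra).
    apply saddle_far; assumption. }
  assert (HK : forall u, 0 <= u <= 1 ->
     Cmod (K' u) = u * u * Cmod z ^ 3 / Cmod ((eta + RtoC u * saddle_shift r) / eta)).
  { intros u Hu. unfold K'. rewrite Cmod_div, !Cmod_mult, Cmod_nonneg_R; [f_equal; ring|nra|].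
    apply Cmod_gt_0. generalize (HB u Hu) (Cmod_ge_0 z). nra. }
  generalize (Cmod_ge_0 z); intros Z0.
  rewrite HE. split.
  - apply Rle_trans with (Cmod z ^ 3 / (88 / 100) / INR (S 2)); [|right; simpl INR; field].
    apply (cder_unit_bound K K' _ 2 HD).
    intros u Hu. rewrite HK by exact Hu. specialize (HB u Hu).
    assert (88 / 100 <= Cmod ((eta + RtoC u * saddle_shift r) / eta)) by nra.
    set (D := Cmod ((eta + RtoC u * saddle_shift r) / eta)) in *.
    replace (Cmod z ^ 3 / (88 / 100) * u ^ 2) with (u * u * Cmod z ^ 3 / (88 / 100)) by field.
    unfold Rdiv. apply Rmult_le_compat_l; [|apply Rinv_le_contravar; lra].
    apply Rmult_le_pos; [nra|apply pow_le, Z0].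
  - apply Rle_trans with (Cmod z ^ 2 / (88 / 100) / INR (S 1)); [|right; simpl INR; field].
    apply (cder_unit_bound K K' _ 1 HD).
    intros u Hu. rewrite HK by exact Hu. specialize (HB u Hu).
    set (D := Cmod ((eta + RtoC u * saddle_shift r) / eta)) in *.
    assert (HD0 : 0 < D) by nra.
    apply (Rmult_le_reg_r D); [exact HD0|].
    set (y := Cmod z) in *.
    replace (u * u * y ^ 3 / D * D) with (u * u * y ^ 3) by (field; lra).
    replace (u * u * y ^ 3) with (u * y ^ 2 * (u * y)) by ring.
    replace (y ^ 2 / (88 / 100) * u ^ 1 * D) with (u * y ^ 2 * (D / (88 / 100))) by field.
    apply Rmult_le_compat_l; [apply Rmult_le_pos; [lra|apply pow_le, Z0]|].
    apply (Rmult_le_reg_r (88 / 100)); [lra|].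
    replace (D / (88 / 100) * (88 / 100)) with D by field. nra.
Qed.

Definition saddle_delta (r : R) : C := (- (2 * PI * Ci * eta * eta) * log_remainder r)%C.

(** The constant 0.0473 exceeds 2 * 3.24 / (3 * 0.88 * 52). In the quadratic bound pi / 0.88 is
    below 2 pi, so the exponential of the error never overcomes the Gaussian. *)
Lemma saddle_delta_bounds (r : R) :
  - 1 <= r ->
  Cmod (saddle_delta r) <= 473 / 10000 * (Rabs r + 1 / 4) ^ 3 /\
  Cmod (saddle_delta r) <= PI * (Rabs r + 1 / 4) ^ 2 / (88 / 100).
Proof.
  intros Hr. generalize PI_gt_3 PI_lt_324; intros HP1 HP2.
  destruct (log_remainder_bounds r Hr) as [H3 H2].
  assert (E : Cmod (saddle_delta r) = 2 * PI * (Cmod eta ^ 2) * Cmod (log_remainder r)).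
  { unfold saddle_delta. rewrite Cmod_mult, Cmod_opp, !Cmod_mult, Cmod_Ci, !Cmod_nonneg_R by lra. ring. }
  assert (Ez : Cmod (saddle_ratio r) = Cmod (saddle_shift r) / Cmod eta).
  { unfold saddle_ratio. apply Cmod_div, eta_neq_0. }
  rewrite Ez in H3, H2. rewrite E.
  generalize (Cmod_saddle_shift r) (Cmod_ge_0 (saddle_shift r)).
  set (w := Cmod (saddle_shift r)) in *. set (n := Cmod eta) in *. set (m := Rabs r + 1 / 4).
  intros Hw Hw0.
  assert (N2 : 0 < 2 * PI * n ^ 2) by (apply Rmult_lt_0_compat; [lra|apply pow_lt; lra]).
  split.
  - apply Rle_trans with (2 * PI * n ^ 2 * ((w / n) ^ 3 / (88 / 100) / 3)).
    { apply Rmult_le_compat_l; lra. }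
    replace (2 * PI * n ^ 2 * ((w / n) ^ 3 / (88 / 100) / 3)) with (w ^ 3 * (2 * PI / (264 / 100) * / n))
      by (field; lra).
    assert (W3 : w ^ 3 <= m ^ 3) by (apply pow_incr; lra).
    assert (W0 : 0 <= w ^ 3) by (apply pow_le; lra).
    assert (Hn : / n <= / 52) by (apply Rinv_le_contravar; lra).
    assert (Hn0 : 0 < / n) by (apply Rinv_0_lt_compat; lra).
    assert (Hc : 2 * PI / (264 / 100) * / n <= 473 / 10000).
    { apply Rle_trans with (2 * PI / (264 / 100) * / 52); [apply Rmult_le_compat_l; lra|lra]. }
    rewrite (Rmult_comm (473 / 10000)). apply Rmult_le_compat; try lra.
    apply Rmult_le_pos; lra.
  - apply Rle_trans with (2 * PI * n ^ 2 * ((w / n) ^ 2 / (88 / 100) / 2)).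
    { apply Rmult_le_compat_l; lra. }
    replace (2 * PI * n ^ 2 * ((w / n) ^ 2 / (88 / 100) / 2)) with (PI / (88 / 100) * w ^ 2)
      by (field; lra).
    replace (PI * m ^ 2 / (88 / 100)) with (PI / (88 / 100) * m ^ 2) by field.
    apply Rmult_le_compat_l; [lra|]. apply pow_incr; lra.
Qed.

Definition saddle_amp : C :=
  (- Cexp (- s * Clog eta + PI * Ci * eta * eta + PI * Ci * eta + RtoC (PI / 8) * Ci))%C.

Definition upper_factor (x : C) : C := (1 - Cexp (2 * PI * Ci * x))%C.

(** Put w = [saddle_shift r]. As s = 1 + 2 pi i eta^2, the terms of -s log x + pi i x^2 linear in w
    cancel, and the quadratic ones add up to 2 pi i w^2. The term pi i x comes from the denominator,
    pi/4 from [edir], and the final difference of logarithms from the 1 in s. *)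
Lemma saddle_exponent (r : R) :
  (- s * Clog (saddle_pt r) + PI * Ci * saddle_pt r * saddle_pt r
     + PI * Ci * saddle_pt r + RtoC (PI / 4) * Ci =
   (- s * Clog eta + PI * Ci * eta * eta + PI * Ci * eta + RtoC (PI / 8) * Ci)
     + RtoC (- (2 * PI) * r ^ 2) + saddle_delta r - (Clog (saddle_pt r) - Clog eta))%C.
Proof.
  unfold saddle_delta, log_remainder. set (Lx := Clog (saddle_pt r)).
  assert (Ez : saddle_shift r = (saddle_ratio r * eta)%C)
    by (unfold saddle_ratio; field; exact eta_neq_0).
  set (z := saddle_ratio r) in *.
  assert (Es : s = (1 + 2 * PI * Ci * eta * eta)%C) by (rewrite Heta; ring).
  (* Completing the square: 2 pi i w^2 + pi i w = - pi i / 8 - 2 pi r^2. The offset -1/4 is the one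
     that removes the term linear in r. *)
  assert (Ew : (2 * PI * Ci * (saddle_shift r * saddle_shift r) + PI * Ci * saddle_shift r
                 + RtoC (PI / 8) * Ci + RtoC (2 * PI * r ^ 2) = 0)%C).
  { assert (Esq : (saddle_shift r * saddle_shift r =
        RtoC (1 / 16) - RtoC (r / 2) * edir + RtoC (r ^ 2) * (edir * edir))%C).
    { unfold saddle_shift. apply C_eq; rewrite edir_eq; simpl; field; apply Rgt_not_eq, sqrt_lt_R0; lra. }
    rewrite Esq, edir_sqr. unfold saddle_shift. rewrite edir_eq.
    apply C_eq; simpl; field; apply Rgt_not_eq, sqrt_lt_R0; lra. }
  unfold saddle_pt. rewrite Es, Ez in *.
  transitivity ((- (1 + 2 * PI * Ci * eta * eta) * Clog eta + PI * Ci * eta * eta + PI * Ci * eta + RtoC (PI / 8) * Ci)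
     + RtoC (- (2 * PI) * r ^ 2) + - (2 * PI * Ci * eta * eta) * (Lx - Clog eta - z + z * z / 2) - (Lx - Clog eta)
     + (2 * PI * Ci * (z * eta * (z * eta)) + PI * Ci * (z * eta)
                 + RtoC (PI / 8) * Ci + RtoC (2 * PI * r ^ 2)))%C.
  - replace (RtoC (PI / 4)) with (RtoC (PI / 8) + RtoC (PI / 8))%C by (rewrite <- RtoC_plus; f_equal; field).
    replace (RtoC (- (2 * PI) * r ^ 2)) with (- RtoC (2 * PI * r ^ 2))%C by (rewrite <- RtoC_opp; f_equal; ring).
    field.
  - rewrite Ew. ring.
Qed.

Lemma saddle_upper_factor (x : C) :
  42 / 10 <= snd x ->
  upper_factor x <> 0%C /\ 179 / 180 <= Cmod (upper_factor x) /\ Cmod (upper_factor x - 1) <= 1 / 180.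
Proof.
  intros Hx. generalize PI_gt_3; intros HP.
  assert (HE : Cmod (Cexp (2 * PI * Ci * x)) <= 1 / 180).
  { rewrite Cmod_Cexp.
    replace (fst (2 * PI * Ci * x)%C) with (- (PI * snd x) + - (PI * snd x)) by (simpl; ring).
    rewrite exp_plus.
    (* From e^y >= 1 + y with y >= 3 * 4.2; the square of 10/136 is below 1/180. *)
    assert (Hy : exp (- (PI * snd x)) <= 10 / 136).
    { apply Rle_trans with (1 := exp_opp_le_inv (PI * snd x) ltac:(nra)).
      replace (10 / 136) with (/ (136 / 10)) by field. apply Rinv_le_contravar; [lra|]. nra. }
    generalize (exp_pos (- (PI * snd x))). nra. }
  assert (H1 : 179 / 180 <= Cmod (upper_factor x)).
  { unfold upper_factor. apply Rle_trans with (2 := Cmod_triangle_rev _ _). rewrite Cmod_1. lra. }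
  split; [apply Cmod_gt_0; lra|]. split; [exact H1|].
  unfold upper_factor. replace (1 - Cexp (2 * PI * Ci * x) - 1)%C with (- Cexp (2 * PI * Ci * x))%C by ring.
  rewrite Cmod_opp. exact HE.
Qed.

Lemma Cexp_Clog_div (r : R) : - 1 <= r -> Cexp (Clog (saddle_pt r) - Clog eta) = (saddle_pt r / eta)%C.
Proof.
  intros Hr. rewrite Cexp_minus, !Cexp_Clog; [reflexivity|left; lra|].
  left. generalize (saddle_pt_quadrant r Hr); lra.
Qed.

Lemma saddle_numerator (r : R) :
  - 1 <= r ->
  (Cexp (- s * Clog (saddle_pt r) + PI * Ci * saddle_pt r * saddle_pt r + PI * Ci * saddle_pt r) * edir
   = - saddle_amp * RtoC (gauss r) * Cexp (saddle_delta r) / (saddle_pt r / eta))%C.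
Proof.
  intros Hr. unfold edir. rewrite <- Cexp_plus, saddle_exponent, Cexp_minus, Cexp_Clog_div by exact Hr.
  rewrite (Cexp_plus (_ + RtoC (- (2 * PI) * r ^ 2))), (Cexp_plus _ (RtoC (- (2 * PI) * r ^ 2))), Cexp_R.
  unfold saddle_amp, gauss. unfold Cdiv. ring.
Qed.

Lemma saddle_pt_neq_0 (r : R) : - 1 <= r -> saddle_pt r <> 0%C.
Proof. intros Hr E. generalize (saddle_pt_quadrant r Hr). rewrite E; simpl; lra. Qed.

(** With E = e^(pi i x) one has 1 / (E - 1/E) = - E / (1 - E^2), and E^2 is small high in the upper
    half-plane. This accounts for the sign in [saddle_amp]. *)
Lemma R_integrand_upper (x : C) :
  0 < snd x ->
  R_integrand s x =
  (- Cexp (- s * Clog x + PI * Ci * x * x + PI * Ci * x) / upper_factor x)%C.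
Proof.
  intros Hx. rewrite R_integrand_unfold, (Cexp_plus (_ + _)).
  assert (Hd := slit_domain_sin_denom x (slit_domain_upper x Hx)).
  unfold upper_factor. unfold sin_denom in *. rewrite Cexp_opp in *.
  replace (2 * PI * Ci * x)%C with (PI * Ci * x + PI * Ci * x)%C by ring.
  rewrite (Cexp_plus (PI * Ci * x) (PI * Ci * x)). generalize (Cexp_neq_0 (PI * Ci * x)).
  set (E := Cexp (PI * Ci * x)) in *. intros HE.
  assert (H1 : (1 - E * E)%C <> 0%C).
  { intros H. apply Hd. replace (E - / E)%C with (- ((1 - E * E) / E))%C by (field; exact HE).
    rewrite H. unfold Cdiv. ring. }
  assert (H2 : (E * E - 1)%C <> 0%C).
  { intros H. apply H1. replace (1 - E * E)%C with (- (E * E - 1))%C by ring. rewrite H. ring. }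
  field. repeat split; assumption.
Qed.

Definition saddle_quotient (r : R) : C := (/ (saddle_pt r / eta * upper_factor (saddle_pt r)))%C.

Lemma saddle_integrand (r : R) :
  - 1 <= r ->
  (edir * R_integrand s (saddle_pt r) =
   saddle_amp * RtoC (gauss r) * (Cexp (saddle_delta r) * saddle_quotient r))%C.
Proof.
  intros Hr. destruct (saddle_pt_quadrant r Hr) as [Q1 Q2].
  destruct (saddle_upper_factor _ Q2) as [U0 _].
  rewrite R_integrand_upper by lra.
  transitivity (- (Cexp (- s * Clog (saddle_pt r) + PI * Ci * saddle_pt r * saddle_pt r + PI * Ci * saddle_pt r) * edir)
     / upper_factor (saddle_pt r))%C.
  { unfold Cdiv; ring. }
  rewrite saddle_numerator by exact Hr. unfold saddle_quotient.
  field. repeat split; auto using saddle_pt_neq_0, eta_neq_0.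
Qed.

(** Here 1.19 exceeds 1 / (0.88 * 179/180), while 0.023 exceeds 1.19 / 52 and 0.006 exceeds
    1/179. *)
Lemma saddle_quotient_bounds (r : R) :
  - 1 <= r ->
  Cmod (saddle_quotient r) <= 119 / 100 /\
  Cmod (saddle_quotient r - 1) <= 6 / 1000 + 23 / 1000 * (Rabs r + 1 / 4).
Proof.
  intros Hr. destruct (saddle_pt_quadrant r Hr) as [Q1 Q2].
  destruct (saddle_upper_factor _ Q2) as [U0 [U1 U2]].
  assert (H0 := eta_neq_0). assert (Hx := saddle_pt_neq_0 r Hr).
  assert (Hv : 88 / 100 <= Cmod (saddle_pt r / eta)).
  { rewrite Cmod_div by exact H0.
    generalize (saddle_far r 1 Hr ltac:(lra)). rewrite Cmult_1_l. fold (saddle_pt r).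
    generalize (Cmod_ge_0 (saddle_shift r)). intros A B.
    apply (Rmult_le_reg_r (Cmod eta)); [lra|].
    replace (Cmod (saddle_pt r) / Cmod eta * Cmod eta) with (Cmod (saddle_pt r)) by (field; lra). lra. }
  assert (Hv0 : (saddle_pt r / eta)%C <> 0%C) by (apply Cmod_gt_0; lra).
  assert (Hq : Cmod (saddle_quotient r) <= 119 / 100).
  { unfold saddle_quotient. rewrite Cmod_inv, Cmod_mult.
    2: { apply Cmult_neq_0; assumption. }
    replace (119 / 100) with (/ (100 / 119)) by field. apply Rinv_le_contravar; [lra|]. nra. }
  split; [exact Hq|].
  replace (saddle_quotient r - 1)%C
    with (- (saddle_quotient r * saddle_ratio r + (upper_factor (saddle_pt r) - 1) / upper_factor (saddle_pt r)))%C.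
  2: { unfold saddle_quotient, saddle_ratio, saddle_pt in *. field. repeat split; assumption. }
  rewrite Cmod_opp. apply Rle_trans with (1 := Cmod_triangle _ _).
  rewrite Cmod_mult, Cmod_div by exact U0.
  assert (Hz : Cmod (saddle_ratio r) <= (Rabs r + 1 / 4) / 52).
  { unfold saddle_ratio. rewrite Cmod_div by exact H0. unfold Rdiv.
    apply Rmult_le_compat; [apply Cmod_ge_0| |apply Cmod_saddle_shift|].
    - apply Rlt_le, Rinv_0_lt_compat; lra.
    - apply Rinv_le_contravar; lra. }
  assert (Hu : Cmod (upper_factor (saddle_pt r) - 1) / Cmod (upper_factor (saddle_pt r)) <= 6 / 1000).
  { apply (Rmult_le_reg_r (Cmod (upper_factor (saddle_pt r)))); [lra|].
    replace (Cmod (upper_factor (saddle_pt r) - 1) / Cmod (upper_factor (saddle_pt r)) * Cmod (upper_factor (saddle_pt r)))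
      with (Cmod (upper_factor (saddle_pt r) - 1)) by (field; lra). lra. }
  generalize (Cmod_ge_0 (saddle_quotient r)) (Cmod_ge_0 (saddle_ratio r)). nra.
Qed.

(** The constant 1/4 exceeds 1.19 * 0.0473 * 3.4 + 0.036, the two summands being the contributions
    of [saddle_delta] and of [saddle_quotient - 1]. *)
Lemma saddle_pointwise (r : R) :
  - 1 <= r ->
  Cmod (edir * R_integrand s (saddle_pt r) - saddle_amp * RtoC (gauss r))
  <= Cmod saddle_amp * (1 / 4 * exp (- Rabs r)).
Proof.
  intros Hr. rewrite saddle_integrand by exact Hr.
  replace (saddle_amp * RtoC (gauss r) * (Cexp (saddle_delta r) * saddle_quotient r) - saddle_amp * RtoC (gauss r))%C
    with (saddle_amp * (RtoC (gauss r) * ((Cexp (saddle_delta r) - 1) * saddle_quotient r + (saddle_quotient r - 1))))%C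
    by ring.
  rewrite Cmod_mult. apply Rmult_le_compat_l; [apply Cmod_ge_0|].
  assert (G0 : 0 < gauss r) by apply exp_pos.
  rewrite Cmod_mult, Cmod_nonneg_R by lra.
  destruct (saddle_quotient_bounds r Hr) as [Q1 Q2].
  destruct (saddle_delta_bounds r Hr) as [D1 D2].
  assert (X0 := Rabs_pos r).
  assert (M1 := saddle_majorant_main (Rabs r) _ X0 eq_refl).
  assert (M2 := saddle_majorant_rest (Rabs r) X0).
  assert (EG : exp (- (2 * PI) * Rabs r ^ 2) = gauss r) by (unfold gauss; rewrite pow2_abs; reflexivity).
  rewrite EG in M1, M2.
  assert (HT : Cmod ((Cexp (saddle_delta r) - 1) * saddle_quotient r + (saddle_quotient r - 1))
     <= 563 / 10000 * ((Rabs r + 1 / 4) ^ 3 * exp (PI * (Rabs r + 1 / 4) ^ 2 / (88 / 100)))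
        + (6 / 1000 + 23 / 1000 * (Rabs r + 1 / 4))).
  { apply Rle_trans with (1 := Cmod_triangle _ _). apply Rplus_le_compat; [|exact Q2].
    rewrite Cmod_mult.
    assert (HD : Cmod (Cexp (saddle_delta r) - 1) <=
       473 / 10000 * (Rabs r + 1 / 4) ^ 3 * exp (PI * (Rabs r + 1 / 4) ^ 2 / (88 / 100))).
    { apply Rle_trans with (1 := Cmod_Cexp_minus_1 _).
      apply Rmult_le_compat; [apply Cmod_ge_0|apply Rlt_le, exp_pos|exact D1|apply exp_le, D2]. }
    assert (P0 : 0 <= (Rabs r + 1 / 4) ^ 3 * exp (PI * (Rabs r + 1 / 4) ^ 2 / (88 / 100))).
    { apply Rmult_le_pos; [apply pow_le; lra|apply Rlt_le, exp_pos]. }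
    rewrite Rmult_assoc in HD.
    set (T := (Rabs r + 1 / 4) ^ 3 * exp (PI * (Rabs r + 1 / 4) ^ 2 / (88 / 100))) in *.
    generalize (Cmod_ge_0 (Cexp (saddle_delta r) - 1)) (Cmod_ge_0 (saddle_quotient r)). nra. }
  apply Rle_trans with (1 := Rmult_le_compat_l _ _ _ (Rlt_le _ _ G0) HT).
  rewrite Rmult_plus_distr_l.
  set (T := (Rabs r + 1 / 4) ^ 3 * exp (PI * (Rabs r + 1 / 4) ^ 2 / (88 / 100))) in *.
  generalize (exp_pos (- Rabs r)). nra.
Qed.

End Saddle.

(** * The ray integral compared with the Gaussian *)

Lemma is_RInt_pow_unit (n : nat) : is_RInt (fun v => v ^ n) 0 1 (/ INR (S n)).
Proof.
  assert (Hk : 0 < INR (S n)) by (apply lt_0_INR; lia).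
  replace (/ INR (S n)) with (1 ^ S n / INR (S n) - 0 ^ S n / INR (S n))
    by (rewrite pow1, pow_i by lia; field; lra).
  apply (is_RInt_derive (V := R_CompleteNormedModule) (fun v => v ^ S n / INR (S n)) (fun v => v ^ n)).
  - intros u _.
    assert (H : is_derive (fun u => u ^ S n) u (INR (S n) * 1 * u ^ n))
      by (apply (is_derive_pow (fun u => u) (S n) u 1), @is_derive_id).
    apply is_derive_ext with (fun u => / INR (S n) * u ^ S n);
      [intros t; change (/ INR (S n) * t ^ S n = t ^ S n / INR (S n)); field; lra|].
    eapply is_derive_eq; [exact (is_derive_scal _ _ (/ INR (S n)) _ H)|]. field; lra.
  - intros u _. apply (ex_derive_continuous (fun v => v ^ n)). auto_derive; trivial.
Qed.

Lemma CRInt_pow_bound (h : R -> C) (K : R) (n : nat) :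
  ex_RInt (fun v => fst (h v)) 0 1 -> ex_RInt (fun v => snd (h v)) 0 1 ->
  (forall v, 0 < v < 1 -> Cmod (h v) <= K * v ^ n) ->
  Cmod (CRInt h 0 1) <= 2 * K / INR (S n).
Proof.
  intros E1 E2 Hb. unfold Rdiv. rewrite Rmult_assoc.
  apply CRInt_bound with (fun v => K * v ^ n); auto; [lra|].
  exact (is_RInt_scal (V := R_NormedModule) _ 0 1 K _ (is_RInt_pow_unit n)).
Qed.

Section SaddleValue.

Context (s eta : C).
Context (Heta : (2 * PI * Ci * eta * eta)%C = (s - 1)%C).
Context (He1 : 5 <= fst eta) (He2 : 5 <= snd eta) (Hem : 52 <= Cmod eta).

Lemma saddle_sigma : - fst s = 4 * PI * (fst eta * snd eta) - 1.
Proof. apply (f_equal fst) in Heta. simpl in Heta. lra. Qed.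

Lemma saddle_sigma_le : fst s <= - 1.
Proof.
  generalize saddle_sigma PI_gt_3; intros H1 H2. assert (25 <= fst eta * snd eta) by nra. nra.
Qed.

(** The modulus of e^(-s log x + pi i x^2 + pi i x), the integrand in the upper half-plane without
    [upper_factor]. *)
Definition numerator_mod (x : C) : R :=
  exp (- fst s * ln (Cmod x) + snd s * Arg x - 2 * PI * fst x * snd x - PI * snd x).

(** On a segment from 0 the numerator is dominated by a power of y. The exponent is the derivative
    of the logarithm of its modulus with respect to ln y at y = 1. *)
Lemma R_integrand_scaled_bound (x : C) (y : R) :
  0 < fst x -> 0 < snd x -> 0 < y <= 1 ->
  0 <= - fst s - 4 * PI * (fst x * snd x) - PI * snd x ->
  Cmod (R_integrand s (RtoC y * x)) <=
  numerator_mod x * (exp ((- fst s - 4 * PI * (fst x * snd x) - PI * snd x) * ln y)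
                       * (1 + / (2 * PI * y * snd x))).
Proof.
  intros H1 H2 Hy Hc. generalize PI_RGT_0; intros HP.
  assert (Hup : 0 < snd (RtoC y * x)%C) by (simpl; nra).
  rewrite Cmod_R_integrand by (apply slit_domain_sin_denom, slit_domain_upper, Hup).
  assert (HA : Arg (RtoC y * x) = Arg x).
  { generalize (Clog_scal y x ltac:(lra) (or_introl H1)). intros E.
    apply (f_equal snd) in E. simpl in E. rewrite E. ring. }
  rewrite HA, Cmod_mult, Cmod_nonneg_R by lra.
  assert (Hm : 0 < Cmod x) by (apply Cmod_gt_0; intros E; rewrite E in H1; simpl in H1; lra).
  rewrite ln_mult by lra.
  replace (fst (RtoC y * x)%C) with (y * fst x) by (simpl; ring).
  replace (snd (RtoC y * x)%C) with (y * snd x) in * by (simpl; ring).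
  set (u := 2 * PI * y * snd x).
  assert (Hu : 0 < u) by (unfold u; apply Rmult_lt_0_compat; [apply Rmult_lt_0_compat; lra|exact H2]).
  (* With u = 2 pi y snd x, the denominator is at least e^(u/2) (1 - e^(-u)), and 1 / (1 - e^(-u))
     <= 1 + 1/u. *)
  assert (Hden : / Cmod (sin_denom (RtoC y * x)) <= exp (- (PI * y * snd x)) * (1 + / u)).
  { assert (Hd := sin_denom_ge_sinh (RtoC y * x)%C).
    replace (snd (RtoC y * x)%C) with (y * snd x) in Hd by (simpl; ring).
    specialize (Hd ltac:(lra)).
    assert (He : exp (- u) <= / (1 + u)) by (apply exp_opp_le_inv; lra).
    assert (E : exp (PI * (y * snd x)) - exp (- (PI * (y * snd x))) = exp (PI * y * snd x) * (1 - exp (- u))).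
    { rewrite Rmult_minus_distr_l, Rmult_1_r, <- exp_plus. unfold u. f_equal; f_equal; ring. }
    rewrite E in Hd.
    assert (Hl : exp (PI * y * snd x) * (u / (1 + u)) <= Cmod (sin_denom (RtoC y * x))).
    { apply Rle_trans with (2 := Hd). apply Rmult_le_compat_l; [apply Rlt_le, exp_pos|].
      replace (u / (1 + u)) with (1 - / (1 + u)) by (field; lra). lra. }
    replace (exp (- (PI * y * snd x)) * (1 + / u)) with (/ (exp (PI * y * snd x) * (u / (1 + u)))).
    - apply Rinv_le_contravar; [|exact Hl]. apply Rmult_lt_0_compat; [apply exp_pos|].
      apply Rdiv_lt_0_compat; lra.
    - rewrite exp_Ropp. generalize (exp_pos (PI * y * snd x)); intros. field. repeat split; lra. }
  unfold Rdiv. apply Rle_trans with (1 := Rmult_le_compat_l _ _ _ (Rlt_le _ _ (exp_pos _)) Hden).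
  rewrite <- !Rmult_assoc. apply Rmult_le_compat_r.
  { assert (0 < / u) by (apply Rinv_0_lt_compat, Hu). lra. }
  unfold numerator_mod. rewrite <- !exp_plus. apply exp_le.
  (* These two inequalities turn the linear and the quadratic part of the exponent into multiples of
     ln y. *)
  assert (L1 : ln y <= y - 1).
  { rewrite <- (ln_exp (y - 1)). apply ln_le; [lra|]. generalize (exp_ineq1_le (y - 1)); lra. }
  assert (L2 : 2 * ln y <= y * y - 1).
  { replace (2 * ln y) with (ln (y * y)) by (rewrite ln_mult by lra; ring).
    rewrite <- (ln_exp (y * y - 1)). apply ln_le; [nra|]. generalize (exp_ineq1_le (y * y - 1)); lra. }
  assert (P1 : 0 < PI * (fst x * snd x)) by (apply Rmult_lt_0_compat; [exact HP|apply Rmult_lt_0_compat; assumption]).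
  assert (P2 : 0 < PI * snd x) by (apply Rmult_lt_0_compat; lra).
  assert (Q1 : PI * snd x * ln y <= PI * snd x * (y - 1)) by (apply Rmult_le_compat_l; lra).
  assert (Q2 : 2 * (PI * (fst x * snd x)) * (2 * ln y) <= 2 * (PI * (fst x * snd x)) * (y * y - 1))
    by (apply Rmult_le_compat_l; lra).
  nra.
Qed.

(** The integral from 0 to the start of the ray. The integrand grows along the segment at least like
    the power c of y, c >= 6 S, while the segment has length at most S; so the integral is a small
    multiple of the endpoint value, which already carries the factor [gauss (- 1)] <= 0.005. *)
Lemma saddle_tail :
  Cmod (R_prim s (saddle_pt eta (- 1))) <= 1 / 100 * Cmod (saddle_amp s eta).
Proof.
  set (x := saddle_pt eta (- 1)).
  generalize PI_gt_3 PI_lt_324 inv_sqrt2_bounds inv_sqrt2_sqr saddle_sigma; intros HP1 HP2 Hq Hqq Hsig.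
  assert (Hm1 : - 1 <= - 1) by lra.
  destruct (saddle_pt_quadrant eta He1 He2 (- 1) Hm1) as [X1 X2]. fold x in X1, X2.
  assert (E1 : fst x = fst eta - 1 / 4 - 1 / sqrt 2).
  { unfold x. rewrite saddle_pt_line, fst_line. simpl. lra. }
  assert (E2 : snd x = snd eta - 1 / sqrt 2).
  { unfold x. rewrite saddle_pt_line, snd_line. simpl. lra. }
  set (S := fst eta + snd eta).
  set (c := - fst s - 4 * PI * (fst x * snd x) - PI * snd x).
  assert (Hc : 6 * S <= c).
  { unfold c. rewrite Hsig, E1, E2. set (q := 1 / sqrt 2) in *.
    replace (4 * PI * (fst eta * snd eta) - 1 - 4 * PI * ((fst eta - 1 / 4 - q) * (snd eta - q)) - PI * (snd eta - q))
      with (PI * (4 * q * fst eta + 4 * q * snd eta - 4 * (q * q)) - 1) by field.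
    rewrite Hqq.
    assert (28 / 10 * S - 2 <= 4 * q * fst eta + 4 * q * snd eta - 4 * (1 / 2)) by (unfold S; nra).
    assert (10 <= S) by (unfold S; lra). nra. }
  assert (HS : 10 <= S) by (unfold S; lra).
  (* With y = v^2 the power of y becomes v^(2c), one power of v goes into the 1/y of the denominator
     bound, and an integer exponent n is needed for [CRInt_pow_bound]. *)
  destruct (nfloor_ex (2 * c - 1) ltac:(lra)) as [n [Hn1 Hn2]].
  destruct (ex_RInt_R_scaled s x saddle_sigma_le (slit_domain_upper x ltac:(lra))) as [Ex1 Ex2].
  set (M := numerator_mod x).
  assert (HM0 : 0 < M) by apply exp_pos.
  assert (HM : M <= 65 / 10000 * Cmod (saddle_amp s eta)).
  { assert (EM : M = Cmod (Cexp (- s * Clog x + PI * Ci * x * x + PI * Ci * x) * edir)).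
    { rewrite Cmod_mult, Cmod_edir, Cmod_Cexp, Rmult_1_r. unfold M, numerator_mod. f_equal.
      unfold Clog. simpl. ring. }
    assert (Hx0 := saddle_pt_neq_0 eta He1 He2 (- 1) Hm1). assert (He0 := eta_neq_0 eta He1).
    assert (Hv : 88 / 100 <= Cmod (x / eta)).
    { rewrite Cmod_div by exact He0.
      generalize (saddle_far eta He1 He2 Hem (- 1) 1 Hm1 ltac:(lra)). rewrite Cmult_1_l. fold (saddle_pt eta (- 1)). fold x.
      generalize (Cmod_ge_0 (saddle_shift (- 1))). intros A B.
      apply (Rmult_le_reg_r (Cmod eta)); [lra|].
      replace (Cmod x / Cmod eta * Cmod eta) with (Cmod x) by (field; lra). lra. }
    rewrite EM. unfold x at 1 2 3 4. rewrite (saddle_numerator s eta Heta He1 He2 (- 1) Hm1). fold x.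
    rewrite Cmod_div by (apply Cmod_gt_0; lra).
    rewrite !Cmod_mult, Cmod_opp, Cmod_nonneg_R, Cmod_Cexp by (apply Rlt_le, exp_pos).
    destruct (saddle_delta_bounds eta He1 He2 Hem (- 1) Hm1) as [D1 _].
    rewrite Rabs_left in D1 by lra.
    assert (HD : exp (fst (saddle_delta eta (- 1))) <= 112 / 100).
    { apply Rle_trans with (exp (1 / 10)).
      - apply exp_le. generalize (Cmod_fst (saddle_delta eta (- 1))) (Rle_abs (fst (saddle_delta eta (- 1)))). lra.
      - apply Rle_trans with (1 := exp_le_inv_1_minus (1 / 10) ltac:(lra)). lra. }
    assert (HG : gauss (- 1) <= 5 / 1000).
    { replace (gauss (- 1)) with (gauss 1) by (unfold gauss; f_equal; ring). apply gauss_1_le. }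
    assert (G0 : 0 < gauss (- 1)) by apply exp_pos.
    generalize (exp_pos (fst (saddle_delta eta (- 1)))); intros D0.
    generalize (Cmod_ge_0 (saddle_amp s eta)); intros A0.
    apply (Rmult_le_reg_r (Cmod (x / eta))); [lra|].
    set (a := Cmod (saddle_amp s eta)) in *. set (g := gauss (- 1)) in *.
    set (d := exp (fst (saddle_delta eta (- 1)))) in *. set (w := Cmod (x / eta)) in *.
    replace (a * g * d / w * w) with (a * (g * d)) by (field; lra).
    replace (65 / 10000 * a * w) with (a * (65 / 10000 * w)) by ring.
    apply Rmult_le_compat_l; [exact A0|].
    assert (g * d <= 5 / 1000 * (112 / 100)) by (apply Rmult_le_compat; lra). lra. }
  assert (HSx : Cmod x <= S).
  { apply Rle_trans with (1 := Cmod_le_sum x). rewrite !Rabs_pos_eq by lra. unfold S. lra. }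
  assert (Hb : forall v, 0 < v < 1 -> Cmod (R_scaled s x v) <= (21 / 10 * (S * M)) * v ^ n).
  { intros v Hv. unfold R_scaled. rewrite !Cmod_mult, Cmod_nonneg_R by lra.
    assert (Hf := R_integrand_scaled_bound x (v * v) ltac:(lra) ltac:(lra) ltac:(nra) ltac:(fold c; lra)).
    fold c in Hf. fold M in Hf.
    assert (Hln : ln (v * v) = 2 * ln v) by (rewrite ln_mult by lra; ring).
    assert (Hlv : ln v <= 0) by (rewrite <- ln_1; apply ln_le; lra).
    assert (Hpow : exp (c * ln (v * v)) * (2 * v * (1 + / (2 * PI * (v * v) * snd x))) <= 21 / 10 * v ^ n).
    { assert (Hvn : exp ((2 * c - 1) * ln v) <= v ^ n).
      { rewrite <- Rpower_pow by lra. unfold Rpower. apply exp_le. nra. }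
      assert (Hs : exp (c * ln (v * v)) = exp ((2 * c - 1) * ln v) * v).
      { transitivity (exp ((2 * c - 1) * ln v) * exp (ln v)); [|rewrite exp_ln by lra; reflexivity].
        rewrite <- exp_plus. f_equal. rewrite Hln. ring. }
      rewrite Hs.
      replace (exp ((2 * c - 1) * ln v) * v * (2 * v * (1 + / (2 * PI * (v * v) * snd x))))
        with (exp ((2 * c - 1) * ln v) * (2 * (v * v) + / (PI * snd x))) by (field; repeat split; lra).
      rewrite (Rmult_comm (21 / 10)).
      assert (Hi : / (PI * snd x) <= / 12) by (apply Rinv_le_contravar; [lra|nra]).
      assert (Hi0 : 0 < / (PI * snd x)) by (apply Rinv_0_lt_compat; nra).
      apply Rmult_le_compat; [apply Rlt_le, exp_pos| |exact Hvn|]; nra. }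
    generalize (Cmod_ge_0 x) (Cmod_ge_0 (R_integrand s (RtoC (v * v) * x))); intros X0 F0.
    set (P := exp (c * ln (v * v))) in *. set (Q := 1 + / (2 * PI * (v * v) * snd x)) in *.
    apply Rle_trans with (2 * v * (S * (M * (P * Q)))).
    - apply Rmult_le_compat_l; [lra|]. apply Rmult_le_compat; assumption.
    - replace (2 * v * (S * (M * (P * Q)))) with ((S * M) * (P * (2 * v * Q))) by ring.
      replace (21 / 10 * (S * M) * v ^ n) with ((S * M) * (21 / 10 * v ^ n)) by ring.
      apply Rmult_le_compat_l; [nra|exact Hpow]. }
  apply Rle_trans with (1 := CRInt_pow_bound _ _ n Ex1 Ex2 Hb).
  rewrite S_INR.
  apply (Rmult_le_reg_r (INR n + 1)); [lra|].
  unfold Rdiv at 1. rewrite Rmult_assoc, Rinv_l, Rmult_1_r by lra.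
  generalize (Cmod_ge_0 (saddle_amp s eta)); intros A0.
  assert (S * M <= S * (65 / 10000 * Cmod (saddle_amp s eta))) by (apply Rmult_le_compat_l; lra).
  assert (1 / 100 * Cmod (saddle_amp s eta) * (11 * S) <= 1 / 100 * Cmod (saddle_amp s eta) * (INR n + 1))
    by (apply Rmult_le_compat_l; lra).
  nra.
Qed.

Lemma cder_saddle_difference (r : R) :
  - 1 <= r ->
  cder (fun r => R_prim s (saddle_pt eta r) - saddle_amp s eta * RtoC (gauss_prim r))%C r
    (edir * R_integrand s (saddle_pt eta r) - saddle_amp s eta * RtoC (gauss r))%C.
Proof.
  intros Hr. apply cder_minus.
  - apply cder_ext with (fun r => R_prim s ((eta - RtoC (1 / 4)) + RtoC r * edir)).
    { intros u. rewrite saddle_pt_line. reflexivity. }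
    rewrite saddle_pt_line. apply cder_R_prim; [apply saddle_sigma_le|].
    rewrite <- saddle_pt_line. apply slit_domain_upper.
    generalize (saddle_pt_quadrant eta He1 He2 r Hr); lra.
  - apply cder_scal, cder_R, is_derive_gauss_prim.
Qed.

(** Error budget: 1/4 for r >= 0, (1 - 1/e) / 4 <= 1/6 for -1 <= r <= 0, 0.01 for the segment from
    0, and 0.01 for the part of the Gaussian below -1. *)
Theorem R_ray_saddle :
  Cmod (R_ray s - saddle_amp s eta * RtoC (1 / sqrt 2)) <= 44 / 100 * Cmod (saddle_amp s eta).
Proof.
  set (A := saddle_amp s eta). assert (A0 := Cmod_ge_0 A).
  set (F := fun r => (R_prim s (saddle_pt eta r) - A * RtoC (gauss_prim r))%C).
  set (F' := fun r => (edir * R_integrand s (saddle_pt eta r) - A * RtoC (gauss r))%C).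
  assert (HF : forall r, - 1 <= r -> cder F r (F' r)) by exact cder_saddle_difference.
  assert (HF' : forall r, - 1 <= r -> Cmod (F' r) <= Cmod A * (1 / 4 * exp (- Rabs r)))
    by exact (saddle_pointwise s eta Heta He1 He2 Hem).
  assert (Hleft : Cmod (F 0 - F (- 1)) <= Cmod A * (1 / 4 * (1 - exp (- 1)))).
  { replace (Cmod A * (1 / 4 * (1 - exp (- 1)))) with
      ((fun r => Cmod A * (1 / 4 * exp r)) 0 - (fun r => Cmod A * (1 / 4 * exp r)) (- 1))
      by (cbv beta; rewrite exp_0; ring).
    apply (cder_mean_value F F' (fun r => Cmod A * (1 / 4 * exp r)) (fun r => Cmod A * (1 / 4 * exp r))); [lra| | |].
    - intros u Hu; apply HF; lra.
    - intros u Hu. auto_derive; [trivial|ring].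
    - intros u Hu. rewrite <- (Ropp_involutive u) at 2. rewrite <- (Rabs_left1 u) by lra. apply HF'; lra. }
  assert (Hright : forall r, 0 <= r -> Cmod (F r - F 0) <= Cmod A * (1 / 4)).
  { intros r Hr. apply Rle_trans with (- Cmod A * (1 / 4 * exp (- r)) - - Cmod A * (1 / 4 * exp (- 0))).
    - apply (cder_mean_value F F' (fun r => - Cmod A * (1 / 4 * exp (- r))) (fun r => Cmod A * (1 / 4 * exp (- r)))); [lra| | |].
      + intros u Hu; apply HF; lra.
      + intros u Hu. auto_derive; [trivial|ring].
      + intros u Hu. rewrite <- (Rabs_pos_eq u) at 2 by lra. apply HF'; lra.
    - rewrite Ropp_0, exp_0. generalize (exp_pos (- r)). nra. }
  assert (He : 1 / 3 <= exp (- 1)).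
  { replace (exp (- 1)) with (/ exp 1) by (rewrite <- exp_Ropp; f_equal; lra).
    replace (1 / 3) with (/ 3) by field.
    apply Rinv_le_contravar; [apply exp_pos|apply exp_le_3]. }
  assert (Hlim : clim (Rbar_locally p_infty)
     (fun r => R_prim s (saddle_pt eta r) - A * RtoC (gauss_prim r + gauss_prim 1))%C
     (R_ray s - A * RtoC (1 / sqrt 2 / 2 + gauss_prim 1))%C).
  { apply clim_minus.
    - apply clim_ext_loc with (fun r => R_prim s ((eta - RtoC (1 / 4)) + RtoC r * edir)).
      { apply filter_forall. intros u. rewrite saddle_pt_line. reflexivity. }
      apply R_prim_lim, saddle_sigma_le.
    - apply clim_mult; [apply clim_const|]. apply clim_R.
      apply rlim_plus; [apply gauss_prim_lim|apply rlim_const]. }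
  assert (Hmain : Cmod (R_ray s - A * RtoC (1 / sqrt 2 / 2 + gauss_prim 1)) <= Cmod A * (1 / 4 + 1 / 6 + 1 / 100)).
  { apply (clim_Cmod_le _ _ (fun _ => Cmod A * (1 / 4 + 1 / 6 + 1 / 100)) _ Hlim (rlim_const _)).
    exists 0. intros r Hr.
    (* The missing piece of the Gaussian between -1 and 0 is [gauss_prim 1], as [gauss_prim] is
       odd. *)
    replace (R_prim s (saddle_pt eta r) - A * RtoC (gauss_prim r + gauss_prim 1))%C
      with ((F r - F 0) + (F 0 - F (- 1)) + R_prim s (saddle_pt eta (- 1)))%C.
    2: { unfold F. replace (gauss_prim (- 1)) with (- gauss_prim 1) by (rewrite <- gauss_prim_opp; f_equal; lra).
       rewrite RtoC_opp, RtoC_plus. ring. }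
    apply Rle_trans with (1 := Cmod_triangle _ _).
    generalize (Cmod_triangle (F r - F 0) (F 0 - F (- 1))) (Hright r ltac:(lra)) saddle_tail.
    fold A. nra. }
  replace (R_ray s - A * RtoC (1 / sqrt 2))%C with
    ((R_ray s - A * RtoC (1 / sqrt 2 / 2 + gauss_prim 1)) + A * RtoC (gauss_prim 1 - 1 / sqrt 2 / 2))%C.
  2: { replace (RtoC (1 / sqrt 2)) with (RtoC (1 / sqrt 2 / 2 + 1 / sqrt 2 / 2)) by (f_equal; field; apply Rgt_not_eq, sqrt_lt_R0; lra).
       rewrite !RtoC_plus, RtoC_minus. ring. }
  apply Rle_trans with (1 := Cmod_triangle _ _). rewrite Cmod_mult, Cmod_R.
  assert (Hg : Rabs (gauss_prim 1 - 1 / sqrt 2 / 2) <= 1 / 100).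
  { apply Rabs_le. split; [generalize gauss_prim_1_lower; lra|].
    assert (gauss_prim 1 <= 1 / sqrt 2 / 2); [|lra].
    generalize (gauss_prim_sqr 1) (gauss_aux_bound 1) inv_sqrt2_sqr inv_sqrt2_bounds (gauss_prim_ge_0 1 ltac:(lra)).
    intros. set (q := 1 / sqrt 2) in *. nra. }
  nra.
Qed.

End SaddleValue.

(** * Stirling's formula from Gauss' product *)

Definition stirling (z : C) : C := Cexp ((z - RtoC (1 / 2)) * Clog z - z).

(** The term of Gudermann's series: log Gamma(z) is (z - 1/2) log z - z + log(2 pi) / 2 plus the sum
    of these terms at z, z + 1, z + 2, ... *)
Definition stirling_step (z : C) : C := ((z + RtoC (1 / 2)) * (Clog (z + 1) - Clog z) - 1)%C.

Lemma stirling_succ (z : C) :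
  0 < fst z -> (z * stirling z * Cexp (stirling_step z))%C = stirling (z + 1).
Proof.
  intros Hz. unfold stirling, stirling_step.
  rewrite <- (Cexp_Clog z) at 1 by (left; exact Hz).
  rewrite <- !Cexp_plus. f_equal. rewrite RtoC_div by lra. field.
Qed.

Lemma Cmod_ge_fst (z : C) : fst z <= Cmod z.
Proof. apply Rle_trans with (2 := Cmod_fst z), Rle_abs. Qed.

Lemma Cmod_add_pos (z : C) (t : R) : 0 <= fst z -> 0 <= t -> Cmod z <= Cmod (z + RtoC t).
Proof.
  intros Hz Ht. apply Cmod_ge_intro; [apply Cmod_ge_0|].
  replace (Cmod z ^ 2) with (Cmod z * Cmod z) by ring. rewrite Cmod_sqr. simpl. nra.
Qed.

(** Expanding about the midpoint m = z + 1/2 makes the difference of logarithms odd in the step, so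
    that its error is cubic: the derivative in u is u^2 / (4 m (m + u/2) (m - u/2)). The outer
    factor m cancels the one in the denominator. *)
Lemma stirling_step_bound (z : C) : 0 < fst z -> Cmod (stirling_step z) <= / (12 * Cmod z ^ 2).
Proof.
  intros Hz. assert (Hm0 : 0 < Cmod z) by (generalize (Cmod_ge_fst z); lra).
  set (m := (z + RtoC (1 / 2))%C).
  assert (Hm : Cmod z <= Cmod m) by (apply Cmod_add_pos; lra).
  set (A := fun u : R => (Clog (m + RtoC u * RtoC (1 / 2)) - Clog (m + RtoC u * - RtoC (1 / 2)) - RtoC u * / m)%C).
  set (A' := fun u : R => (RtoC (u * u / 4) / (m * (m + RtoC u * RtoC (1 / 2)) * (m + RtoC u * - RtoC (1 / 2))))%C).
  assert (Hm' : m <> 0%C) by (apply Cmod_gt_0; lra).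
  assert (Hp : forall u, 0 <= u <= 1 -> 0 < fst (m + RtoC u * RtoC (1 / 2))%C /\ 0 < fst (m + RtoC u * - RtoC (1 / 2))%C).
  { intros u Hu. unfold m; simpl. split; lra. }
  assert (HA : forall u, 0 <= u <= 1 -> cder A u (A' u)).
  { intros u Hu. destruct (Hp u Hu) as [P1 P2]. unfold A. eapply cder_eq.
    - apply cder_minus; [apply cder_minus|].
      + apply cder_log; [apply cder_line|left; exact P1].
      + apply cder_log; [apply cder_line|left; exact P2].
      + apply cder_mult; [apply cder_id|apply cder_const].
    - cbv beta. unfold A'.
      assert (N1 := slit_neq_0 _ (or_introl P1)). assert (N2 := slit_neq_0 _ (or_introl P2)).
      replace (RtoC (u * u / 4)) with (RtoC u * RtoC u * (RtoC (1 / 2) * RtoC (1 / 2)))%C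
        by (rewrite <- !RtoC_mult; f_equal; field).
      replace (m + RtoC u * - RtoC (1 / 2))%C with (m - RtoC u * RtoC (1 / 2))%C in * by ring.
      assert (E : RtoC 1 = (RtoC (1 / 2) + RtoC (1 / 2))%C) by (rewrite <- RtoC_plus; f_equal; field).
      set (h := RtoC (1 / 2)) in *.
      transitivity ((h / (m + RtoC u * h) - (- h) / (m - RtoC u * h) - (h + h) / m))%C.
      { rewrite <- E. field. repeat split; assumption. }
      transitivity (RtoC u * RtoC u * (h * h) * (h + h) / (m * (m + RtoC u * h) * (m - RtoC u * h)))%C.
      { field. repeat split; assumption. }
      rewrite <- E. field. repeat split; assumption. }
  assert (HB : forall u, 0 <= u <= 1 -> Cmod (A' u) <= / (4 * (Cmod z ^ 2 * Cmod m)) * u ^ 2).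
  { intros u Hu. destruct (Hp u Hu) as [P1 P2].
    assert (N1 := slit_neq_0 _ (or_introl P1)). assert (N2 := slit_neq_0 _ (or_introl P2)).
    unfold A'. rewrite Cmod_div, !Cmod_mult, Cmod_nonneg_R by (nra || (repeat apply Cmult_neq_0; assumption)).
    assert (B1 : Cmod z <= Cmod (m + RtoC u * RtoC (1 / 2))).
    { apply Rle_trans with (1 := Hm). rewrite <- RtoC_mult. apply Cmod_add_pos; [unfold m; simpl; lra|lra]. }
    assert (B2 : Cmod z <= Cmod (m + RtoC u * - RtoC (1 / 2))).
    { replace (m + RtoC u * - RtoC (1 / 2))%C with (z + RtoC (1 / 2 - u / 2))%C.
      - apply Cmod_add_pos; lra.
      - unfold m. apply C_eq; simpl; field. }
    replace (/ (4 * (Cmod z ^ 2 * Cmod m)) * u ^ 2) with (u * u / 4 * / (Cmod m * Cmod z * Cmod z)) by (field; lra).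
    unfold Rdiv. apply Rmult_le_compat_l; [nra|].
    apply Rinv_le_contravar.
    - apply Rmult_lt_0_compat; [apply Rmult_lt_0_compat|]; lra.
    - apply Rmult_le_compat; try lra; [apply Rmult_le_pos; lra|].
      apply Rmult_le_compat_l; lra. }
  assert (H := cder_unit_bound A A' _ 2 HA HB).
  assert (E : stirling_step z = (m * (A 1 - A 0))%C).
  { unfold stirling_step, A. fold m.
    replace (m + RtoC 1 * RtoC (1 / 2))%C with (z + 1)%C by (unfold m; apply C_eq; simpl; field).
    replace (m + RtoC 1 * - RtoC (1 / 2))%C with z by (unfold m; apply C_eq; simpl; field).
    rewrite !Cmult_0_l, Cplus_0_r. field. exact Hm'. }
  rewrite E, Cmod_mult.
  apply Rle_trans with (Cmod m * (/ (4 * (Cmod z ^ 2 * Cmod m)) / INR 3)).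
  - apply Rmult_le_compat_l; [lra|exact H].
  - right. simpl INR. field. lra.
Qed.

Fixpoint stirling_sum (z : C) (n : nat) : C :=
  match n with
  | O => stirling_step z
  | S m => (stirling_sum z m + stirling_step (z + RtoC (INR (S m))))%C
  end.

Lemma rising_prod_stirling (z : C) (n : nat) :
  0 < fst z ->
  (rising_prod z n * stirling z * Cexp (stirling_sum z n))%C = stirling (z + RtoC (INR (S n))).
Proof.
  intros Hz. induction n as [|n IH].
  - simpl rising_prod. simpl stirling_sum. rewrite stirling_succ by exact Hz. reflexivity.
  - simpl rising_prod. simpl stirling_sum. fold (INR (S n)). rewrite Cexp_plus.
    change (match n with 0%nat => 1 | S _ => INR n + 1 end) with (INR (S n)) in *.
    replace (INR (S (S n))) with (INR (S n) + 1) by (rewrite (S_INR (S n)); reflexivity).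
    rewrite RtoC_plus, Cplus_assoc.
    rewrite <- stirling_succ, <- IH by (simpl; generalize (pos_INR (S n)); simpl; lra).
    ring.
Qed.

Lemma Cmod_add_INR_ge (z : C) (n : nat) : 0 < fst z -> INR n <= Cmod (z + RtoC (INR n)).
Proof.
  intros Hz. apply Rle_trans with (2 := Cmod_ge_fst _). simpl. lra.
Qed.

Lemma stirling_sum_cauchy (z : C) (m j : nat) :
  0 < fst z -> (1 <= m)%nat ->
  Cmod (stirling_sum z (m + j) - stirling_sum z m) <= (/ INR m - / INR (m + j)) / 12.
Proof.
  intros Hz Hm. assert (Hm0 : 0 < INR m) by (apply lt_0_INR; lia).
  induction j as [|j IH].
  - rewrite Nat.add_0_r. replace (stirling_sum z m - stirling_sum z m)%C with (RtoC 0) by ring.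
    rewrite Cmod_0. lra.
  - rewrite Nat.add_succ_r. simpl stirling_sum.
    change (match (m + j)%nat with 0%nat => 1 | S _ => INR (m + j) + 1 end) with (INR (S (m + j))).
    set (w := (z + RtoC (INR (S (m + j))))%C).
    replace (stirling_sum z (m + j) + stirling_step w - stirling_sum z m)%C
      with ((stirling_sum z (m + j) - stirling_sum z m) + stirling_step w)%C by ring.
    apply Rle_trans with (1 := Cmod_triangle _ _).
    assert (Hn : 0 < INR (m + j)) by (apply lt_0_INR; lia).
    assert (Hw : INR (S (m + j)) <= Cmod w) by (apply Cmod_add_INR_ge, Hz).
    assert (Hb : Cmod (stirling_step w) <= / (12 * Cmod w ^ 2)).
    { apply stirling_step_bound. unfold w; simpl fst. generalize (pos_INR (S (m + j))); simpl; lra. }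
    rewrite S_INR in *. set (k := INR (m + j)) in *.
    assert (/ (12 * Cmod w ^ 2) <= (/ k - / (k + 1)) / 12).
    { apply Rle_trans with (/ (12 * (k * (k + 1)))).
      - apply Rinv_le_contravar; nra.
      - right. field. lra. }
    lra.
Qed.

(** Binet's function, the correction to Stirling's main term in log Gamma. *)
Definition stirling_log (z : C) : C := CLim_seq (stirling_sum z).

Lemma CLim_seq_unique (u : nat -> C) (L : C) : clim eventually u L -> CLim_seq u = L.
Proof.
  intros [L1 L2]. unfold CLim_seq.
  rewrite (is_lim_seq_unique (fun n => fst (u n)) (Finite (fst L)) L1).
  rewrite (is_lim_seq_unique (fun n => snd (u n)) (Finite (snd L)) L2).
  destruct L; reflexivity.
Qed.

Lemma inv_INR_lim : filterlim (fun n => / INR n) eventually (locally 0).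
Proof.
  assert (H := is_lim_seq_inv INR p_infty is_lim_seq_INR). apply H. discriminate.
Qed.

Lemma stirling_log_lim (z : C) : 0 < fst z -> clim eventually (stirling_sum z) (stirling_log z).
Proof.
  intros Hz. destruct (ex_clim (F := eventually) (stirling_sum z)) as [L HL].
  - intros eps. destruct (rlim_lt _ _ eps inv_INR_lim (cond_pos eps)) as [N HN].
    set (M := S N). specialize (HN M ltac:(unfold M; lia)).
    assert (HM0 : 0 < INR M) by (apply lt_0_INR; unfold M; lia).
    assert (Hc : forall n, (M <= n)%nat -> Cmod (stirling_sum z n - stirling_sum z M) < eps / 12).
    { intros n Hn. replace n with (M + (n - M))%nat by lia.
      apply Rle_lt_trans with (1 := stirling_sum_cauchy z M (n - M) Hz ltac:(unfold M; lia)).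
      assert (0 < / INR (M + (n - M))) by (apply Rinv_0_lt_compat, lt_0_INR; unfold M; lia). lra. }
    exists (fun n => (M <= n)%nat). split; [exists M; auto|].
    intros u v Hu Hv.
    replace (stirling_sum z v - stirling_sum z u)%C
      with ((stirling_sum z v - stirling_sum z M) - (stirling_sum z u - stirling_sum z M))%C by ring.
    apply Rle_lt_trans with (1 := Cmod_triangle _ _). rewrite Cmod_opp.
    generalize (Hc u Hu) (Hc v Hv) (cond_pos eps). lra.
  - unfold stirling_log. rewrite (CLim_seq_unique _ _ HL). exact HL.
Qed.

(** Holds because z and n enclose an angle of at most pi/2. It makes the bound of the correction
    depend on |z| alone, as needed when (1 - s)/2 is far from the real axis. *)
Lemma Cmod_add_INR_sqr (z : C) (n : nat) :
  0 < fst z -> (Cmod z + INR n) ^ 2 / 2 <= Cmod (z + RtoC (INR n)) ^ 2.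
Proof.
  intros Hz. replace (Cmod (z + RtoC (INR n)) ^ 2) with (Cmod (z + RtoC (INR n)) * Cmod (z + RtoC (INR n))) by ring.
  rewrite Cmod_sqr. simpl fst; simpl snd. generalize (Cmod_sqr z) (pos_INR n).
  generalize (pow2_ge_0 (Cmod z - INR n)). nra.
Qed.

Lemma stirling_sum_bound (z : C) (n : nat) :
  0 < fst z -> 1 < Cmod z -> Cmod (stirling_sum z n) <= (/ (Cmod z - 1) - / (Cmod z + INR n)) / 6.
Proof.
  intros Hz Hz1.
  assert (Hs : forall k, Cmod (stirling_step (z + RtoC (INR k))) <= (/ (Cmod z + INR k - 1) - / (Cmod z + INR k)) / 6).
  { intros k. generalize (pos_INR k); intros Hk.
    apply Rle_trans with (1 := stirling_step_bound (z + RtoC (INR k)) ltac:(simpl; lra)).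
    generalize (Cmod_add_INR_sqr z k Hz); intros H2. set (R := Cmod z + INR k) in *.
    assert (HR : 1 < R) by (unfold R; lra).
    apply Rle_trans with (/ (6 * (R * (R - 1)))).
    - apply Rinv_le_contravar; nra.
    - right. field. lra. }
  induction n as [|n IH].
  - simpl stirling_sum. specialize (Hs 0%nat). simpl in *. rewrite Cplus_0_r, Rplus_0_r in *. exact Hs.
  - simpl stirling_sum.
    change (match n with 0%nat => 1 | S _ => INR n + 1 end) with (INR (S n)).
    apply Rle_trans with (1 := Cmod_triangle _ _).
    specialize (Hs (S n)). rewrite S_INR in *.
    replace (Cmod z + (INR n + 1) - 1) with (Cmod z + INR n) in Hs by ring. lra.
Qed.

Lemma stirling_log_bound (z : C) : 0 < fst z -> 1 < Cmod z -> Cmod (stirling_log z) <= / (Cmod z - 1) / 6.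
Proof.
  intros Hz Hz1.
  apply (clim_Cmod_le (F := eventually) _ _ (fun _ => / (Cmod z - 1) / 6) _ (stirling_log_lim z Hz) (rlim_const _)).
  exists 0%nat. intros n _. apply Rle_trans with (1 := stirling_sum_bound z n Hz Hz1).
  assert (0 < / (Cmod z + INR n)) by (apply Rinv_0_lt_compat; generalize (pos_INR n); lra). lra.
Qed.

(** * The limit of Gauss' product in the right half-plane *)

Definition gauss_product (z : C) (n : nat) : C :=
  (rising_prod z n / (RtoC (INR (Factorial.fact n)) * Cpowc (RtoC (INR n)) z))%C.

Lemma recipGamma_lim (z L : C) : clim eventually (gauss_product z) L -> recipGamma z = L.
Proof. apply CLim_seq_unique. Qed.

Lemma rising_prod_1 (n : nat) : rising_prod 1 n = RtoC (INR (Factorial.fact (S n))).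
Proof.
  induction n as [|n IH]; [reflexivity|].
  change (rising_prod 1 (S n)) with (rising_prod 1 n * (1 + RtoC (INR (S n))))%C.
  rewrite IH. replace (Factorial.fact (S (S n))) with (Factorial.fact (S n) * S (S n))%nat by (simpl; ring).
  rewrite mult_INR, RtoC_mult. f_equal. rewrite (S_INR (S n)), RtoC_plus. ring.
Qed.

Definition log_shift (w : C) (n : nat) : C := (Clog (RtoC (INR n) + w) - RtoC (ln (INR n)))%C.

Lemma log_shift_bound (w : C) (n : nat) :
  0 <= fst w -> (1 <= n)%nat ->
  Cmod (RtoC (INR n) * log_shift w n - w) <= Cmod w ^ 2 / 2 * / INR n.
Proof.
  intros Hw Hn. assert (Hn0 : 0 < INR n) by (apply lt_0_INR; lia). set (x := INR n) in *.
  set (A := fun u : R => (Clog (RtoC x + RtoC u * w) - RtoC u * (w / RtoC x))%C).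
  set (A' := fun u : R => (- RtoC u * w * w / (RtoC x * (RtoC x + RtoC u * w)))%C).
  assert (Hx : RtoC x <> 0%C) by (apply RtoC_neq_0; lra).
  assert (Hp : forall u, 0 <= u <= 1 -> x <= Cmod (RtoC x + RtoC u * w)).
  { intros u Hu. apply Rle_trans with (2 := Cmod_ge_fst _). simpl. nra. }
  assert (Hs : forall u, 0 <= u <= 1 -> slit (RtoC x + RtoC u * w)) by (intros u Hu; left; simpl; nra).
  assert (HA : forall u, 0 <= u <= 1 -> cder A u (A' u)).
  { intros u Hu. assert (N := slit_neq_0 _ (Hs u Hu)). unfold A. eapply cder_eq.
    - apply cder_minus.
      + apply cder_log; [apply cder_line|apply Hs, Hu].
      + apply cder_mult; [apply cder_id|apply cder_const].
    - cbv beta. unfold A'. field. split; assumption. }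
  assert (HB : forall u, 0 <= u <= 1 -> Cmod (A' u) <= Cmod w ^ 2 / x ^ 2 * u ^ 1).
  { intros u Hu. assert (N := slit_neq_0 _ (Hs u Hu)). specialize (Hp u Hu).
    unfold A'. rewrite Cmod_div, !Cmod_mult, Cmod_opp, !Cmod_nonneg_R by (lra || (apply Cmult_neq_0; assumption)).
    replace (Cmod w ^ 2 / x ^ 2 * u ^ 1) with (u * Cmod w * Cmod w * / (x * x)) by (field; lra).
    unfold Rdiv. apply Rmult_le_compat_l; [generalize (Cmod_ge_0 w); intros; repeat apply Rmult_le_pos; lra|].
    apply Rinv_le_contravar; nra. }
  assert (H := cder_unit_bound A A' _ 1 HA HB).
  assert (E : (RtoC x * log_shift w n - w = RtoC x * (A 1 - A 0))%C).
  { unfold log_shift, A. fold x. rewrite Cmult_1_l, !Cmult_0_l, Cplus_0_r, Clog_pos by lra. field. exact Hx. }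
  rewrite E, Cmod_mult, Cmod_nonneg_R by lra.
  apply Rle_trans with (x * (Cmod w ^ 2 / x ^ 2 / INR 2)); [apply Rmult_le_compat_l; [lra|exact H]|].
  right. simpl INR. field. lra.
Qed.

Lemma INR_log_shift_lim (w : C) :
  0 <= fst w -> clim eventually (fun n => RtoC (INR n) * log_shift w n)%C w.
Proof.
  intros Hw. apply clim_bound with (fun n => Cmod w ^ 2 / 2 * / INR n).
  - exists 1%nat. intros n Hn. apply log_shift_bound; assumption.
  - rewrite <- (Rmult_0_r (Cmod w ^ 2 / 2)). apply rlim_mult; [apply rlim_const|apply inv_INR_lim].
Qed.

Lemma log_shift_lim (w : C) : 0 <= fst w -> clim eventually (log_shift w) 0.
Proof.
  intros Hw. apply clim_ext_loc with (fun n => RtoC (/ INR n) * (RtoC (INR n) * log_shift w n))%C.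
  - exists 1%nat. intros n Hn. assert (0 < INR n) by (apply lt_0_INR; lia).
    rewrite Cmult_assoc, <- RtoC_mult, Rinv_l by lra. ring.
  - rewrite <- (Cmult_0_l w). apply clim_mult; [|apply INR_log_shift_lim, Hw].
    apply clim_R, inv_INR_lim.
Qed.

(** This is 1 / sqrt(2 pi), written as the value forced by Gamma(1) = 1; below it enters through the
    estimate [stirling_const_sqr]. *)
Definition stirling_const : C := (stirling 1 * Cexp (stirling_log 1))%C.

Lemma stirling_neq_0 (z : C) : stirling z <> 0%C.
Proof. apply Cexp_neq_0. Qed.

(** Dividing [rising_prod_stirling] at z by the same identity at 1, where the product is (n + 1)!,
    leaves an elementary quotient that tends to 1. *)
Lemma gauss_product_lim (z : C) :
  0 < fst z ->
  clim eventually (gauss_product z) (stirling_const / stirling z * Cexp (- stirling_log z))%C.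
Proof.
  intros Hz.
  (* The logarithm of (n + 1) stirling(z + n + 1) / (stirling(n + 2) n^z), arranged so that each
     term converges: [log_shift w n] tends to 0 and n times it to w. *)
  set (l := fun n => ((z + RtoC (1 / 2)) * log_shift (z + 1) n + RtoC (INR n) * log_shift (z + 1) n
      - (RtoC (INR n) * log_shift 2 n + RtoC (3 / 2) * log_shift 2 n) + log_shift 1 n - z + 1)%C).
  assert (Hl : clim eventually l 0).
  { replace (RtoC 0) with ((z + RtoC (1 / 2)) * 0 + (z + 1) - (2 + RtoC (3 / 2) * 0) + 0 - z + 1)%C by ring.
    assert (F1 : 0 <= fst (z + 1)%C) by (simpl; lra).
    assert (F2 : 0 <= fst (RtoC 2)) by (simpl; lra).
    assert (F3 : 0 <= fst (RtoC 1)) by (simpl; lra).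
    unfold l. apply clim_plus; [|apply clim_const]. apply clim_minus; [|apply clim_const].
    apply clim_plus; [|apply log_shift_lim, F3].
    apply clim_minus; apply clim_plus.
    - apply clim_mult; [apply clim_const|apply log_shift_lim, F1].
    - apply INR_log_shift_lim, F1.
    - apply INR_log_shift_lim, F2.
    - apply clim_mult; [apply clim_const|apply log_shift_lim, F2]. }
  apply clim_ext_loc with
    (fun n => (stirling 1 / stirling z * Cexp (stirling_sum 1 n - stirling_sum z n + l n))%C).
  - exists 1%nat. intros n Hn. assert (Hn0 : 0 < INR n) by (apply lt_0_INR; lia).
    assert (H1 := rising_prod_stirling z n Hz).
    assert (H2 := rising_prod_stirling 1 n ltac:(simpl; lra)).
    rewrite rising_prod_1 in H2.
    assert (Hf : RtoC (INR (Factorial.fact n)) <> 0%C).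
    { apply RtoC_neq_0, INR_fact_neq_0. }
    assert (Hn1 : RtoC (INR (S n)) <> 0%C).
    { apply RtoC_neq_0, not_0_INR; lia. }
    replace (RtoC (INR (Factorial.fact (S n)))) with (RtoC (INR (S n)) * RtoC (INR (Factorial.fact n)))%C in H2
      by (rewrite <- RtoC_mult, <- mult_INR; reflexivity).
    unfold gauss_product.
    assert (HE : (Cexp (l n) * stirling (1 + RtoC (INR (S n))) * Cpowc (RtoC (INR n)) z
        = stirling (z + RtoC (INR (S n))) * RtoC (INR (S n)))%C).
    { unfold stirling, Cpowc. rewrite Clog_pos by exact Hn0.
      transitivity (Cexp ((z + RtoC (INR (S n)) - RtoC (1 / 2)) * Clog (z + RtoC (INR (S n))) - (z + RtoC (INR (S n))))
                      * Cexp (Clog (RtoC (INR (S n)))))%C.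
      2: { rewrite Cexp_Clog; [reflexivity|]. left. change (0 < INR (S n)). apply lt_0_INR; lia. }
      rewrite <- !Cexp_plus. f_equal. unfold l, log_shift.
      replace (z + RtoC (INR (S n)))%C with (RtoC (INR n) + (z + 1))%C by (rewrite S_INR, RtoC_plus; ring).
      replace (1 + RtoC (INR (S n)))%C with (RtoC (INR n) + 2)%C
        by (rewrite S_INR, RtoC_plus; apply C_eq; simpl; ring).
      replace (RtoC (INR (S n))) with (RtoC (INR n) + 1)%C by (rewrite S_INR, RtoC_plus; ring).
      replace (RtoC (3 / 2)) with (1 + RtoC (1 / 2))%C by (rewrite <- RtoC_plus; f_equal; field).
      assert (Eh : RtoC (1 / 2) = (/ 2)%C) by (rewrite RtoC_div by lra; field).
      set (L2 := Clog (RtoC (INR n) + 2)). rewrite Eh. field. }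
    assert (HP : Cpowc (RtoC (INR n)) z <> 0%C) by apply Cexp_neq_0.
    rewrite Cexp_plus, Cexp_minus.
    assert (S1 := stirling_neq_0 1). assert (Sz := stirling_neq_0 z).
    assert (E1 := Cexp_neq_0 (stirling_sum 1 n)). assert (Ez := Cexp_neq_0 (stirling_sum z n)).
    rewrite <- H1, <- H2 in HE.
    set (p := Cpowc _ _) in *. set (e := Cexp (l n)) in *. set (r := rising_prod z n) in *.
    set (f := RtoC (INR (Factorial.fact n))) in *. set (k := RtoC (INR (S n))) in *.
    set (a := stirling 1) in *. set (b := stirling z) in *.
    set (c := Cexp (stirling_sum 1 n)) in *. set (d := Cexp (stirling_sum z n)) in *.
    assert (HE2 : (e * (f * a * c) * p = r * b * d)%C).
    { replace (e * (f * a * c) * p)%C with (/ k * (e * (k * f * a * c) * p))%C by (field; exact Hn1).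
      rewrite HE. field. exact Hn1. }
    replace (r / (f * p))%C with (/ (b * d) * (r * b * d) / (f * p))%C by (field; repeat split; assumption).
    rewrite <- HE2. field. repeat split; assumption.
  - replace (stirling_const / stirling z * Cexp (- stirling_log z))%C
      with (stirling 1 / stirling z * Cexp (stirling_log 1 - stirling_log z + 0))%C.
    + apply clim_mult; [apply clim_const|]. apply clim_exp.
      apply clim_plus; [|exact Hl]. apply clim_minus; apply stirling_log_lim; [simpl; lra|exact Hz].
    + rewrite Cplus_0_r. unfold stirling_const, Cminus, Cdiv. rewrite Cexp_plus. ring.
Qed.

Lemma recipGamma_stirling (z : C) :
  0 < fst z -> recipGamma z = (stirling_const / stirling z * Cexp (- stirling_log z))%C.
Proof. intros Hz. apply recipGamma_lim, gauss_product_lim, Hz. Qed.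

(** * The sine product and the reflection formula *)

Lemma Ci_sqr : (Ci * Ci = - (1))%C.
Proof. apply C_eq; simpl; ring. Qed.

Lemma Csin_alt (z : C) : Csin z = (- Ci / 2 * (Cexp (Ci * z) - Cexp (- (Ci * z))))%C.
Proof.
  unfold Csin. set (E := (Cexp (Ci * z) - Cexp (- (Ci * z)))%C).
  destruct E as [x y]. apply C_eq; simpl; field.
Qed.

Section Trigo.

Context (r : R) (A : R -> C) (a : C) (HA : cder A r a).

Lemma cder_Cexp_i : cder (fun u => Cexp (Ci * A u)) r (Ci * a * Cexp (Ci * A r)).
Proof. apply cder_exp. apply cder_scal, HA. Qed.

Lemma cder_Cexp_mi : cder (fun u => Cexp (- (Ci * A u))) r (- (Ci * a) * Cexp (- (Ci * A r))).
Proof. apply cder_exp, cder_opp, cder_scal, HA. Qed.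

Lemma cder_Ccos : cder (fun u => Ccos (A u)) r (- a * Csin (A r))%C.
Proof.
  unfold Ccos, Cdiv. eapply cder_eq.
  - apply cder_mult; [apply cder_plus; [exact cder_Cexp_i|exact cder_Cexp_mi]|apply cder_const].
  - cbv beta. rewrite Csin_alt. field.
Qed.

Lemma cder_Csin : cder (fun u => Csin (A u)) r (a * Ccos (A r))%C.
Proof.
  apply cder_ext with (fun u => (- Ci / 2 * (Cexp (Ci * A u) - Cexp (- (Ci * A u))))%C).
  { intros u; rewrite Csin_alt; reflexivity. }
  eapply cder_eq.
  - apply cder_scal. apply cder_minus; [exact cder_Cexp_i|exact cder_Cexp_mi].
  - unfold Ccos.
    transitivity (- (Ci * Ci) * a * ((Cexp (Ci * A r) + Cexp (- (Ci * A r))) / 2))%C; [field|].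
    rewrite Ci_sqr. ring.
Qed.

End Trigo.

Lemma Ccos_0 : Ccos 0 = 1%C.
Proof.
  unfold Ccos. rewrite Cmult_0_r. replace (- (0))%C with (RtoC 0) by ring. rewrite Cexp_0. field.
Qed.

Lemma Csin_0 : Csin 0 = 0%C.
Proof.
  rewrite Csin_alt, Cmult_0_r. replace (- (0))%C with (RtoC 0) by ring. ring.
Qed.

Lemma Cmod_Cexp_taylor1 (d : C) : Cmod (Cexp d - 1 - d) <= Cmod d ^ 2 * exp (Cmod d).
Proof.
  set (A := fun u : R => (Cexp (RtoC u * d) - RtoC u * d)%C).
  set (A' := fun u : R => (d * (Cexp (RtoC u * d) - 1))%C).
  assert (H : Cmod (A 1 - A 0) <= Cmod d ^ 2 * exp (Cmod d) / INR 2).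
  { apply (cder_unit_bound A A' _ 1).
    - intros u _. unfold A. eapply cder_eq.
      + apply cder_minus.
        * apply cder_exp. apply cder_mult; [apply cder_id|apply cder_const].
        * apply cder_mult; [apply cder_id|apply cder_const].
      + cbv beta. unfold A'. ring.
    - intros u Hu. unfold A'. rewrite Cmod_mult.
      generalize (Cmod_Cexp_minus_1 (RtoC u * d)). rewrite Cmod_mult, Cmod_nonneg_R by lra.
      generalize (Cmod_ge_0 d). set (n := Cmod d). intros Hn H.
      assert (exp (u * n) <= exp n) by (apply exp_le; nra).
      assert (u * n * exp (u * n) <= u * n * exp n) by (apply Rmult_le_compat_l; nra).
      replace (n ^ 2 * exp n * u ^ 1) with (n * (u * n * exp n)) by ring.
      apply Rmult_le_compat_l; lra. }
  unfold A in H. rewrite Cmult_0_l, Cmult_1_l, Cexp_0 in H. simpl INR in H.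
  replace (Cexp d - 1 - d)%C with (Cexp d - d - (1 - 0))%C by ring.
  apply Rle_trans with (1 := H).
  assert (0 <= Cmod d ^ 2 * exp (Cmod d)) by (apply Rmult_le_pos; [apply pow2_ge_0|apply Rlt_le, exp_pos]).
  lra.
Qed.

Lemma Cmod_Ccos_minus_1 (w : C) : Cmod (Ccos w - 1) <= Cmod w ^ 2 * exp (Cmod w).
Proof.
  unfold Ccos.
  replace ((Cexp (Ci * w) + Cexp (- (Ci * w))) / 2 - 1)%C
    with (RtoC (1 / 2) * ((Cexp (Ci * w) - 1 - Ci * w) + (Cexp (- (Ci * w)) - 1 - - (Ci * w))))%C
    by (rewrite RtoC_div by lra; field).
  rewrite Cmod_mult, Cmod_nonneg_R by lra.
  generalize (Cmod_triangle (Cexp (Ci * w) - 1 - Ci * w) (Cexp (- (Ci * w)) - 1 - - (Ci * w)))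
    (Cmod_Cexp_taylor1 (Ci * w)) (Cmod_Cexp_taylor1 (- (Ci * w))).
  rewrite Cmod_opp, Cmod_mult, Cmod_Ci, Rmult_1_l. lra.
Qed.

Lemma CRInt_derive (W w : R -> C) (a b : R) :
  (forall t, cder W t (w t)) -> (forall t, clim (locally t) w (w t)) ->
  CRInt w a b = (W b - W a)%C.
Proof.
  intros HW Hw. unfold CRInt. rewrite (surjective_pairing (W b - W a)%C). f_equal.
  - apply is_RInt_unique. apply (is_RInt_derive (V := R_CompleteNormedModule) (fun t => fst (W t))).
    + intros t _; exact (proj1 (HW t)).
    + intros t _; exact (proj1 (Hw t)).
  - apply is_RInt_unique. apply (is_RInt_derive (V := R_CompleteNormedModule) (fun t => snd (W t))).
    + intros t _; exact (proj2 (HW t)).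
    + intros t _; exact (proj2 (Hw t)).
Qed.

Lemma ex_RInt_clim (w : R -> C) (a b : R) :
  (forall t, clim (locally t) w (w t)) ->
  ex_RInt (fun t => fst (w t)) a b /\ ex_RInt (fun t => snd (w t)) a b.
Proof.
  intros Hw. split; apply (ex_RInt_continuous (V := R_CompleteNormedModule)); intros t _; apply Hw.
Qed.

Lemma CRInt_minus (h k : R -> C) (a b : R) :
  ex_RInt (fun t => fst (h t)) a b -> ex_RInt (fun t => snd (h t)) a b ->
  ex_RInt (fun t => fst (k t)) a b -> ex_RInt (fun t => snd (k t)) a b ->
  CRInt (fun t => h t - k t)%C a b = (CRInt h a b - CRInt k a b)%C.
Proof.
  intros H1 H2 K1 K2.
  unfold CRInt. apply C_eq; simpl; apply is_RInt_unique.
  - apply (is_RInt_minus (V := R_NormedModule) (fun t => fst (h t)) (fun t => fst (k t)));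
      apply (RInt_correct (V := R_CompleteNormedModule)); assumption.
  - apply (is_RInt_minus (V := R_NormedModule) (fun t => snd (h t)) (fun t => snd (k t)));
      apply (RInt_correct (V := R_CompleteNormedModule)); assumption.
Qed.

(** * Wallis integrals with a complex frequency *)

Definition cos_power (z : C) (n : nat) (t : R) : C := (RtoC (cos t ^ n) * Ccos (RtoC t * (2 * z)))%C.

Definition wallis (z : C) (m : nat) : C := CRInt (cos_power z (2 * m)) 0 (PI / 2).

Definition wallis_R (m : nat) : R := RInt (fun t => cos t ^ (2 * m)) 0 (PI / 2).

Lemma is_derive_cos_pow (n : nat) (t : R) : is_derive (fun u => cos u ^ S n) t (- INR (S n) * cos t ^ n * sin t).
Proof.
  assert (H := is_derive_pow cos (S n) t _ (is_derive_cos t)).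
  eapply is_derive_eq; [exact H|]. rewrite <- pred_Sn. ring.
Qed.

Lemma cder_line_mult (z : C) (t : R) : cder (fun u => RtoC u * z)%C t z.
Proof.
  eapply cder_eq; [apply cder_mult; [apply cder_id|apply cder_const]|]. cbv beta. ring.
Qed.

Lemma clim_cos_power (z : C) (n : nat) (t : R) : clim (locally t) (cos_power z n) (cos_power z n t).
Proof.
  apply clim_mult.
  - apply clim_R. apply (ex_derive_continuous (fun u => cos u ^ n)). auto_derive; trivial.
  - exact (cder_continuous t _ _ (cder_Ccos t _ _ (cder_line_mult (2 * z) t))).
Qed.

(** Two integrations by parts, condensed into the explicit primitive [W]. *)
Lemma wallis_succ (z : C) (m : nat) :
  ((RtoC (INR (2 * m + 2) ^ 2) - 4 * z * z) * wallis z (S m) =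
   RtoC (INR (2 * m + 2) * INR (2 * m + 1)) * wallis z m)%C.
Proof.
  set (k := (2 * m)%nat). set (n := INR (k + 2)).
  assert (En : n = INR k + 2) by (unfold n; rewrite plus_INR; reflexivity).
  assert (Ek1 : INR (k + 1) = INR k + 1) by (rewrite plus_INR; reflexivity).
  assert (ES : (2 * S m = k + 2)%nat) by (unfold k; lia).
  set (W := fun t : R => (RtoC (n * (cos t ^ (k + 1) * sin t)) * Ccos (RtoC t * (2 * z))
                 - 2 * z * (RtoC (cos t ^ (k + 2)) * Csin (RtoC t * (2 * z))))%C).
  set (w := fun t : R => ((RtoC (n ^ 2) - 4 * z * z) * cos_power z (k + 2) t
                 - RtoC (n * INR (k + 1)) * cos_power z k t)%C).
  assert (HW : forall t, cder W t (w t)).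
  { intros t. unfold W, w, cos_power.
    assert (D1 : is_derive (fun u => n * (cos u ^ (k + 1) * sin u)) t
       (n * (n * cos t ^ (k + 2) - INR (k + 1) * cos t ^ k))).
    { assert (Hp := is_derive_cos_pow k t). replace (S k) with (k + 1)%nat in Hp by lia.
      assert (Hs := is_derive_sin t).
      assert (Hm : is_derive (fun u => cos u ^ (k + 1) * sin u) t
         (- INR (k + 1) * cos t ^ k * sin t * sin t + cos t ^ (k + 1) * cos t)).
      { exact (is_derive_mult (K := R_AbsRing) _ _ t _ _ Hp Hs Rmult_comm). }
      eapply is_derive_eq; [exact (is_derive_scal _ _ n _ Hm)|].
      f_equal. rewrite !pow_add. simpl (cos t ^ 1). simpl (cos t ^ 2). rewrite En, Ek1.
      generalize (sin2_cos2 t). unfold Rsqr. intros Hsc.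
      replace (- (INR k + 1) * cos t ^ k * sin t * sin t) with (- (INR k + 1) * cos t ^ k * (sin t * sin t)) by ring.
      replace (sin t * sin t) with (1 - cos t * cos t) by lra. ring. }
    assert (D2 : is_derive (fun u => cos u ^ (k + 2)) t (- n * cos t ^ (k + 1) * sin t)).
    { assert (Hp := is_derive_cos_pow (k + 1) t). replace (S (k + 1)) with (k + 2)%nat in Hp by lia. exact Hp. }
    eapply cder_eq.
    - apply cder_minus.
      + apply cder_mult; [apply cder_R, D1|apply cder_Ccos, cder_line_mult].
      + apply cder_scal. apply cder_mult; [apply cder_R, D2|apply cder_Csin, cder_line_mult].
    - cbv beta. set (co := Ccos _). set (si := Csin _).
      replace (RtoC (n * (n * cos t ^ (k + 2) - INR (k + 1) * cos t ^ k)))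
        with (RtoC (n ^ 2) * RtoC (cos t ^ (k + 2)) - RtoC (n * INR (k + 1)) * RtoC (cos t ^ k))%C
        by (rewrite <- !RtoC_mult, <- RtoC_minus; f_equal; ring).
      replace (RtoC (- n * cos t ^ (k + 1) * sin t)) with (- RtoC (n * (cos t ^ (k + 1) * sin t)))%C
        by (rewrite <- RtoC_opp; f_equal; ring).
      ring. }
  assert (Hw : forall t, clim (locally t) w (w t)).
  { intros t. apply clim_minus; (apply clim_mult; [apply clim_const|apply clim_cos_power]). }
  assert (HI := CRInt_derive W w 0 (PI / 2) HW Hw).
  (* At 0 both sines vanish, at pi/2 both powers of the cosine. *)
  assert (HE : (W (PI / 2)%R - W 0%R)%C = 0%C).
  { unfold W. rewrite cos_PI2, sin_0, Cmult_0_l, Csin_0, Nat.add_comm, (Nat.add_comm k 2).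
    simpl (0 ^ (1 + k)). simpl (0 ^ (2 + k)). rewrite !Rmult_0_l, !Rmult_0_r. ring. }
  rewrite HE in HI. unfold w in HI.
  set (h1 := fun t : R => ((RtoC (n ^ 2) - 4 * z * z) * cos_power z (k + 2) t)%C) in HI.
  set (h2 := fun t : R => (RtoC (n * INR (k + 1)) * cos_power z k t)%C) in HI.
  assert (C1 : forall t, clim (locally t) h1 (h1 t)).
  { intros t. apply clim_mult; [apply clim_const|apply clim_cos_power]. }
  assert (C2 : forall t, clim (locally t) h2 (h2 t)).
  { intros t. apply clim_mult; [apply clim_const|apply clim_cos_power]. }
  destruct (ex_RInt_clim h1 0 (PI / 2) C1) as [X1 X2].
  destruct (ex_RInt_clim h2 0 (PI / 2) C2) as [Y1 Y2].
  change (CRInt (fun t => h1 t - h2 t)%C 0 (PI / 2) = 0%C) in HI.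
  rewrite (CRInt_minus h1 h2 0 (PI / 2) X1 X2 Y1 Y2) in HI. unfold h1, h2 in HI.
  destruct (ex_RInt_clim _ 0 (PI / 2) (clim_cos_power z (k + 2))) as [A1 A2].
  destruct (ex_RInt_clim _ 0 (PI / 2) (clim_cos_power z k)) as [B1 B2].
  rewrite (CRInt_scal _ (cos_power z (k + 2)) _ _ A1 A2), (CRInt_scal _ (cos_power z k) _ _ B1 B2) in HI.
  unfold wallis. rewrite ES. fold k.
  set (X := ((RtoC (n ^ 2) - 4 * z * z) * CRInt (cos_power z (k + 2)) 0 (PI / 2))%C) in *.
  set (Y := (RtoC (n * INR (k + 1)) * CRInt (cos_power z k) 0 (PI / 2))%C) in *.
  replace X with ((X - Y) + Y)%C by ring. rewrite HI. ring.
Qed.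

Lemma wallis_0 (m : nat) : wallis 0 m = RtoC (wallis_R m).
Proof.
  assert (E : forall t, cos_power 0 (2 * m) t = RtoC (cos t ^ (2 * m))).
  { intros t. unfold cos_power. rewrite !Cmult_0_r, Ccos_0. ring. }
  unfold wallis, wallis_R, CRInt. apply C_eq.
  - apply RInt_ext. intros t _. rewrite E. reflexivity.
  - change (RInt (fun v => snd (cos_power 0 (2 * m) v)) 0 (PI / 2) = 0).
    rewrite (RInt_ext _ (fun _ => 0)) by (intros t _; rewrite E; reflexivity).
    rewrite (RInt_const (V := R_CompleteNormedModule)). unfold scal; simpl; unfold mult; simpl. ring.
Qed.

Lemma wallis_R_succ (m : nat) : wallis_R (S m) = wallis_R m * (1 - / (2 * (INR m + 1))).
Proof.
  assert (H := wallis_succ 0 m). rewrite !wallis_0 in H. apply (f_equal fst) in H.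
  rewrite !plus_INR, !mult_INR in H. simpl in H.
  generalize (pos_INR m); intros Hm.
  apply (Rmult_eq_reg_l ((2 * INR m + 2) ^ 2)); [|nra].
  replace ((2 * INR m + 2) ^ 2 * (wallis_R m * (1 - / (2 * (INR m + 1)))))
    with ((2 * INR m + 2) * (2 * INR m + 1) * wallis_R m) by (field; lra).
  lra.
Qed.

Lemma wallis_R_0 : wallis_R 0 = PI / 2.
Proof.
  unfold wallis_R. simpl. rewrite (RInt_const (V := R_CompleteNormedModule)).
  unfold scal; simpl; unfold mult; simpl. ring.
Qed.

Lemma wallis_R_pos (m : nat) : 0 < wallis_R m.
Proof.
  induction m as [|m IH].
  - rewrite wallis_R_0. generalize PI_RGT_0; lra.
  - rewrite wallis_R_succ. apply Rmult_lt_0_compat; [exact IH|].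
    generalize (pos_INR m); intros Hm.
    assert (/ (2 * (INR m + 1)) <= / 2) by (apply Rinv_le_contravar; lra). lra.
Qed.

Lemma sin_ge_quarter (t : R) : 0 <= t <= PI / 2 -> t / 4 <= sin t.
Proof.
  intros Ht. generalize PI_RGT_0 PI_4 (PI_gt_3); intros HP H4 H3.
  destruct (Rle_dec t (PI / 4)) as [H|H].
  - generalize (sin_ge_half t ltac:(lra)). lra.
  - assert (1 / 2 <= sin t); [|lra]. rewrite <- sin_PI6. apply sin_incr_1; lra.
Qed.

Lemma is_RInt_cos_pow (m : nat) : is_RInt (fun t => cos t ^ (2 * m)) 0 (PI / 2) (wallis_R m).
Proof.
  apply (RInt_correct (V := R_CompleteNormedModule)).
  apply (ex_RInt_continuous (V := R_CompleteNormedModule)). intros t _.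
  apply (ex_derive_continuous (fun t => cos t ^ (2 * m))). auto_derive; trivial.
Qed.

(** On the interval |cos(2 z t) - 1| <= K sin^2 t, and cos^(2m) sin^2 integrates to
    [wallis_R m - wallis_R (S m)], a fraction 1 / (2 (m + 1)) of [wallis_R m]. In K, 64 = 4 * 4^2
    comes from t <= 4 sin t, and 4 |z| bounds 2 t |z|. *)
Lemma wallis_quotient_bound (z : C) (m : nat) :
  Cmod (wallis z m / RtoC (wallis_R m) - 1) <= 64 * Cmod z ^ 2 * exp (4 * Cmod z) * / INR (S m).
Proof.
  generalize PI_RGT_0 PI_4 (wallis_R_pos m) (pos_INR m); intros HP H4 Hw Hm.
  set (K := 64 * Cmod z ^ 2 * exp (4 * Cmod z)).
  assert (Hw0 : RtoC (wallis_R m) <> 0%C) by (apply RtoC_neq_0; lra).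
  replace (wallis z m / RtoC (wallis_R m) - 1)%C with ((wallis z m - wallis 0 m) / RtoC (wallis_R m))%C
    by (rewrite wallis_0; field; exact Hw0).
  rewrite Cmod_div, Cmod_nonneg_R by (assumption || lra).
  assert (HI : is_RInt (fun t => K * (cos t ^ (2 * m) - cos t ^ (2 * S m))) 0 (PI / 2)
                 (K * (wallis_R m - wallis_R (S m)))).
  { exact (is_RInt_scal (V := R_NormedModule) _ _ _ K _
      (is_RInt_minus (V := R_NormedModule) _ _ _ _ _ _ (is_RInt_cos_pow m) (is_RInt_cos_pow (S m)))). }
  assert (Hcl : forall t, clim (locally t) (fun t => cos_power z (2 * m) t - cos_power 0 (2 * m) t)%C
                    (cos_power z (2 * m) t - cos_power 0 (2 * m) t)%C).
  { intros t; apply clim_minus; apply clim_cos_power. }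
  destruct (ex_RInt_clim _ 0 (PI / 2) Hcl) as [E1 E2].
  assert (HB := CRInt_bound (fun t => cos_power z (2 * m) t - cos_power 0 (2 * m) t)%C _ 0 (PI / 2) _
     ltac:(lra) E1 E2 HI).
  destruct (ex_RInt_clim _ 0 (PI / 2) (clim_cos_power z (2 * m))) as [X1 X2].
  destruct (ex_RInt_clim _ 0 (PI / 2) (clim_cos_power 0 (2 * m))) as [Y1 Y2].
  rewrite (CRInt_minus (cos_power z (2 * m)) (cos_power 0 (2 * m)) 0 (PI / 2) X1 X2 Y1 Y2) in HB.
  fold (wallis z m) in HB. fold (wallis 0 m) in HB.
  assert (HJ : Cmod (wallis z m - wallis 0 m) <= 2 * (K * (wallis_R m - wallis_R (S m)))).
  { apply HB. intros t Ht. unfold cos_power. rewrite !Cmult_0_r, Ccos_0.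
    replace (RtoC (cos t ^ (2 * m)) * Ccos (RtoC t * (2 * z)) - RtoC (cos t ^ (2 * m)) * 1)%C
      with (RtoC (cos t ^ (2 * m)) * (Ccos (RtoC t * (2 * z)) - 1))%C by ring.
    assert (Hc0 : 0 <= cos t) by (apply cos_ge_0; lra).
    assert (Hcp : 0 <= cos t ^ (2 * m)) by (apply pow_le, Hc0).
    rewrite Cmod_mult, Cmod_nonneg_R by exact Hcp.
    replace (K * (cos t ^ (2 * m) - cos t ^ (2 * S m))) with (cos t ^ (2 * m) * (K * sin t ^ 2)).
    2: { replace (2 * S m)%nat with (2 * m + 2)%nat by lia. rewrite pow_add.
         generalize (sin2_cos2 t). unfold Rsqr. intros Hsc.
         replace (sin t ^ 2) with (1 - cos t ^ 2) by (simpl; lra). ring. }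
    apply Rmult_le_compat_l; [exact Hcp|].
    apply Rle_trans with (1 := Cmod_Ccos_minus_1 _).
    assert (H2 : Cmod 2 = 2) by (apply Cmod_nonneg_R; lra).
    rewrite !Cmod_mult, H2, Cmod_nonneg_R by lra.
    assert (Hs := sin_ge_quarter t ltac:(lra)).
    generalize (Cmod_ge_0 z); intros Hz.
    unfold K. replace ((t * (2 * Cmod z)) ^ 2) with (4 * Cmod z ^ 2 * t ^ 2) by ring.
    replace (64 * Cmod z ^ 2 * exp (4 * Cmod z) * sin t ^ 2)
      with ((4 * Cmod z ^ 2 * (16 * sin t ^ 2)) * exp (4 * Cmod z)) by ring.
    apply Rmult_le_compat.
    - generalize (pow2_ge_0 (Cmod z)) (pow2_ge_0 t). intros. repeat apply Rmult_le_pos; lra.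
    - apply Rlt_le, exp_pos.
    - apply Rmult_le_compat_l; [generalize (pow2_ge_0 (Cmod z)); lra|].
      replace (16 * sin t ^ 2) with ((4 * sin t) ^ 2) by ring. apply pow_incr; lra.
    - apply exp_le. nra. }
  rewrite wallis_R_succ in HJ. rewrite S_INR.
  apply (Rmult_le_reg_r (wallis_R m)); [exact Hw|].
  replace (Cmod (wallis z m - wallis 0 m) / wallis_R m * wallis_R m) with (Cmod (wallis z m - wallis 0 m)) by (field; lra).
  apply Rle_trans with (1 := HJ). right. field. lra.
Qed.

Fixpoint sine_product (z : C) (m : nat) : C :=
  match m with
  | O => 1
  | S k => (sine_product z k * (1 - z * z / RtoC (INR (S k) ^ 2)))%C
  end.

Lemma INR_S_neq_0 (n : nat) : RtoC (INR (S n)) <> 0%C.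
Proof. apply RtoC_neq_0, not_0_INR; lia. Qed.

(** Each use of the recurrence contributes the factor 1 - z^2 / (m + 1)^2 on one side and the ratio
    of consecutive real Wallis integrals on the other. *)
Lemma sine_product_wallis (z : C) (m : nat) :
  (sine_product z m * wallis z m * RtoC (wallis_R 0) = wallis z 0 * RtoC (wallis_R m))%C.
Proof.
  induction m as [|m IH].
  - simpl sine_product. ring.
  - change (sine_product z (S m)) with (sine_product z m * (1 - z * z / RtoC (INR (S m) ^ 2)))%C.
    assert (Hs := wallis_succ z m). rewrite wallis_R_succ.
    assert (H0 := INR_S_neq_0 m).
    assert (E : ((1 - z * z / RtoC (INR (S m) ^ 2)) * wallis z (S m) = RtoC (1 - / (2 * (INR m + 1))) * wallis z m)%C).
    { generalize (pos_INR m); intros Hm.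
      replace (INR (2 * m + 2)) with (2 * INR (S m)) in Hs by (rewrite S_INR, plus_INR, mult_INR; simpl; ring).
      replace (INR (2 * m + 1)) with (2 * INR (S m) - 1) in Hs by (rewrite S_INR, plus_INR, mult_INR; simpl; ring).
      replace (INR m + 1) with (INR (S m)) by apply S_INR.
      set (x := INR (S m)) in *. assert (Hx : 0 < x) by (unfold x; rewrite S_INR; lra).
      replace (RtoC ((2 * x) ^ 2)) with (4 * (RtoC x * RtoC x))%C in Hs by (apply C_eq; simpl; ring).
      replace (RtoC (x ^ 2)) with (RtoC x * RtoC x)%C by (rewrite <- RtoC_mult; f_equal; ring).
      replace (RtoC (1 - / (2 * x))) with (RtoC (2 * x * (2 * x - 1)) / (4 * (RtoC x * RtoC x)))%C.
      2: { replace (4 * (RtoC x * RtoC x))%C with (RtoC (4 * (x * x))) by (rewrite !RtoC_mult; ring).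
           rewrite <- RtoC_div by nra. f_equal. field. lra. }
      transitivity ((4 * (RtoC x * RtoC x) - 4 * z * z) * wallis z (S m) / (4 * (RtoC x * RtoC x)))%C.
      { field. exact H0. }
      rewrite Hs. field. exact H0. }
    transitivity (sine_product z m * ((1 - z * z / RtoC (INR (S m) ^ 2)) * wallis z (S m)) * RtoC (wallis_R 0))%C; [ring|].
    rewrite E, RtoC_mult.
    transitivity (RtoC (1 - / (2 * (INR m + 1))) * (sine_product z m * wallis z m * RtoC (wallis_R 0)))%C; [ring|].
    rewrite IH. ring.
Qed.

Lemma wallis_0_value (z : C) : z <> 0%C -> wallis z 0 = (Csin (RtoC PI * z) / (2 * z))%C.
Proof.
  intros Hz. unfold wallis.
  rewrite (CRInt_derive (fun t => Csin (RtoC t * (2 * z)) * / (2 * z))%C).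
  - rewrite Cmult_0_l, Csin_0. replace (RtoC (PI / 2) * (2 * z))%C with (RtoC PI * z)%C.
    + field. exact Hz.
    + rewrite RtoC_div by lra. field.
  - intros t. eapply cder_eq.
    + apply cder_mult; [apply cder_Csin, cder_line_mult|apply cder_const].
    + cbv beta. unfold cos_power. simpl (cos t ^ (2 * 0)). field. exact Hz.
  - intros t. apply clim_cos_power.
Qed.

Lemma sine_product_lim (z : C) :
  z <> 0%C -> clim eventually (sine_product z) (Csin (RtoC PI * z) / (RtoC PI * z))%C.
Proof.
  intros Hz. generalize PI_RGT_0; intros HP.
  assert (HPc : RtoC PI <> 0%C) by (apply RtoC_neq_0; lra).
  assert (Hq : clim eventually (fun m => wallis z m / RtoC (wallis_R m))%C 1).
  { apply clim_bound with (fun m => 64 * Cmod z ^ 2 * exp (4 * Cmod z) * / INR (S m)).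
    - apply filter_forall. intros m. apply wallis_quotient_bound.
    - rewrite <- (Rmult_0_r (64 * Cmod z ^ 2 * exp (4 * Cmod z))).
      apply rlim_mult; [apply rlim_const|].
      apply (filterlim_comp _ _ _ S (fun n => / INR n) eventually eventually); [|apply inv_INR_lim].
      intros P [N HN]. exists N. intros n Hn. apply HN. lia. }
  replace (Csin (RtoC PI * z) / (RtoC PI * z))%C with (wallis z 0 / RtoC (wallis_R 0) / 1)%C.
  2: { rewrite wallis_0_value, wallis_R_0 by exact Hz. rewrite RtoC_div by lra. field. split; assumption. }
  apply clim_ext_loc with (fun m => (wallis z 0 / RtoC (wallis_R 0)) / (wallis z m / RtoC (wallis_R m)))%C.
  - assert (Hne := rlim_gt _ _ 0 (rlim_Cmod _ _ Hq) ltac:(rewrite Cmod_1; lra)).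
    apply filter_imp with (2 := Hne). intros m Hm.
    apply Cmod_gt_0 in Hm.
    assert (Hw : forall k, RtoC (wallis_R k) <> 0%C).
    { intros k. generalize (wallis_R_pos k). intros. apply RtoC_neq_0; lra. }
    assert (Hwm : wallis z m <> 0%C).
    { intros E. apply Hm. rewrite E. unfold Cdiv. ring. }
    assert (H0 := Hw 0%nat). assert (H1 := Hw m). assert (E := sine_product_wallis z m).
    replace (sine_product z m) with (sine_product z m * wallis z m * RtoC (wallis_R 0) / (wallis z m * RtoC (wallis_R 0)))%C
      by (field; split; assumption).
    rewrite E. field. repeat split; assumption.
  - apply clim_div; [apply clim_const|exact Hq|]. intros E. apply (f_equal fst) in E. simpl in E. lra.
Qed.

Lemma rising_prod_reflection (z : C) (n : nat) :
  (rising_prod z n * rising_prod (1 - z) n =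
   z * sine_product z n * RtoC (INR (Factorial.fact n)) * RtoC (INR (Factorial.fact n)) * (RtoC (INR (S n)) - z))%C.
Proof.
  induction n as [|n IH].
  - simpl. ring.
  - change (rising_prod z (S n)) with (rising_prod z n * (z + RtoC (INR (S n))))%C.
    change (rising_prod (1 - z) (S n)) with (rising_prod (1 - z) n * (1 - z + RtoC (INR (S n))))%C.
    change (sine_product z (S n)) with (sine_product z n * (1 - z * z / RtoC (INR (S n) ^ 2)))%C.
    replace (Factorial.fact (S n)) with (S n * Factorial.fact n)%nat by reflexivity.
    rewrite mult_INR, RtoC_mult.
    replace (RtoC (INR (S (S n)))) with (RtoC (INR (S n)) + 1)%C by (rewrite (S_INR (S n)), RtoC_plus; ring).
    replace (RtoC (INR (S n) ^ 2)) with (RtoC (INR (S n)) * RtoC (INR (S n)))%C by (rewrite <- RtoC_mult; f_equal; ring).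
    assert (H0 := INR_S_neq_0 n). set (x := RtoC (INR (S n))) in *.
    transitivity ((rising_prod z n * rising_prod (1 - z) n) * (z + x) * (1 - z + x))%C; [ring|].
    rewrite IH. field. exact H0.
Qed.

Lemma gauss_product_reflection_lim (z : C) :
  z <> 0%C ->
  clim eventually (fun n => gauss_product z n * gauss_product (1 - z) n)%C (Csin (RtoC PI * z) / RtoC PI)%C.
Proof.
  intros Hz. generalize PI_RGT_0; intros HP.
  assert (HPc : RtoC PI <> 0%C) by (apply RtoC_neq_0; lra).
  replace (Csin (RtoC PI * z) / RtoC PI)%C with (z * (Csin (RtoC PI * z) / (RtoC PI * z)) * (1 + 0 * (1 - z)))%C
    by (field; split; assumption).
  apply clim_ext_loc with (fun n => z * sine_product z n * (1 + RtoC (/ INR n) * (1 - z)))%C.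
  - exists 1%nat. intros n Hn. assert (Hn0 : 0 < INR n) by (apply lt_0_INR; lia).
    unfold gauss_product.
    assert (Hf : RtoC (INR (Factorial.fact n)) <> 0%C).
    { apply RtoC_neq_0, INR_fact_neq_0. }
    assert (Hn1 : RtoC (INR n) <> 0%C) by (apply RtoC_neq_0; lra).
    assert (HE : (Cpowc (RtoC (INR n)) z * Cpowc (RtoC (INR n)) (1 - z) = RtoC (INR n))%C).
    { unfold Cpowc. rewrite <- Cexp_plus.
      replace (z * Clog (RtoC (INR n)) + (1 - z) * Clog (RtoC (INR n)))%C with (Clog (RtoC (INR n))) by ring.
      apply Cexp_Clog. left. exact Hn0. }
    assert (P1 : Cpowc (RtoC (INR n)) z <> 0%C) by apply Cexp_neq_0.
    assert (P2 : Cpowc (RtoC (INR n)) (1 - z) <> 0%C) by apply Cexp_neq_0.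
    assert (HR := rising_prod_reflection z n).
    rewrite S_INR, RtoC_plus in HR. rewrite RtoC_inv by lra.
    set (f := RtoC (INR (Factorial.fact n))) in *. set (x := RtoC (INR n)) in *.
    set (p := Cpowc x z) in *. set (q := Cpowc x (1 - z)) in *.
    transitivity ((rising_prod z n * rising_prod (1 - z) n) / (f * f * (p * q)))%C.
    + rewrite HR, HE. field. split; assumption.
    + field. repeat split; assumption.
  - apply clim_mult.
    + apply clim_mult; [apply clim_const|apply sine_product_lim, Hz].
    + apply clim_plus; [apply clim_const|]. apply clim_mult; [|apply clim_const].
      apply clim_R, inv_INR_lim.
Qed.

Lemma stirling_const_neq_0 : stirling_const <> 0%C.
Proof. apply Cmult_neq_0; apply Cexp_neq_0. Qed.

Lemma recipGamma_neq_0 (z : C) : 0 < fst z -> recipGamma z <> 0%C.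
Proof.
  intros Hz. rewrite recipGamma_stirling by exact Hz. unfold Cdiv.
  apply Cmult_neq_0; [|apply Cexp_neq_0].
  apply Cmult_neq_0; [apply stirling_const_neq_0|].
  unfold stirling. rewrite <- Cexp_opp. apply Cexp_neq_0.
Qed.

(** Stirling's formula covers only the right half-plane. For other z the convergence of Gauss'
    product is deduced here: the product of the two sequences converges, and the sequence at 1 - z
    has a nonzero limit. *)
Lemma recipGamma_reflection (z : C) :
  z <> 0%C -> 0 < fst (1 - z)%C ->
  (recipGamma z * recipGamma (1 - z) = Csin (RtoC PI * z) / RtoC PI)%C.
Proof.
  intros Hz H1. assert (Hn := recipGamma_neq_0 (1 - z) H1).
  assert (HL : clim eventually (gauss_product (1 - z)) (recipGamma (1 - z))).
  { rewrite recipGamma_stirling by exact H1. apply gauss_product_lim, H1. }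
  assert (Hq : clim eventually (gauss_product z) (Csin (RtoC PI * z) / RtoC PI / recipGamma (1 - z))%C).
  { apply clim_ext_loc with (fun n => (gauss_product z n * gauss_product (1 - z) n) / gauss_product (1 - z) n)%C.
    - assert (Hne := rlim_gt _ _ 0 (rlim_Cmod _ _ HL) (proj1 (Cmod_gt_0 _) Hn)).
      apply filter_imp with (2 := Hne). intros n Hgn. apply Cmod_gt_0 in Hgn. field. exact Hgn.
    - apply clim_div; [apply gauss_product_reflection_lim, Hz|exact HL|exact Hn]. }
  rewrite (recipGamma_lim _ _ Hq). field. split; [|exact Hn].
  apply RtoC_neq_0. generalize PI_RGT_0; lra.
Qed.

(* The value 1/sqrt(2 pi) of [stirling_const] is read off, approximately, from the reflection
   formula at 1/2 + 20 i, where both sides are explicit. *)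
Lemma stirling_const_sqr :
  Cmod (2 * RtoC PI * (stirling_const * stirling_const) - 1) <= 3 / 100.
Proof.
  generalize PI_gt_3; intros HP.
  (* Here 1 - z is the conjugate of z, so both logarithms are explicit; the height 20 makes each
     Stirling correction at most 1 / (6 * 19). *)
  set (z := (1 / 2, 20) : C). set (z' := (1 - z)%C).
  assert (HPc : RtoC PI <> 0%C) by (apply RtoC_neq_0; lra).
  assert (Hz0 : z <> 0%C) by (intros E; apply (f_equal fst) in E; simpl in E; lra).
  assert (F1 : 0 < fst z) by (simpl; lra).
  assert (F2 : 0 < fst z') by (simpl; lra).
  assert (M1 : 20 <= Cmod z) by (apply Cmod_ge_intro; simpl; lra).
  assert (M2 : 20 <= Cmod z') by (apply Cmod_ge_intro; simpl; lra).
  assert (HR := recipGamma_reflection z Hz0 F2). fold z' in HR.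
  rewrite !recipGamma_stirling in HR by assumption.
  set (theta := atan (/ 40)).
  assert (HLog : (Clog z - Clog z' = RtoC (PI - 2 * theta) * Ci)%C).
  { assert (EA : Arg z = PI / 2 - theta).
    { rewrite Arg_upper by (simpl; lra). unfold theta. simpl. do 2 f_equal. field. }
    assert (EA' : Arg z' = - (PI / 2 - theta)).
    { rewrite Arg_lower by (simpl; lra). unfold theta. simpl.
      replace ((1 + - (1 / 2)) / (0 + - (20))) with (- / 40) by field.
      rewrite atan_opp. ring. }
    assert (EM : Cmod z' = Cmod z) by (unfold Cmod; f_equal; simpl; field).
    unfold Clog. rewrite EM, EA, EA'. apply C_eq; simpl; field. }
  assert (Hst : (stirling z * stirling z' = RtoC (exp (- (20 * PI) + 40 * theta - 1)))%C).
  { unfold stirling. rewrite <- Cexp_plus, <- Cexp_R. f_equal.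
    replace ((z - RtoC (1 / 2)) * Clog z - z + ((z' - RtoC (1 / 2)) * Clog z' - z'))%C
      with (((0, 20) : C) * (Clog z - Clog z') - 1)%C.
    - rewrite HLog. apply C_eq; simpl; field.
    - replace ((0, 20) : C) with (z - / 2)%C by (apply C_eq; simpl; field).
      replace (RtoC (1 / 2)) with (/ 2)%C by (rewrite RtoC_div by lra; field).
      set (L := Clog z). set (L' := Clog z'). unfold z'. field. }
  assert (Hsin : Csin (RtoC PI * z) = RtoC ((exp (20 * PI) + exp (- (20 * PI))) / 2)).
  { unfold Csin.
    replace (Cexp (Ci * (RtoC PI * z))) with (Ci * RtoC (exp (- (20 * PI))))%C.
    2: { unfold Cexp; simpl.
         replace (0 * (PI * (1 / 2) - 0 * 20) - 1 * (PI * 20 + 0 * (1 / 2))) with (- (20 * PI)) by field.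
         replace (0 * (PI * 20 + 0 * (1 / 2)) + 1 * (PI * (1 / 2) - 0 * 20)) with (PI / 2) by field.
         rewrite cos_PI2, sin_PI2. apply C_eq; simpl; ring. }
    replace (Cexp (- (Ci * (RtoC PI * z)))) with (- (Ci * RtoC (exp (20 * PI))))%C.
    2: { unfold Cexp; simpl.
         replace (- (0 * (PI * (1 / 2) - 0 * 20) - 1 * (PI * 20 + 0 * (1 / 2)))) with (20 * PI) by field.
         replace (- (0 * (PI * 20 + 0 * (1 / 2)) + 1 * (PI * (1 / 2) - 0 * 20))) with (- (PI / 2)) by field.
         rewrite cos_neg, sin_neg, cos_PI2, sin_PI2. apply C_eq; simpl; ring. }
    apply C_eq; simpl; field. }
  rewrite Hsin in HR.
  set (m := (stirling_log z + stirling_log z')%C).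
  assert (HK : (2 * RtoC PI * (stirling_const * stirling_const) =
      RtoC (1 + exp (- (40 * PI))) * Cexp (RtoC (40 * theta - 1) + m))%C).
  { assert (E : (stirling_const * stirling_const =
        RtoC ((exp (20 * PI) + exp (- (20 * PI))) / 2) / RtoC PI * (stirling z * stirling z') * Cexp m)%C).
    { rewrite <- HR. unfold m. rewrite Cexp_plus, !Cexp_opp.
      field. repeat split; apply Cexp_neq_0. }
    rewrite E, Hst, Cexp_plus, Cexp_R.
    transitivity (RtoC (exp (20 * PI) + exp (- (20 * PI))) * RtoC (exp (- (20 * PI) + 40 * theta - 1)) * Cexp m)%C.
    - replace (RtoC ((exp (20 * PI) + exp (- (20 * PI))) / 2)) with (RtoC (exp (20 * PI) + exp (- (20 * PI))) / 2)%C
        by (rewrite RtoC_div by lra; reflexivity).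
      field. exact HPc.
    - rewrite Cmult_assoc, <- !RtoC_mult. f_equal. f_equal.
      replace (- (20 * PI) + 40 * theta - 1) with (- (20 * PI) + (40 * theta - 1)) by ring.
      rewrite exp_plus.
      transitivity ((exp (20 * PI) * exp (- (20 * PI)) + exp (- (20 * PI)) * exp (- (20 * PI))) * exp (40 * theta - 1)); [ring|].
      rewrite <- !exp_plus. rewrite Rplus_opp_r, exp_0. do 3 f_equal. ring. }
  (* From x / (1 + x^2) <= atan x <= x at x = 1/40. *)
  assert (Htheta : - (1 / 1600) <= 40 * theta - 1 <= 0).
  { unfold theta.
    assert (Hat : forall x, 0 < x -> x / (1 + x ^ 2) <= atan x <= x).
    { intros x Hx. destruct (MVT_gen atan 0 x (fun u => / (1 + u ^ 2))) as [c [Hc Ec]].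
      - intros u _. eapply is_derive_eq; [apply is_derive_atan|]. unfold Rsqr. f_equal. ring.
      - intros u _. apply continuity_pt_filterlim, continuous_atan.
      - rewrite atan_0 in Ec. rewrite Rmin_left, Rmax_right in Hc by lra.
        assert (0 < / (1 + c ^ 2)) by (apply Rinv_0_lt_compat; nra).
        assert (/ (1 + x ^ 2) <= / (1 + c ^ 2)) by (apply Rinv_le_contravar; nra).
        assert (/ (1 + c ^ 2) <= 1) by (rewrite <- Rinv_1; apply Rinv_le_contravar; nra).
        unfold Rdiv. nra. }
    generalize (Hat (/ 40) ltac:(lra)). lra. }
  assert (Hm : Cmod m <= 18 / 1000).
  { unfold m. apply Rle_trans with (1 := Cmod_triangle _ _).
    generalize (stirling_log_bound z F1 ltac:(lra)) (stirling_log_bound z' F2 ltac:(lra)).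
    assert (/ (Cmod z - 1) <= / 19) by (apply Rinv_le_contravar; lra).
    assert (/ (Cmod z' - 1) <= / 19) by (apply Rinv_le_contravar; lra). lra. }
  set (d := (RtoC (40 * theta - 1) + m)%C) in *.
  assert (Hd : Cmod d <= 187 / 10000).
  { unfold d. apply Rle_trans with (1 := Cmod_triangle _ _). rewrite Cmod_R, Rabs_left1 by lra. lra. }
  assert (He : Cmod (Cexp d - 1) <= 195 / 10000).
  { apply Rle_trans with (1 := Cmod_Cexp_minus_1 d).
    assert (exp (Cmod d) <= 102 / 100).
    { apply Rle_trans with (exp (187 / 10000)); [apply exp_le, Hd|].
      apply Rle_trans with (1 := exp_le_inv_1_minus (187 / 10000) ltac:(lra)). lra. }
    generalize (Cmod_ge_0 d) (exp_pos (Cmod d)). nra. }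
  rewrite HK. set (tau := exp (- (40 * PI))).
  assert (Ht : 0 < tau <= 1 / 120).
  { split; [apply exp_pos|]. apply Rle_trans with (1 := exp_opp_le_inv (40 * PI) ltac:(lra)).
    replace (1 / 120) with (/ 120) by field. apply Rinv_le_contravar; lra. }
  replace (RtoC (1 + tau) * Cexp d - 1)%C with (RtoC (1 + tau) * (Cexp d - 1) + RtoC tau)%C
    by (rewrite RtoC_plus; ring).
  apply Rle_trans with (1 := Cmod_triangle _ _).
  rewrite Cmod_mult, !Cmod_nonneg_R by lra. generalize (Cmod_ge_0 (Cexp d - 1)). nra.
Qed.

(** * Asymptotics of chi *)

Lemma log_half_shift_bound (z : C) :
  0 < fst z -> Cmod (z * (Clog (z + RtoC (1 / 2)) - Clog z) - RtoC (1 / 2)) <= / (8 * Cmod z).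
Proof.
  intros Hz. assert (Hm0 : 0 < Cmod z) by (generalize (Cmod_ge_fst z); lra).
  assert (Hz0 : z <> 0%C) by (apply Cmod_gt_0, Hm0).
  set (A := fun u : R => (z * Clog (z + RtoC u * RtoC (1 / 2)) - RtoC u * RtoC (1 / 2))%C).
  set (A' := fun u : R => (- RtoC (u / 4) / (z + RtoC u * RtoC (1 / 2)))%C).
  assert (Hs : forall u, 0 <= u <= 1 -> slit (z + RtoC u * RtoC (1 / 2))) by (intros u Hu; left; simpl; lra).
  assert (HA : forall u, 0 <= u <= 1 -> cder A u (A' u)).
  { intros u Hu. assert (N := slit_neq_0 _ (Hs u Hu)). unfold A. eapply cder_eq.
    - apply cder_minus.
      + apply cder_scal. apply cder_log; [apply cder_line|apply Hs, Hu].
      + apply cder_mult; [apply cder_id|apply cder_const].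
    - cbv beta. unfold A'. replace (RtoC (u / 4)) with (RtoC u * RtoC (1 / 2) * RtoC (1 / 2))%C
        by (rewrite <- !RtoC_mult; f_equal; field).
      field. exact N. }
  assert (HB : forall u, 0 <= u <= 1 -> Cmod (A' u) <= / (4 * Cmod z) * u ^ 1).
  { intros u Hu. unfold A'. rewrite Cmod_div by apply slit_neq_0, Hs, Hu.
    rewrite Cmod_opp, Cmod_nonneg_R by lra. rewrite <- RtoC_mult.
    assert (Hg := Cmod_add_pos z (u * (1 / 2)) ltac:(lra) ltac:(lra)).
    replace (/ (4 * Cmod z) * u ^ 1) with (u / 4 * / Cmod z) by (field; lra).
    unfold Rdiv. apply Rmult_le_compat_l; [lra|]. apply Rinv_le_contravar; lra. }
  assert (H := cder_unit_bound A A' _ 1 HA HB).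
  unfold A in H. rewrite !Cmult_1_l, !Cmult_0_l, Cplus_0_r in H.
  replace (z * (Clog (z + RtoC (1 / 2)) - Clog z) - RtoC (1 / 2))%C
    with (z * Clog (z + RtoC (1 / 2)) - RtoC (1 / 2) - (z * Clog z - 0))%C by ring.
  apply Rle_trans with (1 := H). right. simpl INR. field. lra.
Qed.

Lemma Cmod_Cexp_minus_1_small (d : C) (e : R) : Cmod d <= e -> e <= 1 / 2 -> Cmod (Cexp d - 1) <= 2 * e.
Proof.
  intros Hd He. apply Rle_trans with (1 := Cmod_Cexp_minus_1 d).
  assert (exp (Cmod d) <= 2).
  { apply Rle_trans with (exp (1 / 2)); [apply exp_le; lra|].
    apply Rle_trans with (1 := exp_le_inv_1_minus (1 / 2) ltac:(lra)). lra. }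
  generalize (Cmod_ge_0 d) (exp_pos (Cmod d)). nra.
Qed.

(** Reflection turns 1 / Gamma(s/2) into sin(pi s / 2) Gamma(z + 1/2) / pi with z = (1 - s)/2, so
    both Gamma factors are taken in the right half-plane, and the Stirling constant enters only
    through its square. *)
Lemma chi_asymptotic (s : C) :
  fst s <= - 1 -> 1000 <= Cmod (1 - s) ->
  exists E : C, Cmod (E - 1) <= 4 / 100 /\
    chi s = (2 * Csin (RtoC PI * (s / 2)) *
       Cexp ((s - RtoC (1 / 2)) * RtoC (ln PI) + ((1 - s) - RtoC (1 / 2)) * Clog ((1 - s) / 2) - (1 - s)) * E)%C.
Proof.
  intros Hs Hp. generalize PI_gt_3; intros HP.
  assert (HPc : RtoC PI <> 0%C) by (apply RtoC_neq_0; lra).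
  set (z := ((1 - s) / 2)%C).
  assert (Ez : z = ((1 - fst s) / 2, - snd s / 2)) by (unfold z; apply C_eq; simpl; field).
  assert (Hz : 1 <= fst z) by (rewrite Ez; simpl; lra).
  assert (Hzm : Cmod z = Cmod (1 - s) / 2).
  { unfold z. assert (N : RtoC 2 <> 0%C) by (intros E; apply (f_equal fst) in E; simpl in E; lra).
    rewrite Cmod_div by exact N. rewrite (Cmod_nonneg_R 2) by lra. reflexivity. }
  set (z1 := (z + RtoC (1 / 2))%C).
  assert (Hz1 : 1 <= fst z1) by (unfold z1; simpl; lra).
  assert (Hz1m : Cmod z <= Cmod z1) by (apply Cmod_add_pos; lra).
  assert (Ez1 : z1 = (1 - s / 2)%C).
  { unfold z1, z. rewrite RtoC_div by lra. field. }
  assert (Hs0 : (s / 2)%C <> 0%C).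
  { intros E. apply (f_equal fst) in E. simpl in E. lra. }
  assert (HR := recipGamma_reflection (s / 2) Hs0). rewrite <- Ez1 in HR.
  specialize (HR ltac:(lra)).
  assert (N1 := recipGamma_neq_0 z1 ltac:(lra)). assert (N := recipGamma_neq_0 z ltac:(lra)).
  set (nu := (z * (Clog z1 - Clog z) - RtoC (1 / 2))%C).
  set (K2 := (2 * RtoC PI * (stirling_const * stirling_const))%C).
  assert (HK2 : Cmod (K2 - 1) <= 3 / 100) by exact stirling_const_sqr.
  assert (HKm : 97 / 100 <= Cmod K2).
  { generalize (Cmod_triangle_rev 1 (1 - K2)). replace (1 - (1 - K2))%C with K2 by ring.
    rewrite Cmod_1, Cmod_minus_sym. lra. }
  assert (HK0 : K2 <> 0%C) by (apply Cmod_gt_0; lra).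
  assert (HC0 := stirling_const_neq_0).
  set (d := (stirling_log z + stirling_log z1 + nu)%C).
  assert (Hd : Cmod d <= 1 / 1000).
  { unfold d. apply Rle_trans with (1 := Cmod_triangle _ _).
    generalize (Cmod_triangle (stirling_log z) (stirling_log z1))
      (stirling_log_bound z ltac:(lra) ltac:(lra)) (stirling_log_bound z1 ltac:(lra) ltac:(lra))
      (log_half_shift_bound z ltac:(lra)).
    fold z1. fold nu.
    assert (/ (Cmod z - 1) <= / 499) by (apply Rinv_le_contravar; lra).
    assert (/ (Cmod z1 - 1) <= / 499) by (apply Rinv_le_contravar; lra).
    assert (/ (8 * Cmod z) <= / 4000) by (apply Rinv_le_contravar; lra). lra. }
  exists (Cexp d / K2)%C. split.
  - replace (Cexp d / K2 - 1)%C with (((Cexp d - 1) - (K2 - 1)) / K2)%C by (field; exact HK0).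
    rewrite Cmod_div by exact HK0.
    apply (Rmult_le_reg_r (Cmod K2)); [lra|].
    replace (Cmod (Cexp d - 1 - (K2 - 1)) / Cmod K2 * Cmod K2) with (Cmod (Cexp d - 1 - (K2 - 1))) by (field; lra).
    apply Rle_trans with (1 := Cmod_triangle _ _). rewrite Cmod_opp.
    generalize (Cmod_Cexp_minus_1_small d _ Hd ltac:(lra)). lra.
  - assert (Erec : recipGamma (s / 2) = (Csin (RtoC PI * (s / 2)) / RtoC PI / recipGamma z1)%C).
    { rewrite <- HR. field. exact N1. }
    unfold chi, CGamma. rewrite Erec. fold z.
    rewrite !recipGamma_stirling by lra. unfold Cpowc. rewrite Clog_pos by lra.
    set (S := Csin (RtoC PI * (s / 2))).
    (* The duplication formula at the level of Stirling's main terms: the logarithm at z + 1/2 is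
       replaced by that at z, at the cost [nu], which is O(1/|z|). *)
    assert (Est : (stirling z * stirling z1 = Cexp (((1 - s) - RtoC (1 / 2)) * Clog z - (1 - s)) * Cexp nu)%C).
    { unfold stirling. rewrite <- !Cexp_plus. f_equal. unfold nu, z1. set (L1 := Clog (z + RtoC (1 / 2))).
      replace (1 - s)%C with (2 * z)%C by (unfold z; field).
      set (L := Clog z). rewrite RtoC_div by lra. field. }
    assert (Ed : (Cexp (stirling_log z) * Cexp (stirling_log z1) * Cexp nu = Cexp d)%C)
      by (unfold d; rewrite !Cexp_plus; reflexivity).
    replace ((s - RtoC (1 / 2)) * RtoC (ln PI) + ((1 - s) - RtoC (1 / 2)) * Clog z - (1 - s))%C
      with ((s - RtoC (1 / 2)) * RtoC (ln PI) + (((1 - s) - RtoC (1 / 2)) * Clog z - (1 - s)))%C by ring.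
    rewrite (Cexp_plus ((s - RtoC (1 / 2)) * RtoC (ln PI))), !Cexp_opp.
    set (X := Cexp ((s - RtoC (1 / 2)) * RtoC (ln PI))).
    set (Y := Cexp (((1 - s) - RtoC (1 / 2)) * Clog z - (1 - s))) in *.
    assert (G1 := stirling_neq_0 z). assert (G2 := stirling_neq_0 z1).
    assert (E1 := Cexp_neq_0 (stirling_log z)). assert (E2 := Cexp_neq_0 (stirling_log z1)).
    transitivity (X * S / RtoC PI * (stirling z * stirling z1) * (Cexp (stirling_log z) * Cexp (stirling_log z1))
        / (stirling_const * stirling_const))%C.
    { field. repeat split; assumption. }
    rewrite Est.
    transitivity (X * S / RtoC PI * Y * (Cexp (stirling_log z) * Cexp (stirling_log z1) * Cexp nu)
        / (stirling_const * stirling_const))%C; [field; split; assumption|].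
    rewrite Ed. unfold K2. field. split; assumption.
Qed.

(** * Dependence on the parameter, and the zeros *)

Lemma is_derive_C_intro (f : C -> C) (x d : C) (K : R) :
  (forall y, Cmod (y - x) <= 1 -> Cmod (f y - f x - (y - x) * d) <= K * Cmod (y - x) ^ 2) ->
  is_derive f x d.
Proof.
  intros H. split.
  - apply is_linear_scal_l.
  - intros x' Hx' eps.
    assert (Ex := is_filter_lim_locally_unique (K := C_AbsRing) (V := AbsRing_NormedModule C_AbsRing) x x' Hx'). rewrite <- Ex. clear Ex Hx'.
    assert (Hd : 0 < Rmin 1 (eps / (Rabs K + 1))).
    { apply Rmin_case; [lra|]. apply Rdiv_lt_0_compat; [apply cond_pos|]. generalize (Rabs_pos K); lra. }
    exists (mkposreal _ Hd). intros y Hy.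
    change (Cmod (y - x) < Rmin 1 (eps / (Rabs K + 1))) in Hy.
    change (Cmod (f y - f x - (y - x) * d) <= eps * Cmod (y - x)).
    assert (Y1 : Cmod (y - x) < 1) by (apply Rlt_le_trans with (1 := Hy), Rmin_l).
    assert (Y2 : Cmod (y - x) < eps / (Rabs K + 1)) by (apply Rlt_le_trans with (1 := Hy), Rmin_r).
    apply Rle_trans with (1 := H y (Rlt_le _ _ Y1)).
    generalize (Cmod_ge_0 (y - x)) (Rle_abs K) (Rabs_pos K). intros Y0 K0 K1.
    assert (Y3 : Cmod (y - x) * (Rabs K + 1) < eps).
    { apply (Rmult_lt_reg_r (/ (Rabs K + 1))); [apply Rinv_0_lt_compat; lra|].
      rewrite Rmult_assoc, Rinv_r, Rmult_1_r by lra. exact Y2. }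
    nra.
Qed.
Lemma Cmod_Clog_bound (x : C) : Cmod (Clog x) <= Rabs (ln (Cmod x)) + PI.
Proof.
  apply Rle_trans with (1 := Cmod_le_sum _). simpl.
  apply Rplus_le_compat_l, Rabs_le, Arg_bound.
Qed.

Lemma R_integrand_shift (s h x : C) :
  R_integrand (s + h) x = (R_integrand s x * Cexp (- h * Clog x))%C.
Proof.
  rewrite !R_integrand_unfold. unfold Cdiv.
  replace (- (s + h) * Clog x + PI * Ci * x * x)%C
    with ((- s * Clog x + PI * Ci * x * x) + - h * Clog x)%C by ring.
  rewrite (Cexp_plus (- s * Clog x + PI * Ci * x * x)). ring.
Qed.

(** Near 0, the factor e^(2 |ln rho|) bounding the change of the power costs rho^(-2), and the
    denominator rho^(-1); [fst s <= -3] compensates for both. *)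
Lemma R_integrand_parameter_bound (s : C) :
  fst s <= - 3 ->
  exists M, 0 < M /\ forall h rho, Cmod h <= 1 -> 0 < rho ->
    Cmod (R_integrand (s + h) (RtoC rho * edir) - R_integrand s (RtoC rho * edir))
    <= Cmod h * (M * exp (- rho)).
Proof.
  intros Hs. generalize PI_gt_3 PI_lt_324 inv_sqrt2_bounds inv_sqrt2_sqr; intros HP1 HP2 Hq Hqq.
  exists (exp (Rabs (snd s) * PI + 2 * PI + (- fst s + 2) ^ 2 + 1)). split; [apply exp_pos|].
  intros h rho Hh Hrho. set (x := (RtoC rho * edir)%C).
  assert (X1 : fst x = rho * (1 / sqrt 2)) by (unfold x; rewrite edir_eq; simpl; ring).
  assert (X2 : snd x = rho * (1 / sqrt 2)) by (unfold x; rewrite edir_eq; simpl; ring).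
  assert (Xm : Cmod x = rho) by (unfold x; rewrite Cmod_mult, Cmod_edir, Cmod_nonneg_R by lra; ring).
  rewrite R_integrand_shift.
  replace (R_integrand s x * Cexp (- h * Clog x) - R_integrand s x)%C
    with (R_integrand s x * (Cexp (- h * Clog x) - 1))%C by ring.
  rewrite Cmod_mult.
  assert (Hup : 0 < snd x) by (rewrite X2; nra).
  assert (Hd0 := slit_domain_sin_denom x (slit_domain_upper x Hup)).
  rewrite Cmod_R_integrand by exact Hd0. rewrite Xm.
  assert (Hd : rho <= Cmod (sin_denom x)).
  { apply Rle_trans with (2 := sin_denom_ge_sinh x (Rlt_le _ _ Hup)).
    apply Rle_trans with (2 := exp_minus_exp_opp_ge (PI * snd x) ltac:(nra)). rewrite X2. nra. }
  set (L := ln rho). set (l := Cmod (Clog x)).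
  assert (Hl : l <= Rabs L + PI) by (unfold l, L; rewrite <- Xm; apply Cmod_Clog_bound).
  assert (Hl0 : 0 <= l) by apply Cmod_ge_0.
  assert (HE : Cmod (Cexp (- h * Clog x) - 1) <= Cmod h * exp (2 * (Rabs L + PI))).
  { apply Rle_trans with (1 := Cmod_Cexp_minus_1 _). rewrite Cmod_mult, Cmod_opp. fold l.
    rewrite Rmult_assoc. apply Rmult_le_compat_l; [apply Cmod_ge_0|].
    apply Rle_trans with (exp l * exp l).
    - apply Rmult_le_compat; [exact Hl0|apply Rlt_le, exp_pos| |].
      + generalize (exp_ineq1_le l); lra.
      + apply exp_le. generalize (Cmod_ge_0 h); nra.
    - rewrite <- exp_plus. apply exp_le. lra. }
  assert (Hinv : / Cmod (sin_denom x) <= exp (- L)).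
  { rewrite exp_Ropp. unfold L. rewrite exp_ln by exact Hrho. apply Rinv_le_contravar; assumption. }
  set (a := exp (- fst s * L + snd s * Arg x - 2 * PI * fst x * snd x)).
  assert (Ha : 0 < a) by apply exp_pos.
  apply Rle_trans with (a * exp (- L) * (Cmod h * exp (2 * (Rabs L + PI)))).
  { apply Rmult_le_compat; [apply Rdiv_le_0_compat; [lra|apply Cmod_gt_0, Hd0]|apply Cmod_ge_0| |exact HE].
    unfold Rdiv. apply Rmult_le_compat_l; lra. }
  replace (a * exp (- L) * (Cmod h * exp (2 * (Rabs L + PI)))) with (Cmod h * (a * exp (- L) * exp (2 * (Rabs L + PI)))) by ring.
  apply Rmult_le_compat_l; [apply Cmod_ge_0|].
  unfold a. rewrite <- !exp_plus. apply exp_le.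
  generalize (Arg_term_bound (snd s) x); intros HA.
  replace (2 * PI * fst x * snd x) with (PI * rho ^ 2).
  2: { rewrite X1, X2. replace (2 * PI * (rho * (1 / sqrt 2)) * (rho * (1 / sqrt 2))) with (2 * PI * rho ^ 2 * (1 / sqrt 2 * (1 / sqrt 2))) by ring.
       rewrite Hqq. field. }
  set (N := - fst s) in *. assert (HN : 3 <= N) by (unfold N; lra).
  assert (HL : L <= rho) by (apply ln_le_self, Hrho).
  destruct (Rle_dec 0 L) as [HL0|HL0].
  - rewrite Rabs_pos_eq by exact HL0.
    assert ((N + 1) * L <= (N + 1) * rho) by (apply Rmult_le_compat_l; lra).
    assert ((N + 2) * rho <= (N + 2) ^ 2 + PI * rho ^ 2).
    { generalize (pow2_ge_0 (rho - (N + 2) / 2)) (pow2_ge_0 rho) (pow2_ge_0 (N + 2)). nra. }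
    lra.
  - rewrite Rabs_left by lra.
    assert (rho < 1).
    { apply Rnot_le_lt. intros H. apply HL0. unfold L. rewrite <- ln_1. apply ln_le; lra. }
    assert ((N - 3) * L <= 0) by nra.
    generalize (pow2_ge_0 rho) (pow2_ge_0 (N + 2)). nra.
Qed.

(** Proved on finite segments with a constant independent of r, then passed to the limit. It serves
    the simplicity of the zeros, where J is multiplied by a factor vanishing at s. *)
Lemma R_ray_lipschitz (s : C) :
  fst s <= - 3 ->
  exists K, 0 < K /\ forall h, Cmod h <= 1 -> Cmod (R_ray (s + h) - R_ray s) <= Cmod h * K.
Proof.
  intros Hs. destruct (R_integrand_parameter_bound s Hs) as [M [HM Hb]].
  exists (2 * M). split; [lra|]. intros h Hh.
  assert (Hs1 : fst s <= - 1) by lra.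
  assert (Hs2 : fst (s + h)%C <= - 1).
  { simpl. generalize (Cmod_fst h) (Rle_abs (fst h)). lra. }
  assert (Hlim : clim (Rbar_locally p_infty)
     (fun r => R_prim (s + h) (0 + RtoC r * edir) - R_prim s (0 + RtoC r * edir))%C (R_ray (s + h) - R_ray s)%C)
    by (apply clim_minus; apply R_prim_lim; assumption).
  apply (clim_Cmod_le _ _ (fun _ => Cmod h * (2 * M)) _ Hlim (rlim_const _)).
  exists 0. intros r Hr. rewrite Cplus_0_l. set (x := (RtoC r * edir)%C).
  assert (Hx : slit_domain x).
  { apply slit_domain_upper. unfold x. rewrite edir_eq. simpl. generalize inv_sqrt2_bounds. nra. }
  destruct (ex_RInt_R_scaled (s + h) x Hs2 Hx) as [A1 A2].
  destruct (ex_RInt_R_scaled s x Hs1 Hx) as [B1 B2].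
  unfold R_prim. rewrite <- CRInt_minus by assumption.
  (* The bound e^(-rho) at rho = v^2 r times the density 2 v r; its integral 1 - e^(-r) stays below
     1. *)
  set (g := fun v : R => Cmod h * M * (2 * v * r * exp (- (v * v * r)))).
  assert (HI : is_RInt g 0 1 (Cmod h * M * (1 - exp (- r)))).
  { replace (Cmod h * M * (1 - exp (- r))) with
      ((fun v => - (Cmod h * M * exp (- (v * v * r)))) 1 - (fun v => - (Cmod h * M * exp (- (v * v * r)))) 0).
    - apply (is_RInt_derive (V := R_CompleteNormedModule) (fun v => - (Cmod h * M * exp (- (v * v * r))))).
      + intros v _. unfold g. auto_derive; [trivial|ring].
      + intros v _. apply (ex_derive_continuous g). unfold g. auto_derive; trivial.
    - cbv beta. rewrite !Rmult_1_l, !Rmult_0_l, Ropp_0, exp_0. ring. }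
  assert (HB : Cmod (CRInt (fun v => R_scaled (s + h) x v - R_scaled s x v)%C 0 1) <= 2 * (Cmod h * M * (1 - exp (- r)))).
  { apply CRInt_bound with g; [lra| | |exact HI|].
    - exact (ex_RInt_minus (V := R_NormedModule) _ _ _ _ A1 B1).
    - exact (ex_RInt_minus (V := R_NormedModule) _ _ _ _ A2 B2).
    - intros v Hv. unfold R_scaled, g.
      replace (RtoC (2 * v) * (x * R_integrand (s + h) (RtoC (v * v) * x)) - RtoC (2 * v) * (x * R_integrand s (RtoC (v * v) * x)))%C
        with (RtoC (2 * v) * (x * (R_integrand (s + h) (RtoC (v * v) * x) - R_integrand s (RtoC (v * v) * x))))%C by ring.
      assert (Ex : (RtoC (v * v) * x)%C = (RtoC (v * v * r) * edir)%C) by (unfold x; rewrite RtoC_mult, (RtoC_mult (v * v)); rewrite <- RtoC_mult; ring).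
      rewrite Ex, !Cmod_mult, Cmod_nonneg_R by lra.
      assert (Hxm : Cmod x = r) by (unfold x; rewrite Cmod_mult, Cmod_edir, Cmod_nonneg_R by lra; ring).
      rewrite Hxm. specialize (Hb h (v * v * r) Hh ltac:(apply Rmult_lt_0_compat; nra)).
      replace (Cmod h * M * (2 * v * r * exp (- (v * v * r)))) with (2 * v * (r * (Cmod h * (M * exp (- (v * v * r)))))) by ring.
      apply Rmult_le_compat_l; [lra|]. apply Rmult_le_compat_l; lra. }
  apply Rle_trans with (1 := HB).
  generalize (exp_pos (- r)) (Cmod_ge_0 h). intros E0 H0.
  assert (0 <= Cmod h * M) by (apply Rmult_le_pos; lra). nra.
Qed.

(** * The zeros of e^(pi i s) - 1 *)

Lemma Cexp_piI_even (s : C) (n : nat) :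
  s = RtoC (- (2 * INR n)) -> Cexp (PI * Ci * s) = 1%C.
Proof.
  intros ->. unfold Cexp. simpl.
  replace ((PI * 0 - 0 * 1) * - (2 * INR n) - (PI * 1 + 0 * 0) * 0) with 0 by ring.
  replace ((PI * 0 - 0 * 1) * 0 + (PI * 1 + 0 * 0) * - (2 * INR n)) with (- (0 + 2 * INR n * PI)) by ring.
  rewrite cos_neg, sin_neg, cos_period, sin_period, exp_0, cos_0, sin_0. apply C_eq; simpl; ring.
Qed.

Lemma Cexp_piI_eq_1 (s : C) :
  fst s <= - 1 -> Cexp (PI * Ci * s) = 1%C ->
  exists n : nat, (1 <= n)%nat /\ s = RtoC (- (2 * INR n)).
Proof.
  intros Hs E. generalize PI_RGT_0; intros HP.
  assert (Et : snd s = 0).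
  { apply (f_equal Cmod) in E. rewrite Cmod_Cexp, Cmod_1 in E.
    replace (fst (PI * Ci * s)%C) with (- (PI * snd s)) in E by (simpl; ring).
    rewrite <- exp_0 in E. apply exp_inv in E.
    apply (Rmult_eq_reg_l PI); lra. }
  apply (f_equal fst) in E. unfold Cexp in E. simpl in E.
  replace ((PI * 0 - 0 * 1) * fst s - (PI * 1 + 0 * 0) * snd s) with 0 in E by (rewrite Et; ring).
  replace ((PI * 0 - 0 * 1) * snd s + (PI * 1 + 0 * 0) * fst s) with (2 * (PI * fst s / 2)) in E by (rewrite Et; field).
  rewrite exp_0, cos_2a_sin in E.
  assert (Hsin : sin (PI * fst s / 2) = 0) by nra.
  apply sin_eq_0_0 in Hsin. destruct Hsin as [k Hk].
  assert (Ek : fst s = 2 * IZR k).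
  { apply (Rmult_eq_reg_l (PI / 2)); [|lra]. lra. }
  assert (Hk0 : (k <= -1)%Z).
  { assert (IZR k < 0) by lra. apply lt_IZR in H. lia. }
  exists (Z.to_nat (- k)). split; [lia|].
  rewrite INR_IZR_INZ, Z2Nat.id, opp_IZR by lia.
  apply C_eq; simpl; lra.
Qed.

(** * The region G in terms of eta *)

Lemma eta_components (s eta : C) :
  (2 * PI * Ci * eta * eta)%C = (s - 1)%C ->
  fst s - 1 = - (4 * PI * (fst eta * snd eta)) /\ snd s = 2 * PI * (fst eta ^ 2 - snd eta ^ 2).
Proof.
  intros H. split.
  - apply (f_equal fst) in H. simpl in H. lra.
  - apply (f_equal snd) in H. simpl in H. lra.
Qed.

(** With x = [fst eta] and y = [snd eta], the conditions of G become x^2 + y^2 >= 52^2 (as 5408 = 2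
    * 52^2), (x + 10 y) (10 x - y) >= 0 (the origin of 99/20), and 225 (x^2 - y^2) <= 8 (x y)^2. The
    second gives y <= 10 x and hence x >= 5; if y < 5, the third would force x < 3 y, against the
    first. *)
Lemma inG_eta_bounds (s eta : C) :
  inG s -> (2 * PI * Ci * eta * eta)%C = (s - 1)%C -> 0 < fst eta -> 0 < snd eta ->
  5 <= fst eta /\ 5 <= snd eta /\ 52 <= Cmod eta.
Proof.
  intros [G1 [G2 [G3 G4]]] H He1 He2. generalize PI_RGT_0; intros HP.
  destruct (eta_components s eta H) as [E1 E2].
  assert (Em : Cmod (s - 1) = 2 * PI * (fst eta ^ 2 + snd eta ^ 2)).
  { rewrite <- H, !Cmod_mult, Cmod_Ci, !Cmod_nonneg_R by lra. rewrite <- Cmod_sqr. ring. }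
  set (x := fst eta) in *. set (y := snd eta) in *.
  assert (Hm : 2704 <= x ^ 2 + y ^ 2).
  { apply (Rmult_le_reg_l (2 * PI)); [lra|]. lra. }
  assert (H3 : y <= 10 * x).
  { assert (A : - (99 / 10) * (x * y) <= x ^ 2 - y ^ 2).
    { apply (Rmult_le_reg_l (2 * PI)); [lra|]. nra. }
    apply Rnot_lt_le; intros Hlt. assert (0 < (x + 10 * y) * (y / 10 - x)) by (apply Rmult_lt_0_compat; lra). nra. }
  assert (H4 : 225 * (x ^ 2 - y ^ 2) <= 8 * (x * y) ^ 2).
  { apply (Rmult_le_reg_l (2 * PI * PI)); [nra|].
    rewrite E2 in G4. replace (1 - fst s) with (4 * PI * (x * y)) in G4 by lra. nra. }
  assert (X5 : 5 <= x).
  { apply Rnot_lt_le; intros Hlt. assert (y ^ 2 <= (10 * x) ^ 2) by (apply pow_incr; lra). nra. }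
  split; [exact X5|]. split.
  - apply Rnot_lt_le; intros Hlt. assert (Y : y ^ 2 < 25) by nra.
    replace ((x * y) ^ 2) with (x ^ 2 * y ^ 2) in H4 by ring. nra.
  - apply Cmod_ge_intro; [lra|]. fold x; fold y. lra.
Qed.

Lemma eta_square (s eta : C) :
  (eta * eta)%C = ((s - 1) / (2 * PI * Ci))%C <-> (2 * PI * Ci * eta * eta)%C = (s - 1)%C.
Proof.
  assert (HPc : RtoC PI <> 0%C) by (apply RtoC_neq_0; generalize PI_RGT_0; lra).
  assert (HCi : Ci <> 0%C) by (intros E; apply (f_equal snd) in E; simpl in E; lra).
  split; intros H.
  - transitivity (2 * PI * Ci * (eta * eta))%C; [ring|]. rewrite H. field. split; assumption.
  - rewrite <- H. field. split; assumption.
Qed.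

(** As [fst s <= 0], the product of the coordinates of eta is positive, and the condition on the
    argument excludes the third quadrant. *)
Lemma eta_first_quadrant (s eta : C) :
  fst s <= 0 -> (2 * PI * Ci * eta * eta)%C = (s - 1)%C ->
  - (PI / 4) < Arg eta < 3 * PI / 4 -> 0 < fst eta /\ 0 < snd eta.
Proof.
  intros Hs H HA. generalize PI_RGT_0; intros HP.
  destruct (eta_components s eta H) as [E1 _].
  assert (Hp : 0 < fst eta * snd eta) by nra.
  destruct (Rlt_dec 0 (fst eta)) as [H1|H1]; [split; [exact H1|nra]|].
  exfalso. assert (H2 : fst eta < 0) by (destruct (Req_dec (fst eta) 0) as [E|E]; [rewrite E in Hp; lra|lra]).
  assert (H3 : snd eta < 0) by nra.
  rewrite Arg_lower in HA by exact H3.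
  assert (0 < atan (fst eta / snd eta)).
  { rewrite <- atan_0. apply atan_increasing.
    replace (fst eta / snd eta) with ((- fst eta) / (- snd eta)) by (field; lra).
    apply Rdiv_lt_0_compat; lra. }
  lra.
Qed.

Lemma eta_exists (s : C) :
  fst s <= 0 -> exists eta : C,
    (2 * PI * Ci * eta * eta)%C = (s - 1)%C /\ 0 < fst eta /\ 0 < snd eta.
Proof.
  intros Hs. generalize PI_RGT_0; intros HP.
  set (q := ((s - 1) / (2 * PI * Ci))%C).
  assert (Hq : 0 < snd q).
  { unfold q. replace (snd ((s - 1) / (2 * PI * Ci))%C) with ((1 - fst s) / (2 * PI)).
    - apply Rdiv_lt_0_compat; lra.
    - simpl. field. lra. }
  exists (Cexp (Clog q / 2)). split.
  - apply eta_square. fold q. rewrite <- Cexp_plus.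
    replace (Clog q / 2 + Clog q / 2)%C with (Clog q) by field. apply Cexp_Clog. right; lra.
  - generalize (Arg_upper_bound q Hq); intros HA.
    assert (E : snd (Clog q / 2)%C = Arg q / 2) by (unfold Clog; simpl; field).
    set (w := (Clog q / 2)%C) in *.
    change (0 < exp (fst w) * cos (snd w) /\ 0 < exp (fst w) * sin (snd w)). rewrite E.
    split; apply Rmult_lt_0_compat; try apply exp_pos.
    + apply cos_gt_0; lra.
    + apply sin_gt_0; lra.
Qed.

(** One has (1 - s)/2 = - pi i eta^2. Since [Arg eta] lies in (0, pi/2), the proposed logarithm has
    imaginary part in (- pi/2, pi/2), so no multiple of 2 pi i intervenes. *)
Lemma Clog_half_eta (s eta : C) :
  (2 * PI * Ci * eta * eta)%C = (s - 1)%C -> 0 < fst eta -> 0 < snd eta ->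
  Clog ((1 - s) / 2) = (RtoC (ln PI) - RtoC (PI / 2) * Ci + 2 * Clog eta)%C.
Proof.
  intros H He1 He2. generalize PI_RGT_0; intros HP. apply Clog_unique.
  - rewrite Cexp_plus, Cexp_minus, Cexp_R, exp_ln by exact HP.
    replace (2 * Clog eta)%C with (Clog eta + Clog eta)%C by ring.
    rewrite Cexp_plus, Cexp_Clog by (left; exact He1).
    assert (E : Cexp (RtoC (PI / 2) * Ci) = Ci).
    { unfold Cexp. simpl. replace (PI / 2 * 0 - 0 * 1) with 0 by ring.
      replace (PI / 2 * 1 + 0 * 0) with (PI / 2) by ring. rewrite cos_PI2, sin_PI2, exp_0.
      apply C_eq; simpl; ring. }
    rewrite E. replace (1 - s)%C with (- (s - 1))%C by ring. rewrite <- H.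
    assert (HCi : Ci <> 0%C) by (intros E'; apply (f_equal snd) in E'; simpl in E'; lra).
    transitivity (RtoC PI * (- Ci) * (eta * eta))%C.
    + replace (- Ci)%C with (/ Ci)%C by (apply C_eq; simpl; field). field. exact HCi.
    + field.
  - generalize (Arg_first_quadrant eta He1 He2). unfold Clog. simpl. lra.
Qed.

(** * Assembly: the factorization, the zeros and their simplicity *)

Section Factorization.

Context (s eta : C).
Context (HG : inG s) (Heta : (2 * PI * Ci * eta * eta)%C = (s - 1)%C).
Context (He1 : 0 < fst eta) (He2 : 0 < snd eta).

Lemma inG_fst_le : fst s <= - 99.
Proof.
  destruct (inG_eta_bounds s eta HG Heta He1 He2) as [B1 [B2 B3]].
  destruct (eta_components s eta Heta) as [E1 _]. generalize PI_gt_3; intros HP.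
  assert (25 <= fst eta * snd eta) by nra. nra.
Qed.

Lemma saddle_amp_neq_0 : saddle_amp s eta <> 0%C.
Proof.
  unfold saddle_amp. apply Cmod_gt_0. rewrite Cmod_opp, Cmod_Cexp. apply exp_pos.
Qed.

(** The relative error is 0.44 sqrt 2, at most 0.44 / 0.7 < 0.63. *)
Lemma R_ray_factor :
  exists e : C, Cmod e <= 63 / 100 /\ R_ray s = (saddle_amp s eta * RtoC (1 / sqrt 2) * (1 + e))%C.
Proof.
  destruct (inG_eta_bounds s eta HG Heta He1 He2) as [B1 [B2 B3]].
  assert (H := R_ray_saddle s eta Heta B1 B2 B3).
  assert (HA := saddle_amp_neq_0). assert (HA0 := proj1 (Cmod_gt_0 _) HA).
  generalize inv_sqrt2_bounds; intros Hq.
  assert (Hq0 : RtoC (1 / sqrt 2) <> 0%C) by (apply RtoC_neq_0; lra).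
  set (A := saddle_amp s eta) in *. set (q := RtoC (1 / sqrt 2)) in *.
  exists ((R_ray s - A * q) / (A * q))%C. split.
  - assert (Hm : Cmod (A * q) = Cmod A * (1 / sqrt 2)) by (unfold q; rewrite Cmod_mult, Cmod_nonneg_R by lra; reflexivity).
    rewrite Cmod_div by (apply Cmult_neq_0; assumption). rewrite Hm.
    apply (Rmult_le_reg_r (Cmod A * (1 / sqrt 2))); [nra|].
    set (B := Cmod A * (1 / sqrt 2)). assert (HB : 7 / 10 * Cmod A <= B) by (unfold B; nra).
    replace (Cmod (R_ray s - A * q) / B * B) with (Cmod (R_ray s - A * q)) by (field; lra). lra.
  - field. split; assumption.
Qed.

Lemma R_ray_neq_0 : R_ray s <> 0%C.
Proof.
  destruct R_ray_factor as [e [He E]]. rewrite E.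
  apply Cmult_neq_0; [apply Cmult_neq_0; [apply saddle_amp_neq_0|]|].
  - apply RtoC_neq_0. generalize inv_sqrt2_bounds; lra.
  - apply Cmod_gt_0. generalize (Cmod_triangle_rev 1 (- e)). rewrite Cmod_1, Cmod_opp.
    replace (1 - - e)%C with (1 + e)%C by ring. lra.
Qed.

(** Isolates the dominant exponential of the trigonometric quotient in the upper half-plane, where q
    is small. *)
Lemma sin_cos_ratio (q : C) :
  q = Cexp (2 * PI * Ci * eta) -> (1 + q * q)%C <> 0%C ->
  (Csin (RtoC PI * eta) / (2 * Ccos (2 * RtoC PI * eta)))%C =
  (Ci / 2 * Cexp (PI * Ci * eta) * ((1 - q) / (1 + q * q)))%C.
Proof.
  intros Hq H0. rewrite Csin_alt. unfold Ccos.
  replace (Ci * (RtoC PI * eta))%C with (PI * Ci * eta)%C by ring.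
  replace (Ci * (2 * RtoC PI * eta))%C with (2 * PI * Ci * eta)%C by ring.
  rewrite !Cexp_opp, <- Hq.
  assert (EE : q = (Cexp (PI * Ci * eta) * Cexp (PI * Ci * eta))%C).
  { rewrite Hq, <- Cexp_plus. f_equal. ring. }
  assert (HE := Cexp_neq_0 (PI * Ci * eta)). set (E := Cexp (PI * Ci * eta)) in *.
  rewrite EE in *. field. repeat split; assumption.
Qed.

Theorem Raux_factorization :
  exists U : C, Cmod U < 9 / 10 /\
    Raux s =
      (- chi s * Cpowc eta (s - 1)%C * Cexp (- (PI * Ci * eta * eta)) *
       (RtoC (sqrt 2) * Cexp (Ci * RtoC (3 * PI / 8)) * Csin (RtoC PI * eta)
        / (2 * Ccos (2 * RtoC PI * eta))) * (1 + U))%C.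
Proof.
  destruct (inG_eta_bounds s eta HG Heta He1 He2) as [B1 [B2 B3]].
  generalize PI_gt_3 inG_fst_le; intros HP Hs.
  assert (Hp : 1000 <= Cmod (1 - s)).
  { rewrite Cmod_minus_sym. destruct HG as [_ [G2 _]]. lra. }
  destruct (chi_asymptotic s ltac:(lra) Hp) as [E [HE Echi]].
  destruct R_ray_factor as [e [He ER]].
  set (q := Cexp (2 * PI * Ci * eta)).
  assert (Hq : Cmod q <= 1 / 180).
  { destruct (saddle_upper_factor eta ltac:(lra)) as [_ [_ H]].
    unfold upper_factor in H. fold q in H. replace (1 - q - 1)%C with (- q)%C in H by ring.
    rewrite Cmod_opp in H. exact H. }
  generalize (Cmod_ge_0 q); intros Hq0.
  assert (Q1 : 179 / 180 <= Cmod (1 - q)).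
  { apply Rle_trans with (2 := Cmod_triangle_rev _ _). rewrite Cmod_1. lra. }
  assert (Q2 : Cmod (1 + q * q) <= 181 / 180).
  { apply Rle_trans with (1 := Cmod_triangle _ _). rewrite Cmod_1, Cmod_mult. nra. }
  assert (Q3 : 179 / 180 <= Cmod (1 + q * q)).
  { replace (1 + q * q)%C with (1 - - (q * q))%C by ring.
    apply Rle_trans with (2 := Cmod_triangle_rev _ _). rewrite Cmod_1, Cmod_opp, Cmod_mult. nra. }
  assert (N1 : (1 - q)%C <> 0%C) by (apply Cmod_gt_0; lra).
  assert (N2 : (1 + q * q)%C <> 0%C) by (apply Cmod_gt_0; lra).
  assert (HEm : 96 / 100 <= Cmod E).
  { generalize (Cmod_triangle_rev 1 (1 - E)). replace (1 - (1 - E))%C with E by ring.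
    rewrite Cmod_1, Cmod_minus_sym. lra. }
  assert (HE0 : E <> 0%C) by (apply Cmod_gt_0; lra).
  (* The three sources of error together: e from the saddle point, E from Stirling's formula, q from
     the trigonometric quotient. *)
  set (U := ((1 + e) * (1 + q * q) / (E * (1 - q)) - 1)%C).
  exists U. split.
  - assert (HD : Cmod (E * (1 - q)) >= 95 / 100) by (rewrite Cmod_mult; nra).
    assert (HD0 : (E * (1 - q))%C <> 0%C) by (apply Cmult_neq_0; assumption).
    replace U with ((e * (1 + q * q) + (q * q + q - (E - 1) * (1 - q))) / (E * (1 - q)))%C
      by (unfold U; field; split; assumption).
    rewrite Cmod_div by exact HD0.
    (* The numerator is at most (0.63 + 0.04) * 181/180 + |q|^2 + |q| < 0.70, and 0.70 / 0.95 <
       0.9. *)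
    assert (HN : Cmod (e * (1 + q * q) + (q * q + q - (E - 1) * (1 - q))) <= 70 / 100).
    { apply Rle_trans with (1 := Cmod_triangle _ _). rewrite Cmod_mult.
      generalize (Cmod_triangle (q * q + q) (- ((E - 1) * (1 - q)))) (Cmod_triangle (q * q) q) (Cmod_triangle 1 (- q)).
      rewrite !Cmod_opp, !Cmod_mult, Cmod_1. fold (Cminus 1 q). fold (Cminus (q * q + q) ((E - 1) * (1 - q))).
      generalize (Cmod_ge_0 e) (Cmod_ge_0 (1 + q * q)) (Cmod_ge_0 (E - 1)) (Cmod_ge_0 (1 - q)).
      intros. assert (Cmod e * Cmod (1 + q * q) <= 63 / 100 * (181 / 180)) by (apply Rmult_le_compat; lra).
      assert (Cmod (E - 1) * Cmod (1 - q) <= 4 / 100 * (181 / 180)) by (apply Rmult_le_compat; lra).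
      nra. }
    apply (Rmult_lt_reg_r (Cmod (E * (1 - q)))); [lra|].
    unfold Rdiv. rewrite Rmult_assoc, Rinv_l by lra. lra.
  - rewrite Raux_eq_ray, ER, Echi by lra.
    rewrite (Clog_half_eta s eta Heta He1 He2).
    replace (1 + U)%C with ((1 + e) * (1 + q * q) / (E * (1 - q)))%C by (unfold U; ring).
    replace (RtoC (sqrt 2) * Cexp (Ci * RtoC (3 * PI / 8)) * Csin (RtoC PI * eta) / (2 * Ccos (2 * RtoC PI * eta)))%C
      with (RtoC (sqrt 2) * Cexp (Ci * RtoC (3 * PI / 8)) * (Csin (RtoC PI * eta) / (2 * Ccos (2 * RtoC PI * eta))))%C
      by (unfold Cdiv; ring).
    rewrite (sin_cos_ratio q eq_refl N2).
    set (S := Csin (RtoC PI * (s / 2))).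
    (* The factor S is kept on both sides and never divided out, so the formula also holds at the
       trivial zeros. *)
    assert (ES : (Cexp (PI * Ci * s) - 1)%C = (2 * Ci * Cexp (PI * Ci * s / 2) * S)%C).
    { unfold S. rewrite Csin_alt.
      replace (Ci * (RtoC PI * (s / 2)))%C with (PI * Ci * s / 2)%C by field.
      rewrite Cexp_opp.
      replace (Cexp (PI * Ci * s)) with (Cexp (PI * Ci * s / 2) * Cexp (PI * Ci * s / 2))%C
        by (rewrite <- Cexp_plus; f_equal; field).
      assert (H0 := Cexp_neq_0 (PI * Ci * s / 2)). set (F := Cexp (PI * Ci * s / 2)) in *.
      transitivity (- (Ci * Ci) * (F * F - 1))%C; [rewrite Ci_sqr; ring|]. field. exact H0. }
    rewrite ES. unfold Cpowc, saddle_amp.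
    assert (Hsq : RtoC (1 / sqrt 2) = (RtoC (sqrt 2) / 2)%C).
    { assert (Hs2 := sqrt_lt_R0 2 ltac:(lra)).
      replace (RtoC (sqrt 2) / 2)%C with (RtoC (sqrt 2 / 2)) by (rewrite RtoC_div by lra; reflexivity).
      f_equal. apply (Rmult_eq_reg_r (sqrt 2)); [|lra].
      replace (1 / sqrt 2 * sqrt 2) with 1 by (field; lra).
      replace (sqrt 2 / 2 * sqrt 2) with (sqrt 2 * sqrt 2 / 2) by field. rewrite sqrt_sqrt by lra. field. }
    rewrite Hsq.
    set (L := Clog eta). set (lp := RtoC (ln PI)).
    set (X1 := Cexp (PI * Ci * s / 2)).
    set (Y1 := Cexp (- s * L + PI * Ci * eta * eta + PI * Ci * eta + RtoC (PI / 8) * Ci)).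
    set (X2 := Cexp ((s - RtoC (1 / 2)) * lp + (1 - s - RtoC (1 / 2)) * (lp - RtoC (PI / 2) * Ci + 2 * L) - (1 - s))).
    set (X3 := Cexp ((s - 1) * L)). set (X4 := Cexp (- (PI * Ci * eta * eta))).
    set (X5 := Cexp (Ci * RtoC (3 * PI / 8))). set (X6 := Cexp (PI * Ci * eta)).
    (* With s = 1 + 2 pi i eta^2 substituted, the exponents on the two sides agree as polynomial
       expressions in eta, [L] and [lp]. *)
    assert (HX : (X1 * Y1 = X2 * X3 * X4 * X5 * X6)%C).
    { unfold X1, Y1, X2, X3, X4, X5, X6. rewrite <- !Cexp_plus. f_equal.
      replace (RtoC (3 * PI / 8)) with (3 * RtoC PI / 8)%C by (rewrite RtoC_div, RtoC_mult by lra; reflexivity).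
      replace (RtoC (PI / 8)) with (RtoC PI / 8)%C by (rewrite RtoC_div by lra; reflexivity).
      replace (RtoC (PI / 2)) with (RtoC PI / 2)%C by (rewrite RtoC_div by lra; reflexivity).
      replace (RtoC (1 / 2)) with (/ 2)%C by (rewrite RtoC_div by lra; field).
      assert (Es : s = (1 + 2 * PI * Ci * eta * eta)%C) by (rewrite Heta; ring).
      clearbody L lp. rewrite Es. field. }
    transitivity (- (Ci * RtoC (sqrt 2) * S * (1 + e)) * (X1 * Y1))%C; [field|].
    rewrite HX. field. repeat split; assumption.
Qed.

Theorem Raux_zero_iff :
  Raux s = 0%C <-> exists n : nat, (1 <= n)%nat /\ s = RtoC (- (2 * INR n)).
Proof.
  generalize inG_fst_le; intros Hs. rewrite Raux_eq_ray by lra. split.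
  - intros H. apply Cexp_piI_eq_1; [lra|].
    assert (E : (Cexp (PI * Ci * s) - 1)%C = 0%C).
    { replace (Cexp (PI * Ci * s) - 1)%C with ((Cexp (PI * Ci * s) - 1) * R_ray s / R_ray s)%C
        by (field; apply R_ray_neq_0).
      rewrite H. unfold Cdiv. ring. }
    replace (Cexp (PI * Ci * s)) with ((Cexp (PI * Ci * s) - 1) + 1)%C by ring.
    rewrite E. ring.
  - intros [n [_ Hn]]. rewrite (Cexp_piI_even s n Hn). ring.
Qed.

Theorem Raux_zero_simple :
  Raux s = 0%C -> exists d : C, is_derive Raux s d /\ d <> 0%C.
Proof.
  intros H0. generalize inG_fst_le PI_RGT_0; intros Hs HP.
  destruct (proj1 Raux_zero_iff H0) as [n [_ Hn]].
  assert (E1 := Cexp_piI_even s n Hn).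
  destruct (R_ray_lipschitz s ltac:(lra)) as [K [HK HL]].
  exists (PI * Ci * R_ray s)%C. split.
  - apply is_derive_C_intro with (PI ^ 2 * exp PI * (Cmod (R_ray s) + K) + PI * K).
    intros y Hy. set (h := (y - s)%C) in *.
    assert (Ey : y = (s + h)%C) by (unfold h; ring).
    rewrite H0. rewrite Ey at 1. specialize (HL h Hy).
    rewrite Raux_eq_ray.
    2: { change (fst s + fst h <= - 1). generalize (Cmod_fst h) (Rle_abs (fst h)). lra. }
    replace (PI * Ci * (s + h))%C with (PI * Ci * s + PI * Ci * h)%C by ring.
    rewrite Cexp_plus, E1.
    set (w := (PI * Ci * h)%C).
    (* The first term is quadratic in h by Taylor's formula, the second by the Lipschitz bound;
       differentiability of J is avoided. *)
    replace ((1 * Cexp w - 1) * R_ray (s + h) - 0 - h * (PI * Ci * R_ray s))%C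
      with ((Cexp w - 1 - w) * R_ray (s + h) + w * (R_ray (s + h) - R_ray s))%C by (unfold w; ring).
    apply Rle_trans with (1 := Cmod_triangle _ _). rewrite !Cmod_mult.
    assert (Hw : Cmod w = PI * Cmod h) by (unfold w; rewrite !Cmod_mult, Cmod_Ci, Cmod_nonneg_R by lra; ring).
    generalize (Cmod_ge_0 h) (Cmod_ge_0 (R_ray s)) (Cmod_ge_0 (R_ray (s + h))); intros P1 P2 P3.
    assert (HR : Cmod (R_ray (s + h)) <= Cmod (R_ray s) + K).
    { generalize (Cmod_triangle_rev (R_ray (s + h)) (R_ray s)). nra. }
    assert (HT : Cmod (Cexp w - 1 - w) <= PI ^ 2 * exp PI * Cmod h ^ 2).
    { apply Rle_trans with (1 := Cmod_Cexp_taylor1 w). rewrite Hw.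
      replace ((PI * Cmod h) ^ 2) with (PI ^ 2 * Cmod h ^ 2) by ring.
      replace (PI ^ 2 * exp PI * Cmod h ^ 2) with (PI ^ 2 * Cmod h ^ 2 * exp PI) by ring.
      apply Rmult_le_compat_l; [apply Rmult_le_pos; apply pow2_ge_0|]. apply exp_le. nra. }
    assert (HA : Cmod (Cexp w - 1 - w) * Cmod (R_ray (s + h)) <= PI ^ 2 * exp PI * Cmod h ^ 2 * (Cmod (R_ray s) + K))
      by (apply Rmult_le_compat; try apply Cmod_ge_0; assumption).
    assert (HB : Cmod w * Cmod (R_ray (s + h) - R_ray s) <= PI * Cmod h * (Cmod h * K)).
    { rewrite Hw. apply Rmult_le_compat_l; [nra|exact HL]. }
    lra.
  - apply Cmult_neq_0; [apply Cmult_neq_0|apply R_ray_neq_0].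
    + apply RtoC_neq_0; lra.
    + intros E. apply (f_equal snd) in E. simpl in E. lra.
Qed.

End Factorization.

Theorem mainTheorem6 :
  forall s : C, inG s ->
    (forall eta : C,
       (eta * eta)%C = ((s - 1) / (2 * RtoC PI * Ci))%C ->
       - (PI / 4) < Arg eta < 3 * PI / 4 ->
       exists U : C, Cmod U < 9 / 10 /\
         Raux s =
           (- chi s * Cpowc eta (s - 1)%C * Cexp (- (RtoC PI * Ci * eta * eta)) *
            (RtoC (sqrt 2) * Cexp (Ci * RtoC (3 * PI / 8)) * Csin (RtoC PI * eta)
             / (2 * Ccos (2 * RtoC PI * eta))) * (1 + U))%C)
    /\ (Raux s = 0%C <-> exists n : nat, (1 <= n)%nat /\ s = RtoC (- (2 * INR n)))
    /\ (Raux s = 0%C -> exists d : C, is_derive Raux s d /\ d <> 0%C).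
Proof.
  intros s HG. assert (Hs : fst s <= 0) by apply HG.
  split.
  - intros eta Hsq HA. apply eta_square in Hsq.
    destruct (eta_first_quadrant s eta Hs Hsq HA) as [H1 H2].
    exact (Raux_factorization s eta HG Hsq H1 H2).
  (* The statements about zeros do not mention eta, so a square root in the first quadrant is
     supplied. *)
  - destruct (eta_exists s Hs) as [eta [Hsq [H1 H2]]]. split.
    + exact (Raux_zero_iff s eta HG Hsq H1 H2).
    + exact (Raux_zero_simple s eta HG Hsq H1 H2).
Qed.
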